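(* Let $G=\langle\sigma,\tau\mid\sigma^n=\tau^{2m}=e,\ \tau\sigma\tau^{-1}=\sigma^{-1}\rangle$ where $n,m\ge1$ and $\gcd(n,2m)=1$. Let $\mathbb{F}$ be a field of characteristic zero containing a primitive root of unity of order $|G|$. Let $k\ge1$ be an integer and let $\mathbb{F}(G)=Z(D_{G,k})$ be the center of the generic $G$-crossed product over $\mathbb{F}$. Then $\mathbb{F}(G)/\mathbb{F}$ is a stably rational extension.
   Context: Generic crossed product. Let $G$ be a finite group, $\mathbb{F}$ a field of characteristic zero, $k\ge1$. Take indeterminates $x_{h,g}^{(i)}$ ($h,g\in G$, $1\le i\le k$) algebraically independent over $\mathbb{F}$, and index rows and columns of matrices in $M_{|G|}(\mathbb{F}(x_{h,g}^{(i)}))$ by $G$, with matrix units $E_{g,h}$. For $g\in G$, $1\le i\le k$ put $X_{g,i}=\sum_{h\in G}x^{(i)}_{h,hg}E_{h,hg}$. Let $R_{G,k}$ be the unital $\mathbb{F}$-subalgebra generated by all $X_{g,i}$ ($g\in G$, $1\le i\le k$). The generic $G$-crossed product $D_{G,k}$ is obtained from $R_{G,k}$ by inverting all its nonzero central elements; its center is denoted $\mathbb{F}(G)=Z(D_{G,k})$ and is a field extension of $\mathbb{F}$. A finitely generated field extension $\mathbb{L}/\mathbb{F}$ is rational if it is purely transcendental, i.e. $\mathbb{L}=\mathbb{F}(x_1,\dots,x_n)$ with the $x_i$ algebraically independent over $\mathbb{F}$; it is stably rational if $\mathbb{L}(y_1,\dots,y_r)$ is rational over $\mathbb{F}$ for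 some $y_1,\dots,y_r$ algebraically independent over $\mathbb{L}$. *)

(* Defs.v *)
From HB Require Import structures.
From mathcomp Require Import all_boot all_order all_fingroup all_algebra.
From mathcomp Require Import mpoly.
From mathcomp Require boolp.

Set Implicit Arguments.
Unset Strict Implicit.
Unset Printing Implicit Defensive.

Import GRing.Theory.
Local Open Scope ring_scope.

(* A field extension L/F is a ring morphism [iota : F -> L], necessarily
   injective. *)
Section Rationality.

Definition alg_independent (F L : fieldType) (iota : {rmorphism F -> L})
    (n : nat) (x : 'I_n -> L) : Prop :=
  forall p : {mpoly F[n]}, mmap iota x p = 0 -> p = 0.

Definition field_generated (F L : fieldType) (iota : {rmorphism F -> L})
    (n : nat) (x : 'I_n -> L) : Prop :=
  forall z : L, exists p q : {mpoly F[n]},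
    mmap iota x q != 0 /\ z = mmap iota x p / mmap iota x q.

Definition pure_basis (F L : fieldType) (iota : {rmorphism F -> L})
    (n : nat) (x : 'I_n -> L) : Prop :=
  alg_independent iota x /\ field_generated iota x.

Definition rational_ext (F L : fieldType) (iota : {rmorphism F -> L}) : Prop :=
  exists (n : nat) (x : 'I_n -> L), pure_basis iota x.

Definition stably_rational_ext (F L : fieldType) (iota : {rmorphism F -> L}) :
    Prop :=
  exists (r : nat) (E : fieldType) (kappa : {rmorphism L -> E})
         (y : 'I_r -> E),
    pure_basis kappa y /\ rational_ext (kappa \o iota).

End Rationality.

Inductive gen_subalg (F : fieldType) (A : pzRingType) (f : F -> A)
    (S : A -> Prop) : A -> Prop :=
  | GenScalar a : gen_subalg f S (f a)
  | GenIn u : S u -> gen_subalg f S u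
  | GenAdd u v : gen_subalg f S u -> gen_subalg f S v -> gen_subalg f S (u + v)
  | GenMul u v : gen_subalg f S u -> gen_subalg f S v -> gen_subalg f S (u * v).

Definition center_of (A : pzRingType) (S : A -> Prop) (z : A) : Prop :=
  S z /\ forall u, S u -> z * u = u * z.

Section ScalarFractions.

Variables (K : fieldType) (m : nat).
Implicit Types (a b : K) (r s : 'M[K]_m).

Lemma frac_mxB a b r s : a != 0 -> b != 0 ->
  a^-1 *: r - b^-1 *: s = (a * b)^-1 *: (r * b%:M - s * a%:M).
Proof.
move=> a0 b0; rewrite -[r * _]/(r *m _) -[s * _]/(s *m _) !mul_mx_scalar.
rewrite scalerBr !scalerA invfM mulfVK // -mulrA [b^-1 * a]mulrC mulrA.
by rewrite mulVf // mul1r.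
Qed.

Lemma frac_mxM a b r s :
  (a^-1 *: r) * (b^-1 *: s) = (a * b)^-1 *: (r * s).
Proof.
rewrite -[_ * (_ *: s)]/(_ *m _) -[r * s]/(r *m s).
by rewrite -scalemxAl -scalemxAr scalerA invfM.
Qed.

Lemma frac_mxV a b : a != 0 -> (a * b)^-1 *: a%:M = (b^-1)%:M :> 'M[K]_m.
Proof.
by move=> a0; rewrite scale_scalar_mx invfM mulrAC mulVf // mul1r.
Qed.

Lemma unfrac_mx a r s : a != 0 -> r = a^-1 *: s -> s = a *: r.
Proof. by move=> a0 ->; rewrite scalerA divff // scale1r. Qed.

End ScalarFractions.

Section CrossedProduct.

Variables (F K : fieldType) (iota : {rmorphism F -> K}).
Variables (G : finGroupType) (k : nat) (x : G -> G -> 'I_k -> K).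

Local Notation cp_matrix := 'M[K]_#|G|.

Definition matrix_unit (g h : G) : cp_matrix :=
  delta_mx (enum_rank g) (enum_rank h).

Definition cp_gen (g : G) (i : 'I_k) : cp_matrix :=
  \sum_(h : G) x h (h * g)%g i *: matrix_unit h (h * g)%g.

Definition cp_scalar (a : F) : cp_matrix := (iota a)%:M.

Definition cp_ring : cp_matrix -> Prop :=
  gen_subalg cp_scalar (fun u => exists g i, u = cp_gen g i).

(* The localization of [cp_ring] at its nonzero central elements, realised
   inside the matrix ring. If the [x h g i] are nonzero and pairwise distinct,
   these elements are invertible matrices (see [center_cp_ring_unit] below), so
   this is the set of fractions r c^-1. *)
Definition cp_localization (d : cp_matrix) : Prop :=
  exists r c : cp_matrix,
    [/\ cp_ring r, center_of cp_ring c, c != 0 & d = r * invmx c].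

Definition cp_center_pred : {pred cp_matrix} :=
  fun z => boolp.asbool (center_of cp_localization z).

Lemma cp_centerP z :
  reflect (center_of cp_localization z) (z \in cp_center_pred).
Proof. exact: boolp.asboolP. Qed.

Lemma cp_card_gt0 : (0 < #|G|)%N.
Proof. by apply/card_gt0P; exists 1%g. Qed.

Lemma cp_one_neq0 : (1 : cp_matrix) != 0.
Proof.
apply/eqP => /matrixP /(_ (Ordinal cp_card_gt0) (Ordinal cp_card_gt0)).
by rewrite !mxE eqxx => /eqP; rewrite oner_eq0.
Qed.

Lemma cp_scaleAl (a : K) (u v : cp_matrix) :
  a *: (u * v) = (a *: u) * v.
Proof. exact: scalemxAl. Qed.

Lemma cp_scaleAr (a : K) (u v : cp_matrix) :
  a *: (u * v) = u * (a *: v).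
Proof. exact: scalemxAr. Qed.

Lemma mul_cp_genl g i (z : cp_matrix) (a b : G) :
  (cp_gen g i * z) (enum_rank a) (enum_rank b) =
  x a (a * g)%g i * z (enum_rank (a * g)%g) (enum_rank b).
Proof.
rewrite /cp_gen mulr_suml summxE (bigD1 a) //= big1 ?addr0 => [|h ha].
  rewrite -cp_scaleAl mxE; congr (_ * _).
  rewrite -[_ * z]/(_ *m z) mxE (bigD1 (enum_rank (a * g)%g)) //= big1 ?addr0.
    by rewrite mxE !eqxx mul1r.
  by move=> j /negPf hj; rewrite mxE hj andbF mul0r.
rewrite -cp_scaleAl mxE -[_ * z]/(_ *m z) mxE big1 ?mulr0 // => j _.
by rewrite mxE (inj_eq enum_rank_inj) [a == h]eq_sym (negPf ha) mul0r.
Qed.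

Lemma mul_cp_genr g i (z : cp_matrix) (a b : G) :
  (z * cp_gen g i) (enum_rank a) (enum_rank (b * g)%g) =
  z (enum_rank a) (enum_rank b) * x b (b * g)%g i.
Proof.
rewrite /cp_gen mulr_sumr summxE (bigD1 b) //= big1 ?addr0 => [|h hb].
  rewrite -cp_scaleAr mxE mulrC; congr (_ * _).
  rewrite -[z * _]/(z *m _) mxE (bigD1 (enum_rank b)) //= big1 ?addr0.
    by rewrite mxE !eqxx mulr1.
  by move=> j /negPf hj; rewrite mxE hj mulr0.
rewrite -cp_scaleAr mxE -[z * _]/(z *m _) mxE big1 ?mulr0 // => j _.
rewrite mxE !(inj_eq enum_rank_inj) (inj_eq (mulIg g)).
by rewrite [b == h]eq_sym (negPf hb) andbF mulr0.
Qed.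

Hypothesis x_neq0 : forall h g i, x h g i != 0.
Hypothesis x_inj : forall h g i h' g' i',
  x h g i = x h' g' i' -> (h, g, i) = (h', g', i').

Lemma cp_ring_commutant_scalar (z : cp_matrix) :
  (0 < k)%N -> (forall u, cp_ring u -> z * u = u * z) ->
  exists a, z = a%:M.
Proof.
move=> k_gt0 zC; pose i := Ordinal k_gt0.
have zX g : z * cp_gen g i = cp_gen g i * z.
  by apply: zC; apply: GenIn; exists g, i.
have zdiag a b : a != b -> z (enum_rank a) (enum_rank b) = 0.
  move=> ab; have := mul_cp_genr 1%g i z a b.
  rewrite zX mulg1 mul_cp_genl mulg1 mulrC => /eqP.
  rewrite -subr_eq0 -mulrBr mulf_eq0 subr_eq0 => /orP[/eqP //|/eqP].
  by move/x_inj => [e _]; rewrite e eqxx in ab.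
have zcst g : z (enum_rank 1%g) (enum_rank 1%g) = z (enum_rank g) (enum_rank g).
  have := mul_cp_genr g i z 1%g 1%g.
  rewrite zX mul_cp_genl mul1g mulrC => /eqP.
  by rewrite (inj_eq (mulIf (x_neq0 _ _ _))) => /eqP ->.
exists (z (enum_rank 1%g) (enum_rank 1%g)); apply/matrixP => a b.
rewrite -[a]enum_valK -[b]enum_valK [RHS]mxE (inj_eq enum_rank_inj).
have [->|ne] := eqVneq (enum_val a) (enum_val b); first by rewrite mulr1n -zcst.
by rewrite mulr0n zdiag.
Qed.

Lemma cp_ring_scalar (z : cp_matrix) :
  cp_ring z -> (forall u, cp_ring u -> z * u = u * z) ->
  exists a, z = a%:M.
Proof.
move=> Rz zC; have [k0|] := posnP k; last first.
  by move/cp_ring_commutant_scalar; apply.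
elim: Rz {zC} => [a|u [g [i _]]|u v _ [a ->] _ [b ->]|u v _ [a ->] _ [b ->]].
- by eexists.
- by move: (leq_trans (ltn_ord i) (eq_leq k0)).
- by exists (a + b); rewrite raddfD.
- by exists (a * b); rewrite -[_ * _]/(_ *m _) scalar_mxM.
Qed.

Lemma center_cp_ring_unit (c : cp_matrix) :
  center_of cp_ring c -> c != 0 -> c \in unitmx.
Proof.
move=> [Rc /(cp_ring_scalar Rc) [a ->]] a0.
rewrite unitmxE det_scalar unitrX // unitfE.
by apply: contraNneq a0 => ->; rewrite raddf0.
Qed.

Lemma cp_localizationP (d : cp_matrix) :
  cp_localization d <->
  exists (r : cp_matrix) (a : K),
    [/\ cp_ring r, cp_ring (a%:M : cp_matrix), a != 0
      & d = a^-1 *: r].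
Proof.
split=> [[r [c [Rr cC c0 ->]]]|[r [a [Rr Ra a0 ->]]]].
  have [Rc /(cp_ring_scalar Rc) [a ca]] := cC; exists r, a.
  rewrite -ca; split=> //; first by apply: contraNneq c0; rewrite ca => ->; rewrite raddf0.
  by rewrite ca invmx_scalar -[r * _]/(r *m _) mul_mx_scalar.
exists r, a%:M; split=> //; last first.
- by rewrite invmx_scalar -[r * _]/(r *m _) mul_mx_scalar.
- by rewrite -[a%:M]scalemx1 scaler_eq0 negb_or a0 cp_one_neq0.
split=> // u _; rewrite -[_ * u]/(_ *m u) -[u * _]/(u *m _).
by rewrite mul_mx_scalar mul_scalar_mx.
Qed.

Lemma cp_scalar_zmod : zmod_morphism cp_scalar.
Proof. by move=> a b; rewrite /cp_scalar !raddfB. Qed.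

Lemma cp_scalar_monoid : monoid_morphism cp_scalar.
Proof.
split=> [|a b]; first by rewrite /cp_scalar rmorph1.
by rewrite /cp_scalar rmorphM -[RHS]/(_ *m _) scalar_mxM.
Qed.

Lemma cp_ring1 : cp_ring 1.
Proof. by have [<- _] := cp_scalar_monoid; apply: GenScalar. Qed.

Lemma cp_ringN u : cp_ring u -> cp_ring (- u).
Proof.
move=> Ru; rewrite -mulN1r; apply: GenMul => //.
have -> : -1 = cp_scalar (-1) :> cp_matrix.
  by rewrite /cp_scalar rmorphN1 raddfN.
exact: GenScalar.
Qed.

Lemma cp_ring_localization u :
  cp_ring u -> cp_localization u.
Proof.
move=> Ru; apply/cp_localizationP; exists u, 1.
split=> //; [exact: cp_ring1 | exact: oner_neq0 | by rewrite invr1 scale1r].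
Qed.

Lemma cp_localizationB u v : cp_localization u -> cp_localization v ->
  cp_localization (u - v).
Proof.
move=> /cp_localizationP [r [a [Rr Ra a0 ->]]].
move=> /cp_localizationP [s [b [Rs Rb b0 ->]]].
apply/cp_localizationP; exists (r * b%:M - s * a%:M), (a * b).
split.
- by apply: GenAdd; [|apply: cp_ringN]; apply: GenMul.
- by rewrite scalar_mxM; apply: GenMul.
- exact: mulf_neq0 a0 b0.
- exact: frac_mxB.
Qed.

Lemma cp_localizationM u v : cp_localization u -> cp_localization v ->
  cp_localization (u * v).
Proof.
move=> /cp_localizationP [r [a [Rr Ra a0 ->]]].
move=> /cp_localizationP [s [b [Rs Rb b0 ->]]].
apply/cp_localizationP; exists (r * s), (a * b).
split.
- exact: GenMul.
- by rewrite scalar_mxM; apply: GenMul.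
- exact: mulf_neq0 a0 b0.
- exact: frac_mxM.
Qed.

Lemma cp_center_scalar z :
  center_of cp_localization z -> exists a : K, z = a%:M.
Proof.
move=> [/cp_localizationP [r [a [Rr Ra a0 ez]]] zC].
have er : r = a *: z := unfrac_mx a0 ez.
suff [b eb] : exists b : K, r = b%:M.
  by exists (a^-1 * b); rewrite ez eb scale_scalar_mx.
apply: cp_ring_scalar => // u Ru.
by rewrite er -cp_scaleAl -cp_scaleAr zC //; apply: cp_ring_localization.
Qed.

Lemma cp_center_scalarP (a : K) :
  reflect (cp_localization a%:M) ((a%:M : cp_matrix) \in cp_center_pred).
Proof.
apply: (iffP (cp_centerP _)) => [[] //|Da]; split=> // u _.
rewrite -[_ * u]/(_ *m u) -[u * _]/(u *m _).
by rewrite mul_mx_scalar mul_scalar_mx.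
Qed.

Lemma cp_center_subring : subring_closed cp_center_pred.
Proof.
split.
- apply/cp_center_scalarP; exact/cp_ring_localization/cp_ring1.
- move=> _ _ /[dup] /cp_centerP /cp_center_scalar [a ->] Da
             /[dup] /cp_centerP /cp_center_scalar [b ->] Db.
  rewrite -raddfB; apply/cp_center_scalarP; rewrite raddfB.
  by apply: cp_localizationB; apply/cp_center_scalarP.
- move=> _ _ /[dup] /cp_centerP /cp_center_scalar [a ->] Da
             /[dup] /cp_centerP /cp_center_scalar [b ->] Db.
  rewrite -[_ * _]/(_ *m _) -scalar_mxM.
  apply/cp_center_scalarP; rewrite scalar_mxM.
  by apply: cp_localizationM; apply/cp_center_scalarP.
Qed.

Lemma cp_center_inv z :
  z \in cp_center_pred -> invmx z \in cp_center_pred.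
Proof.
move=> /[dup] /cp_centerP /cp_center_scalar [b ->].
have [->|b0] := eqVneq b 0.
  by rewrite invmx_scalar invr0.
move=> /cp_center_scalarP /cp_localizationP.
move=> [r [a [Rr Ra a0 e]]]; rewrite invmx_scalar; apply/cp_center_scalarP.
have er : r = (a * b)%:M by rewrite (unfrac_mx a0 e) scale_scalar_mx.
apply/cp_localizationP; exists a%:M, (a * b); split.
- exact: Ra.
- by rewrite -er.
- exact: mulf_neq0 a0 b0.
- exact/esym/frac_mxV.
Qed.

Lemma cp_center_mulC z z' :
  z \in cp_center_pred -> z' \in cp_center_pred -> z * z' = z' * z.
Proof. by move=> /cp_centerP [_ zC] /cp_centerP [Dz' _]; apply: zC. Qed.

Lemma cp_center_mulVf z : z \in cp_center_pred -> z != 0 -> invmx z * z = 1.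
Proof.
move=> /cp_centerP /cp_center_scalar [a ->] a0.
rewrite -[_ * _]/(_ *m _) mulVmx // unitmxE det_scalar unitrX // unitfE.
by apply: contraNneq a0 => ->; rewrite raddf0.
Qed.

Lemma cp_inv0 : invmx 0 = 0 :> cp_matrix.
Proof. by rewrite -(raddf0 (@scalar_mx K #|G|)) invmx_scalar invr0. Qed.

Lemma cp_scalar_in_center a : cp_scalar a \in cp_center_pred.
Proof. by apply/cp_center_scalarP/cp_ring_localization/GenScalar. Qed.

End CrossedProduct.

Section GenericCrossedProduct.

Variables (F : fieldType) (G : finGroupType) (k : nat).

Local Notation nvars := #|{: G * G * 'I_k}|.

Definition gcp_field : fieldType := {fraction {mpoly F[nvars]}}.

Definition gcp_const : {rmorphism F -> gcp_field} :=
  @tofrac {mpoly F[nvars]} \o @mpolyC nvars F.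

Definition gcp_var (h g : G) (i : 'I_k) : gcp_field :=
  @tofrac {mpoly F[nvars]} 'X_(enum_rank (h, g, i)).

(* R_{G,k} *)
Definition generic_ring : 'M[gcp_field]_#|G| -> Prop :=
  cp_ring gcp_const gcp_var.

(* D_{G,k} *)
Definition generic_crossed_product : 'M[gcp_field]_#|G| -> Prop :=
  cp_localization gcp_const gcp_var.

Definition generic_center_pred : {pred 'M[gcp_field]_#|G|} :=
  cp_center_pred gcp_const gcp_var.

Lemma generic_centerP z :
  reflect (center_of generic_crossed_product z) (z \in generic_center_pred).
Proof. exact: cp_centerP. Qed.

Lemma gcp_var_neq0 h g i : gcp_var h g i != 0.
Proof.
rewrite /gcp_var tofrac_eq0; apply/eqP.
move=> /(congr1 (mcoeff U_(enum_rank (h, g, i)))).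
by rewrite mcoeffXU eqxx mcoeff0 => /eqP; rewrite oner_eq0.
Qed.

Lemma gcp_var_inj h g i h' g' i' :
  gcp_var h g i = gcp_var h' g' i' -> (h, g, i) = (h', g', i').
Proof.
move/eqP; rewrite tofrac_eq => /eqP.
move/(congr1 (mcoeff U_(enum_rank (h', g', i')))).
rewrite !mcoeffXU eqxx; case: eqP => [/enum_rank_inj //|_ /esym/eqP].
by rewrite oner_eq0.
Qed.

Lemma center_generic_ring_unit (c : 'M[gcp_field]_#|G|) :
  center_of generic_ring c -> c != 0 -> c \in unitmx.
Proof. exact: (center_cp_ring_unit gcp_var_neq0 gcp_var_inj). Qed.

Lemma generic_center_subring : subring_closed generic_center_pred.
Proof. exact: (cp_center_subring gcp_const gcp_var_neq0 gcp_var_inj). Qed.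

(* The field F(G) = Z(D_{G,k}) *)
Record generic_center := GenericCenter {
  gc_val : 'M[gcp_field]_#|G|;
  gc_valP : gc_val \in generic_center_pred
}.

HB.instance Definition _ := [isSub for gc_val].
HB.instance Definition _ := [Choice of generic_center by <:].
HB.instance Definition _ :=
  GRing.SubChoice_isSubPzRing.Build _ generic_center_pred generic_center
    generic_center_subring.

Lemma gc_mulC : commutative (@GRing.mul generic_center).
Proof.
move=> [u Zu] [v Zv]; apply: val_inj.
exact: (cp_center_mulC Zu Zv).
Qed.

Lemma gc_one_neq0 : (1 : generic_center) != 0.
Proof. by rewrite -(inj_eq val_inj) /=; apply: cp_one_neq0. Qed.

HB.instance Definition _ :=
  GRing.PzRing_hasCommutativeMul.Build generic_center gc_mulC.
HB.instance Definition _ :=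
  GRing.PzSemiRing_isNonZero.Build generic_center gc_one_neq0.

Definition gc_inv (z : generic_center) : generic_center :=
  GenericCenter (cp_center_inv gcp_var_neq0 gcp_var_inj (gc_valP z)).

Lemma gc_mulVf (z : generic_center) : z != 0 -> gc_inv z * z = 1.
Proof.
case: z => z Zz; rewrite -(inj_eq val_inj) => z0; apply: val_inj.
exact: (cp_center_mulVf gcp_var_neq0 gcp_var_inj Zz z0).
Qed.

Lemma gc_inv0 : gc_inv 0 = 0.
Proof. by apply: val_inj; apply: cp_inv0. Qed.

HB.instance Definition _ :=
  GRing.ComNzRing_isField.Build generic_center gc_mulVf gc_inv0.

Definition gc_embed (a : F) : generic_center :=
  GenericCenter (cp_scalar_in_center gcp_const gcp_var_neq0 gcp_var_inj a).

Lemma gc_embed_zmod : zmod_morphism gc_embed.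
Proof. by move=> a b; apply: val_inj; apply: cp_scalar_zmod. Qed.

Lemma gc_embed_monoid : monoid_morphism gc_embed.
Proof.
have [h1 hM] := cp_scalar_monoid gcp_const G.
by split=> [|a b]; apply: val_inj; [apply: h1 | apply: hM].
Qed.

HB.instance Definition _ :=
  GRing.isZmodMorphism.Build F generic_center gc_embed gc_embed_zmod.
HB.instance Definition _ :=
  GRing.isMonoidMorphism.Build F generic_center gc_embed gc_embed_monoid.

End GenericCrossedProduct.

(* Main.v *)
Require Import Defs.
From HB Require Import structures.
From mathcomp Require Import all_boot all_order all_fingroup all_algebra all_solvable.
From mathcomp Require Import mpoly zify ring.
From mathcomp Require boolp.

(* Let e range over the triples (h, g, i), fix one index i0 and write t_g for the
   variable at (1, g, i0). Seen as scalars, the center of D_{G,k} is the fixed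
   field L^G, where L is generated by the monomials l_e = t_h x_e / t_g and G
   translates the x_e.

   Adjoin variables y_p, indexed by a G-set P, and u, v, y, on which sigma and
   tau act by (zeta u, zeta^-1 v, y) and (v, u, eta y). There is an equivariant
   boundary map d from Z[P] onto the augmentation ideal of Z[G], and its kernel
   is again a permutation module Z[Q]; this is where gcd(n, 2m) = 1 is used. Put
   n_p = y_p / t^(d p). Then E0 = L(n_p, u, v, y) is also generated over
   F(u, v, y) by the monomials y^q of Z[Q] and the x_e y^(-c_e), where c_e is a
   chain with boundary g - h that is translated along with e. The generators n_p,
   u, v, y are permuted by G up to coefficients in L, and so are the y^q and
   x_e y^(-c_e), so by Galois descent E0^G is purely transcendental over
   L^G = F(G) and over F(u, v, y)^G. The latter is rational, by explicit
   generators. *)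

Set Implicit Arguments.
Unset Strict Implicit.
Unset Printing Implicit Defensive.

Import GRing.Theory.
Local Open Scope ring_scope.

(** * Subfields and algebraic independence *)

(** The comparison is Schanuel's lemma for two permutation lattices over the augmentation ideal of
    [Z[G]]: [Z[P]], and the exponents of the [x_e], where [(h, g, i)] goes to [g - h]. The exponents
    of the [l_e] form the kernel of the second map, and the monomials in the [x_e] and [y_p] that
    lie in [E0] come from the fibre product. Each side needs a lift that descent tolerates: for the
    [n_p] the failure of equivariance is a coefficient in [L], while the [c_e] can be chosen
    equivariantly because [G] acts freely on the triples.

    Descent requires coefficients on which [G] acts faithfully. [L] has this property, but [G] fixes
    [F]; on the other side [u], [v], [y] supply a faithful field, and this is what the roots of
    unity are for.

    The obstacle is a permuted basis of the kernel of [d]. The basis of [Z[P]] consists of the edges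
    of the Cayley graph for [tau] and [tau sigma], both of order [2m], and of elements of boundary
    zero. The latter are added to obvious cycles of the graph, weighted by Bezout coefficients of
    [n] and [2m]; the corrected cycles fall into orbits [G/H] and form the basis. *)

Section Subfields.

Variable K : fieldType.
Implicit Types (k S : K -> Prop) (a b : K).

Definition is_subring k :=
  [/\ k 1, forall a b, k a -> k b -> k (a - b)
    & forall a b, k a -> k b -> k (a * b)].

Definition is_subfield k := is_subring k /\ forall a, k a -> k a^-1.

Section Theory.

Variables (k : K -> Prop) (kR : is_subring k).

Lemma subr_1 : k 1. Proof. by case: kR. Qed.

Lemma subr_B a b : k a -> k b -> k (a - b). Proof. by case: kR => _ + _; apply. Qed.

Lemma subr_M a b : k a -> k b -> k (a * b). Proof. by case: kR => _ _; apply. Qed.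

Lemma subr_0 : k 0. Proof. by rewrite -(subrr 1); apply: subr_B; apply: subr_1. Qed.

Lemma subr_N a : k a -> k (- a).
Proof. by rewrite -sub0r; apply: subr_B; apply: subr_0. Qed.

Lemma subr_D a b : k a -> k b -> k (a + b).
Proof. by move=> ka kb; rewrite -[b]opprK; apply: subr_B => //; apply: subr_N. Qed.

Lemma subr_sum I (r : seq I) (P : pred I) (f : I -> K) :
  (forall i, P i -> k (f i)) -> k (\sum_(i <- r | P i) f i).
Proof. by move=> kf; elim/big_rec: _ => [|i x /kf]; [apply: subr_0 | apply: subr_D]. Qed.

Lemma subr_prod I (r : seq I) (P : pred I) (f : I -> K) :
  (forall i, P i -> k (f i)) -> k (\prod_(i <- r | P i) f i).
Proof. by move=> kf; elim/big_rec: _ => [|i x /kf]; [apply: subr_1 | apply: subr_M]. Qed.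

Lemma subr_X a i : k a -> k (a ^+ i).
Proof.
by move=> ka; elim: i => [|i IH]; rewrite ?exprS; [apply: subr_1 | apply: subr_M].
Qed.

Lemma subr_nat i : k i%:R.
Proof.
by elim: i => [|i IH]; rewrite -?natr1; [apply: subr_0 | apply: subr_D => //; apply: subr_1].
Qed.

End Theory.

Section FieldTheory.

Variables (k : K -> Prop) (kF : is_subfield k).

Lemma subf_ring : is_subring k. Proof. by case: kF. Qed.

Lemma subf_V a : k a -> k a^-1. Proof. by case: kF => _; apply. Qed.

Lemma subf_div a b : k a -> k b -> k (a / b).
Proof. by move=> ka kb; apply: (subr_M subf_ring) => //; apply: subf_V. Qed.

Lemma subf_Xz a (i : int) : k a -> k (a ^ i).
Proof.
by case: i => i ka; [|apply: subf_V]; apply: (subr_X subf_ring).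
Qed.

(** The proof is kept as an argument so that the predicate determines it and structure inference
    recovers the closure properties from the predicate alone. *)
Definition subf_pred_of (_ : is_subfield k) : {pred K} := fun a => boolp.asbool (k a).
Definition subf_pred := subf_pred_of kF.

Lemma subf_predP a : reflect (k a) (a \in subf_pred).
Proof. exact: boolp.asboolP. Qed.

Lemma subf_divring_closed : divring_closed subf_pred.
Proof.
split; first exact/subf_predP/(subr_1 subf_ring).
  by move=> a b /subf_predP ka /subf_predP kb; apply/subf_predP; apply: (subr_B subf_ring).
by move=> a b /subf_predP ka /subf_predP kb; apply/subf_predP; apply: subf_div.
Qed.

HB.instance Definition _ := GRing.isDivringClosed.Build K subf_pred subf_divring_closed.

Record subf_type := SubfType { subf_val : K; subf_valP : subf_val \in subf_pred }.

HB.instance Definition _ := [isSub for subf_val].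
HB.instance Definition _ := [Choice of subf_type by <:].
HB.instance Definition _ := [SubChoice_isSubIntegralDomain of subf_type by <:].
HB.instance Definition _ := [SubIntegralDomain_isSubField of subf_type by <:].

End FieldTheory.

End Subfields.

(** * Polynomials and fractions in a finite family, and towers of families *)

Section PolyFamilies.

Variable K : fieldType.
Implicit Types (k S : K -> Prop) (T : finType).

Definition monom T (x : T -> K) (m : {ffun T -> nat}) : K := \prod_t x t ^+ m t.

(* Algebraic independence over a subfield [k], phrased as linear independence
   of the monomials so that the index type is arbitrary. *)
Definition indep k T (x : T -> K) :=
  forall (s : seq {ffun T -> nat}) (c : {ffun T -> nat} -> K),
  uniq s -> (forall m, k (c m)) -> \sum_(m <- s) c m * monom x m = 0 ->
  {in s, forall m, c m = 0}.

(** Exponents may repeat in the list, so that sums and products are plain list operations. *)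
Definition poly_in k T (x : T -> K) (w : K) :=
  exists2 r : seq (K * {ffun T -> nat}),
    {in r, forall a, k a.1} & w = \sum_(a <- r) a.1 * monom x a.2.

Definition adjoin k T (x : T -> K) (w : K) :=
  exists p q, [/\ poly_in k x p, poly_in k x q, q != 0 & w = p / q].

Lemma eq_monom T (x y : T -> K) m : x =1 y -> monom x m = monom y m.
Proof. by move=> e; apply: eq_bigr => t _; rewrite e. Qed.

Lemma monomD T (x : T -> K) (m m' : {ffun T -> nat}) :
  monom x [ffun t => m t + m' t]%N = monom x m * monom x m'.
Proof. by rewrite -big_split; apply: eq_bigr => t _; rewrite ffunE exprD. Qed.

Lemma monom0 T (x : T -> K) : monom x [ffun=> 0%N] = 1.
Proof. by rewrite /monom big1 // => t _; rewrite ffunE. Qed.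

Lemma monomU T (x : T -> K) t : monom x [ffun t' => (t' == t) : nat] = x t.
Proof.
rewrite /monom (bigD1 t) //= ffunE eqxx big1 ?mulr1 // => t' /negPf e.
by rewrite ffunE e.
Qed.

Lemma eq_indep k T (x y : T -> K) : x =1 y -> indep k x -> indep k y.
Proof.
move=> e ix s c us kc h; apply: ix => //; rewrite -[RHS]h.
by apply: eq_bigr => m _; rewrite (eq_monom _ e).
Qed.

Lemma indep_sub k S T (x : T -> K) :
  (forall a, k a -> S a) -> indep S x -> indep k x.
Proof. by move=> kS ix s c us kc; apply: ix => // m; apply: kS. Qed.

Section Rings.

Variables (k : K -> Prop) (kR : is_subring k) (T : finType) (x : T -> K).

Lemma poly_in_base a : k a -> poly_in k x a.
Proof.
move=> ka; exists [:: (a, [ffun=> 0%N])]; last by rewrite big_seq1 monom0 mulr1.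
by move=> b; rewrite inE => /eqP ->.
Qed.

Lemma poly_in_gen t : poly_in k x (x t).
Proof.
exists [:: (1, [ffun t' => (t' == t) : nat])]; last by rewrite big_seq1 monomU mul1r.
by move=> b; rewrite inE => /eqP ->; apply: subr_1.
Qed.

Lemma poly_in_ring : is_subring (poly_in k x).
Proof.
split; first exact: (poly_in_base (subr_1 kR)).
  move=> _ _ [r kr ->] [r' kr' ->].
  exists (r ++ [seq (- a.1, a.2) | a <- r']).
    move=> a; rewrite mem_cat => /orP[/kr //|/mapP[b br' ->]].
    by apply: (subr_N kR); apply: kr'.
  rewrite big_cat big_map /= -sumrN; congr (_ + _).
  by apply: eq_bigr => a _; rewrite mulNr.
move=> _ _ [r kr ->] [r' kr' ->].
exists [seq (a.1 * b.1, [ffun t => a.2 t + b.2 t]%N) |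
    a : K * {ffun T -> nat} <- r, b : K * {ffun T -> nat} <- r'].
  by move=> _ /allpairsP[[a b] [/= /kr ka /kr' kb ->]]; apply: (subr_M kR).
rewrite big_allpairs_dep mulr_suml; apply: eq_bigr => a _.
rewrite mulr_sumr; apply: eq_bigr => b _.
by rewrite /= monomD mulrACA.
Qed.

Lemma poly_in_min S : is_subring S -> (forall a, k a -> S a) ->
  (forall t, S (x t)) -> forall w, poly_in k x w -> S w.
Proof.
move=> SR kS Sx _ [r kr ->]; rewrite big_seq; apply: (subr_sum SR) => a /kr ka.
apply: (subr_M SR); first exact: kS.
by apply: (subr_prod SR) => t _; apply: (subr_X SR).
Qed.

Lemma adjoin_poly w : poly_in k x w -> adjoin k x w.
Proof.
move=> pw; exists w, 1; split=> //; rewrite ?oner_neq0 ?divr1 //.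
exact: (subr_1 poly_in_ring).
Qed.

Lemma adjoin_base a : k a -> adjoin k x a.
Proof. by move=> ka; apply: adjoin_poly; apply: poly_in_base. Qed.

Lemma adjoin_gen t : adjoin k x (x t).
Proof. by apply: adjoin_poly; apply: poly_in_gen. Qed.

Lemma adjoin_field : is_subfield (adjoin k x).
Proof.
have R := poly_in_ring; split; first split.
- by apply: adjoin_poly; apply: (subr_1 R).
- move=> _ _ [p [q [pp pq q0 ->]]] [p' [q' [pp' pq' q0' ->]]].
  exists (p * q' - p' * q), (q * q').
  rewrite mulf_neq0 // -[- (p' / q')]mulNr addf_div // [- p' * q]mulNr; split=> //.
    by apply: (subr_B R); apply: (subr_M R).
  exact: (subr_M R).
- move=> _ _ [p [q [pp pq q0 ->]]] [p' [q' [pp' pq' q0' ->]]].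
  by exists (p * p'), (q * q'); rewrite mulf_neq0 // mulf_div; split=> //; apply: (subr_M R).
- move=> _ [p [q [pp pq q0 ->]]]; have [->|p0] := eqVneq p 0.
    by rewrite mul0r invr0; apply: adjoin_poly; apply: (subr_0 R).
  by exists q, p; rewrite invfM invrK mulrC; split.
Qed.

Lemma adjoin_min S : is_subfield S -> (forall a, k a -> S a) ->
  (forall t, S (x t)) -> forall w, adjoin k x w -> S w.
Proof.
move=> SF kS Sx _ [p [q [pp pq q0 ->]]].
by apply: (subf_div SF); apply: (poly_in_min (subf_ring SF) kS Sx).
Qed.

End Rings.

Lemma big_fibres (I J : eqType) (s : seq I) (h : I -> J) (U : seq J) (f : I -> K) :
  uniq U -> {in s, forall i, h i \in U} ->
  \sum_(i <- s) f i = \sum_(j <- U) \sum_(i <- s | h i == j) f i.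
Proof.
move=> uU hU; rewrite (exchange_big_dep xpredT) //= big_seq [RHS]big_seq.
apply: eq_bigr => i /hU hi; rewrite (eq_bigl (pred1 (h i))) => [|j].
  by rewrite -big_filter filter_pred1_uniq // big_seq1.
by rewrite eq_sym.
Qed.

Section Tower.

Variables (T1 T2 : finType) (x : T1 + T2 -> K).

Definition mjoin (m1 : {ffun T1 -> nat}) (m2 : {ffun T2 -> nat}) :
    {ffun T1 + T2 -> nat} :=
  [ffun t => match t with inl t1 => m1 t1 | inr t2 => m2 t2 end].

Definition mleft (m : {ffun T1 + T2 -> nat}) : {ffun T1 -> nat} := [ffun t => m (inl t)].
Definition mright (m : {ffun T1 + T2 -> nat}) : {ffun T2 -> nat} := [ffun t => m (inr t)].

Lemma mjoinK m : mjoin (mleft m) (mright m) = m.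
Proof. by apply/ffunP => [[t|t]]; rewrite !ffunE. Qed.

Lemma mjoin_left m1 m2 : mleft (mjoin m1 m2) = m1.
Proof. by apply/ffunP => t; rewrite !ffunE. Qed.

Lemma mjoin_right m1 m2 : mright (mjoin m1 m2) = m2.
Proof. by apply/ffunP => t; rewrite !ffunE. Qed.

Lemma monom_join m1 m2 :
  monom x (mjoin m1 m2) = monom (x \o inl) m1 * monom (x \o inr) m2.
Proof.
rewrite /monom big_sumType /=.
by congr (_ * _); apply: eq_bigr => t _; rewrite ffunE.
Qed.

(** Monomials are grouped by their exponent on [T2]. Each group is a coefficient in [S], which
    vanishes by independence over [S]; independence over [k] then kills the terms of the group. *)
Lemma indep_tower k S : is_subring S -> (forall a, k a -> S a) ->
  (forall t, S (x (inl t))) ->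
  indep k (x \o inl) -> indep S (x \o inr) -> indep k x.
Proof.
move=> SR kS Sx ix iy s c us kc h m0 sm0.
pose d mu := \sum_(m <- s | mright m == mu) c m * monom (x \o inl) (mleft m).
have d0 : {in undup (map mright s), forall mu, d mu = 0}.
  apply: iy; rewrite ?undup_uniq //.
    move=> mu; apply: (subr_sum SR) => m _; apply: (subr_M SR); first exact: kS.
    by apply: (subr_prod SR) => t _; apply: (subr_X SR); apply: Sx.
  rewrite -[RHS]h (@big_fibres _ _ s mright (undup (map mright s))) ?undup_uniq //.
    apply: eq_bigr => mu _; rewrite mulr_suml; apply: eq_bigr => m /eqP <-.
    by rewrite -mulrA -monom_join mjoinK.
  by move=> m sm; rewrite mem_undup map_f.
have := d0 (mright m0); rewrite mem_undup map_f // => /(_ isT).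
rewrite /d -big_filter => {}h.
have := ix (map mleft [seq m <- s | mright m == mright m0])
           (fun nu => c (mjoin nu (mright m0))).
rewrite map_inj_in_uniq => [|m m']; last first.
  rewrite !mem_filter => /andP[/eqP e _] /andP[/eqP e' _] el.
  by rewrite -[m]mjoinK -[m']mjoinK e e' el.
rewrite filter_uniq // big_map => /(_ isT (fun nu => kc _)).
rewrite (_ : \sum_(j <- _) _ = 0) => [/(_ erefl (mleft m0))|].
  rewrite mjoinK; apply; apply: map_f; by rewrite mem_filter eqxx.
rewrite -[RHS]h big_seq [RHS]big_seq; apply: eq_bigr => m.
by rewrite mem_filter => /andP[/eqP <- _]; rewrite mjoinK.
Qed.

(** Multiplied by a common denominator [D], the coefficients become polynomials in the first family,
    and the relation becomes one between monomials of the whole family over [k]. *)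
Lemma indep_untower k : is_subfield k -> indep k x ->
  indep (adjoin k (x \o inl)) (x \o inr).
Proof.
move=> kF ix s c us kc h.
have kR := subf_ring kF; have R := poly_in_ring kR (x \o inl).
have [q hq] : exists q : {ffun T2 -> nat} -> K, forall mu,
    [/\ poly_in k (x \o inl) (q mu), q mu != 0 & poly_in k (x \o inl) (c mu * q mu)].
  suff /boolp.choice[q hq] : forall mu, exists b,
      [/\ poly_in k (x \o inl) b, b != 0 & poly_in k (x \o inl) (c mu * b)] by exists q.
  by move=> mu; have [p [b [pp pb b0 ->]]] := kc mu; exists b; rewrite divfK.
pose D := \prod_(mu <- s) q mu.
have D0 : D != 0 by rewrite prodf_seq_neq0; apply/allP => mu _ /=; case: (hq mu).
have /boolp.choice[r hr] mu : exists r : seq (K * {ffun T1 -> nat}),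
    {in r, forall a, k a.1} /\
    (mu \in s -> c mu * D = \sum_(a <- r) a.1 * monom (x \o inl) a.2).
  have [smu|smu] := boolP (mu \in s); last by exists [::].
  have [r kr e] : poly_in k (x \o inl) (c mu * D).
    rewrite /D (big_rem mu) //= mulrA; apply: (subr_M R); first by case: (hq mu).
    by apply: (subr_prod R) => nu _; case: (hq nu).
  by exists r.
pose N := undup (flatten [seq map snd (r mu) | mu <- s]).
(* The list [r mu] may repeat an exponent, so its coefficients are collected before independence is
   applied. *)
pose cc mu nu := \sum_(a <- r mu | a.2 == nu) a.1.
have cD mu : mu \in s -> c mu * D = \sum_(nu <- N) cc mu nu * monom (x \o inl) nu.
  move=> smu; have [_ /(_ smu) ->] := hr mu.
  rewrite (@big_fibres _ _ (r mu) snd N) ?undup_uniq //.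
    apply: eq_bigr => nu _; rewrite mulr_suml.
    by apply: eq_bigr => a /eqP ->.
  move=> a ra; rewrite mem_undup; apply/flattenP.
  by exists (map snd (r mu)); apply: map_f.
have z : {in [seq mjoin nu mu | mu <- s, nu <- N],
           forall m, cc (mright m) (mleft m) = 0}.
  apply: (ix _ (fun m => cc (mright m) (mleft m))).
  - apply: allpairs_uniq => //; first exact: undup_uniq.
    move=> [mu nu] [mu' nu'] _ _ /= e.
    have := congr1 mright e; have := congr1 mleft e.
    by rewrite !mjoin_left !mjoin_right => -> ->.
  - move=> m; rewrite /cc big_seq_cond; apply: (subr_sum kR) => a /andP[ra _].
    by have [kr _] := hr (mright m); apply: kr.
  - rewrite big_allpairs_dep; transitivity (0 * D); last exact: mul0r.
    rewrite -[in RHS]h mulr_suml big_seq [RHS]big_seq; apply: eq_bigr => mu smu.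
    rewrite mulrAC cD // mulr_suml.
    by apply: eq_bigr => nu _; rewrite mjoin_left mjoin_right monom_join mulrA.
move=> mu smu; apply/eqP; rewrite -(mulIr_eq0 _ (mulIf D0)) cD //.
rewrite big_seq big1 // => nu Nnu.
have := z (mjoin nu mu); rewrite mjoin_left mjoin_right => ->; first by rewrite mul0r.
exact: allpairs_f.
Qed.


End Tower.

End PolyFamilies.

(** * Laurent monomials *)

Section Laurent.
Import Order.TTheory Num.Theory.

Variables (K : fieldType).

Definition laurent (T : finType) (x : T -> K) (v : T -> int) : K := \prod_t x t ^ v t.

Lemma laurent_neq0 (T : finType) (x : T -> K) v : (forall t, x t != 0) -> laurent x v != 0.
Proof. by move=> x0; apply/prodf_neq0 => t _; rewrite expfz_neq0. Qed.

Lemma laurentD (T : finType) (x : T -> K) v w : (forall t, x t != 0) ->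
  laurent x (fun t => v t + w t) = laurent x v * laurent x w.
Proof. by move=> x0; rewrite -big_split; apply: eq_bigr => t _; apply: expfzDr. Qed.

Lemma laurentN (T : finType) (x : T -> K) v : laurent x (fun t => - v t) = (laurent x v)^-1.
Proof. by rewrite /laurent -prodfV; apply: eq_bigr => t _; rewrite invr_expz. Qed.

Lemma eq_laurent (T : finType) (x : T -> K) v w : v =1 w -> laurent x v = laurent x w.
Proof. by move=> e; apply: eq_bigr => t _; rewrite e. Qed.

Lemma laurent_sum (T I : finType) (x : T -> K) (r : seq I) (v : I -> T -> int) :
  (forall t, x t != 0) ->
  laurent x (fun t => \sum_(i <- r) v i t) = \prod_(i <- r) laurent x (v i).
Proof.
move=> x0; elim: r => [|i r IH].
  by rewrite big_nil /laurent big1 // => t _; rewrite big_nil.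
by rewrite big_cons -IH -laurentD //; apply: eq_laurent => t; rewrite big_cons.
Qed.

Lemma laurentZ (T : finType) (x : T -> K) v (a : int) :
  laurent x (fun t => a * v t) = laurent x v ^ a.
Proof.
rewrite /laurent (big_morph (fun z => z ^ a) (id1 := 1) (op1 := *%R)).
- by apply: eq_bigr => t _; rewrite exprz_exp mulrC.
- by move=> ? ?; apply: expfzMl.
- by rewrite exp1rz.
Qed.

Lemma laurentU (T : finType) (x : T -> K) t : laurent x (fun t' => (t' == t)%:Z) = x t.
Proof.
rewrite /laurent (bigD1 t) //= eqxx big1 ?mulr1 // => t' /negPf e.
by rewrite e.
Qed.

(** An injective exponent matrix sends distinct exponents to distinct exponents, so a relation
    between the new monomials is one between Laurent monomials in [x]; a common shift makes the
    exponents natural numbers. *)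
Lemma indep_laurent (k : K -> Prop) (T T' : finType) (x : T -> K) (A : T' -> T -> int) :
  is_subring k -> (forall t, x t != 0) ->
  (forall v : T' -> int, (forall t, \sum_t' v t' * A t' t = 0) -> forall t', v t' = 0) ->
  indep k x -> indep k (fun t' => laurent x (A t')).
Proof.
move=> kR x0 Ainj ix s c us kc h.
pose e (m : {ffun T' -> nat}) t : int := \sum_t' (m t')%:Z * A t' t.
(* Bounds the absolute value of every exponent that occurs, so that multiplying the relation by the
   [N]-th power of all variables clears the negative ones. *)
pose N : nat := (\sum_(m <- s) \sum_t absz (e m t))%N.
pose f (m : {ffun T' -> nat}) : {ffun T -> nat} := [ffun t => absz (e m t + N%:Z)].
have eN m t : m \in s -> 0 <= e m t + N%:Z.
  move=> sm; rewrite addrC -[e m t]opprK subr_ge0 (le_trans (ler_norm _)) //.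
  rewrite normrN -abszE.
  rewrite lez_nat /N (big_rem m) //= (bigD1 t) //= -addnA; exact: leq_addr.
have fE m t : m \in s -> (f m t)%:Z = e m t + N%:Z.
  by move=> sm; rewrite ffunE abszE ger0_norm ?eN.
have finj : {in s &, injective f}.
  move=> m m' sm sm' emm; apply/ffunP => t'.
  apply/eqP; rewrite -eqz_nat -subr_eq0; apply/eqP.
  apply: (Ainj (fun t' => (m t')%:Z - (m' t')%:Z)) => t.
  under eq_bigr do rewrite mulrBl; rewrite sumrB.
  have := congr1 (fun g : {ffun T -> nat} => (g t)%:Z) emm.
  by rewrite !fE // => /addIr; rewrite /e => ->; rewrite subrr.
have monE m : m \in s ->
    monom (fun t' => laurent x (A t')) m * laurent x (fun _ => N%:Z) = monom x (f m).
  move=> sm; rewrite {1}/monom -[RHS]/(laurent x (fun t => (f m t)%:Z)).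
  rewrite (eq_laurent _ (fun t => fE m t sm)) laurentD //; congr (_ * _).
  rewrite /e laurent_sum //; apply: eq_bigr => t' _.
  by rewrite laurentZ.
pose c' mu := \sum_(m <- s | f m == mu) c m.
have c'f : {in s, forall m, c' (f m) = c m}.
  move=> m sm; rewrite /c' big_seq_cond (eq_bigl (fun i => (i \in s) && (i == m))).
    by rewrite -big_seq_cond -big_filter filter_pred1_uniq // big_seq1.
  move=> i /=; case si: (i \in s) => //=.
  by apply/eqP/eqP => [/finj|->] //; apply.
have c'0 : {in map f s, forall mu, c' mu = 0}.
  apply: ix; first by rewrite map_inj_in_uniq.
    by move=> mu; apply: (subr_sum kR).
  rewrite big_map; transitivity (0 * laurent x (fun _ => N%:Z)); last exact: mul0r.
  rewrite -[in RHS]h mulr_suml big_seq [RHS]big_seq; apply: eq_bigr => m sm.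
  by rewrite c'f // -mulrA monE.
by move=> m sm; rewrite -c'f // c'0 // map_f.
Qed.

Lemma indep_inj (k : K -> Prop) (T T' : finType) (x : T -> K) (f : T' -> T) :
  is_subring k -> (forall t, x t != 0) -> injective f -> indep k x -> indep k (x \o f).
Proof.
move=> kR x0 finj ix.
apply: (@eq_indep _ k T' (fun t' => laurent x (fun t => (t == f t')%:Z))).
  by move=> t'; rewrite laurentU.
apply: indep_laurent => // v hv t'; rewrite -(hv (f t')) (bigD1 t') //= eqxx mulr1.
rewrite big1 ?addr0 // => i /negPf ne; rewrite (inj_eq finj) eq_sym ne mulr0 //.
Qed.

Lemma indep_neq0 (k : K -> Prop) (T : finType) (x : T -> K) :
  is_subring k -> indep k x -> forall t, x t != 0.
Proof.
move=> kR ix t; apply/eqP => xt0.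
pose m := [ffun t' => (t' == t) : nat]; suff /eqP : (1 : K) = 0 by rewrite oner_eq0.
apply: (ix [:: m] (fun=> 1) isT (fun=> subr_1 kR) _ m); last exact: mem_head.
by rewrite big_seq1 monomU mul1r.
Qed.

End Laurent.

(** * Comparison with algebraic independence of [mpoly] families, and linear changes of variables *)

Section AlgIndependent.

Variables (A B : fieldType) (iota : {rmorphism A -> B}) (n : nat) (x : 'I_n -> B).

Definition image_of (b : B) := exists a, b = iota a.

Lemma image_of_field : is_subfield image_of.
Proof.
split; first split.
- by exists 1; rewrite rmorph1.
- by move=> _ _ [a ->] [b ->]; exists (a - b); rewrite rmorphB.
- by move=> _ _ [a ->] [b ->]; exists (a * b); rewrite rmorphM.
- by move=> _ [a ->]; exists a^-1; rewrite fmorphV.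
Qed.

Definition ffun_of_mnm (m : 'X_{1..n}) : {ffun 'I_n -> nat} := [ffun i => m i].
Definition mnm_of_ffun (m : {ffun 'I_n -> nat}) : 'X_{1..n} := [multinom m i | i < n].

Lemma ffun_of_mnmK : cancel ffun_of_mnm mnm_of_ffun.
Proof. by move=> m; apply/mnmP => i; rewrite mnmE ffunE. Qed.

Lemma mnm_of_ffunK : cancel mnm_of_ffun ffun_of_mnm.
Proof. by move=> m; apply/ffunP => i; rewrite ffunE mnmE. Qed.

Lemma mmap1_monom m : mmap1 x m = monom x (ffun_of_mnm m).
Proof. by apply: eq_bigr => i _; rewrite ffunE. Qed.

(** The bridge to the notion in the theorem, whose variables are numbered by ordinals. *)
Lemma alg_independent_indep : indep image_of x <-> alg_independent iota x.
Proof.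
split=> [ix p|ax s c us kc h m0 sm0].
  rewrite /mmap => h; apply/mpolyP => m; rewrite mcoeff0; apply/eqP; rewrite -[_ == 0]negbK.
  apply/negP; rewrite -mcoeff_msupp => pm.
  have := ix (map ffun_of_mnm (msupp p)) (fun m => iota p@_(mnm_of_ffun m)).
  rewrite map_inj_uniq ?msupp_uniq; last exact: (can_inj ffun_of_mnmK).
  move=> /(_ isT (fun m => ex_intro _ _ erefl)); rewrite big_map.
  rewrite (_ : \sum_(j <- _) _ = 0) => [/(_ erefl _ (map_f _ pm))|].
    move/eqP; rewrite ffun_of_mnmK fmorph_eq0 => /eqP p0.
    by move: pm; rewrite mcoeff_msupp p0 eqxx.
  by rewrite -[RHS]h; apply: eq_bigr => m' _; rewrite ffun_of_mnmK mmap1_monom.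
have /boolp.choice[a ha] m : exists a, c m = iota a by case: (kc m) => a ->; exists a.
pose p : {mpoly A[n]} := \sum_(m <- s) a m *: 'X_[mnm_of_ffun m].
have p0 : p = 0.
  apply: ax; rewrite -[RHS]h /p raddf_sum /=; apply: eq_bigr => m _.
  by rewrite mmapZ mmapX mmap1_monom mnm_of_ffunK ha.
have := congr1 (mcoeff (mnm_of_ffun m0)) p0.
rewrite /p mcoeff0 raddf_sum /= (bigD1_seq m0) //= big1 => [|m /negPf ne].
  by rewrite addr0 mcoeffZ mcoeffX eqxx mulr1 ha => ->; rewrite rmorph0.
by rewrite mcoeffZ mcoeffX (can_eq mnm_of_ffunK) ne mulr0.
Qed.

Lemma poly_in_mmap w : poly_in image_of x w -> exists p, w = mmap iota x p.
Proof.
case=> r; elim: r w => [|a r IH] w kr ->; first by exists 0; rewrite big_nil raddf0.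
have [|p ep] := IH _ _ erefl; first by move=> b rb; apply: kr; rewrite inE rb orbT.
have [b eb] := kr a (mem_head _ _).
exists (b *: 'X_[mnm_of_ffun a.2] + p).
by rewrite big_cons eb ep raddfD /= mmapZ mmapX mmap1_monom mnm_of_ffunK.
Qed.


(** Substituting the linear forms of [Z] and then those of its inverse is the identity on
    polynomials, so a relation between the new variables comes from a relation between the old
    ones. *)
Lemma alg_independent_linear (Z : 'M[A]_n) : Z \in unitmx -> alg_independent iota x ->
  alg_independent iota (fun i => \sum_j iota (Z i j) * x j).
Proof.
move=> uZ ax p hp.
pose lin (Y : 'M[A]_n) : {mpoly A[n]} -> {mpoly A[n]} :=
  mmap (@mpolyC n A) (fun i => \sum_j Y i j *: 'X_j).
have linE Y q (S : comNzRingType) (f : {rmorphism A -> S}) (y : 'I_n -> S) :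
    mmap f y (lin Y q) = mmap f (fun i => \sum_j f (Y i j) * y j) q.
  elim/mpolyind: q => [|c m q _ _ IH]; first by rewrite /lin !raddf0.
  rewrite /lin !raddfD /= -/(lin Y q) IH; congr (_ + _).
  rewrite !mmapZ !mmapX mul_mpolyC mmapZ /mmap1 rmorph_prod; congr (_ * _).
  apply: eq_bigr => i _; rewrite rmorphXn; congr (_ ^+ _); rewrite raddf_sum.
  by apply: eq_bigr => j _ /=; rewrite mmapZ mmapX mmap1U.
have linK q : lin (invmx Z) (lin Z q) = q.
  rewrite {1}/lin linE -[RHS]comp_mpoly_id /comp_mpoly; apply: eq_bigr => m _; congr (_ * _).
  apply: eq_bigr => i _; congr (_ ^+ _); rewrite tnth_mktuple.
  have -> : 'X_i = \sum_j (Z *m invmx Z) i j *: 'X_j :> {mpoly A[n]}.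
    rewrite mulmxV // (bigD1 i) //= mxE eqxx scale1r big1 ?addr0 // => j /negPf ne.
    by rewrite mxE eq_sym ne scale0r.
  under [RHS]eq_bigr do rewrite mxE scaler_suml.
  rewrite exchange_big; apply: eq_bigr => j _; rewrite mulr_sumr.
  by apply: eq_bigr => l _; rewrite mul_mpolyC scalerA.
rewrite -[p]linK (_ : lin Z p = 0); first by rewrite /lin raddf0.
by apply: ax; rewrite linE.
Qed.

End AlgIndependent.

Section LinearChange.

Variables (K : fieldType) (k : K -> Prop) (kF : is_subfield k).
Local Notation val := (val : {rmorphism subf_type kF -> K}).

Lemma image_of_val w : image_of val w <-> k w.
Proof.
split=> [[a ->]|kw]; first exact/(subf_predP kF)/valP.
by exists (SubfType (introT (subf_predP kF _) kw)).
Qed.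

Lemma subf_matrix (n : nat) (Z : 'M[K]_n) : (forall i j, k (Z i j)) ->
  exists Z' : 'M[subf_type kF]_n, map_mx val Z' = Z.
Proof.
move=> kZ; exists (\matrix_(i, j) SubfType (introT (subf_predP kF _) (kZ i j))).
by apply/matrixP => i j; rewrite !mxE.
Qed.

(** The matrix lifts to the field type of [k], and taking inverses commutes with field morphisms. *)
Lemma subf_invmx (n : nat) (Z : 'M[K]_n) : (forall i j, k (Z i j)) ->
  forall i j, k (invmx Z i j).
Proof.
move=> /subf_matrix[Z' <-] i j; rewrite -map_invmx mxE.
exact/(subf_predP kF)/valP.
Qed.

Lemma indep_linear (n : nat) (x : 'I_n -> K) (Z : 'M[K]_n) :
  (forall i j, k (Z i j)) -> Z \in unitmx -> indep k x ->
  indep k (fun i => \sum_j Z i j * x j).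
Proof.
move=> /subf_matrix[Z' eZ] uZ ix.
have uZ' : Z' \in unitmx by rewrite -(map_unitmx val) eZ.
apply: (@indep_sub _ _ (image_of val)); first by move=> a /image_of_val.
apply: (@eq_indep _ _ _ (fun i => \sum_j val (Z' i j) * x j)).
  by move=> i; apply: eq_bigr => j _; rewrite -eZ mxE.
apply/alg_independent_indep/alg_independent_linear => //.
by apply/alg_independent_indep; apply: indep_sub ix => a /image_of_val.
Qed.

End LinearChange.

(** * Galois descent for monomial semilinear actions *)

Section GroupAction.

Variables (K : fieldType) (G : finGroupType) (act : G -> {rmorphism K -> K}).
Hypothesis act1 : forall a, act 1%g a = a.
Hypothesis actM : forall g h a, act (g * h)%g a = act g (act h a).

Definition inv_by (H : {set G}) (a : K) := forall g, g \in H -> act g a = a.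

Lemma inv_by_field H : is_subfield (inv_by H).
Proof.
split; first split.
- by move=> g _; rewrite rmorph1.
- by move=> a b ia ib g Hg; rewrite rmorphB ia ?ib.
- by move=> a b ia ib g Hg; rewrite rmorphM ia ?ib.
- by move=> a ia g Hg; rewrite fmorphV ia.
Qed.

(** The denominator is replaced by its norm over [H]. The new numerator is invariant as a product of
    invariants, and it lies in [A] because [q] divides its own norm there. *)
Lemma inv_frac (H : {group G}) (A : K -> Prop) (p q : K) : is_subring A ->
  (forall g a, g \in H -> A a -> A (act g a)) -> A p -> A q -> q != 0 ->
  inv_by H (p / q) ->
  exists p' q', [/\ A p' /\ inv_by H p', A q' /\ inv_by H q', q' != 0 & p / q = p' / q'].
Proof.
move=> AR Aact Ap Aq q0 ipq; pose D := \prod_(g in H) act g q.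
have DE : D = q * \prod_(g in H | g != 1%g) act g q.
  by rewrite /D (bigD1 1%g) //= act1.
have iD : inv_by H D.
  move=> h Hh; rewrite rmorph_prod [RHS](reindex_inj (mulgI h)) /=.
  by apply: eq_big => g; rewrite ?actM // groupMl.
have D0 : D != 0 by apply/prodf_neq0 => g _; rewrite fmorph_eq0.
have Ar : A (\prod_(g in H | g != 1%g) act g q).
  by apply: (subr_prod AR) => g /andP[Hg _]; apply: Aact.
exists (p / q * D), D; rewrite mulfK //; split=> //; split.
- by rewrite DE mulrA divfK //; apply: (subr_M AR).
- by apply: (subr_M (subf_ring (inv_by_field H))).
- by rewrite DE; apply: (subr_M AR).
- exact: iD.
Qed.

Section Descent.

Variables (k : K -> Prop) (kF : is_subfield k).
Hypothesis kact : forall g a, k a -> k (act g a).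
(** An element with distinct conjugates expresses that [G] acts faithfully on [k], in the form that
    the Vandermonde matrix needs. *)
Variable b : K.
Hypotheses (kb : k b) (b_inj : injective (fun g => act g b)).
Hypothesis cardG_neq0 : #|G|%:R != 0 :> K.

Variables (T : finType) (x : T -> K) (pi : G -> T -> T) (d : G -> T -> K).
Hypothesis x_indep : indep k x.
Hypothesis kd : forall g t, k (d g t).
Hypothesis pi1 : forall t, pi 1%g t = t.
Hypothesis act_x : forall g t, act g (x t) = d g t * x (pi g t).

Definition fixed_in (a : K) := k a /\ inv_by [set: G] a.

Lemma fixed_in_field : is_subfield fixed_in.
Proof.
have F := inv_by_field [set: G]; have R := subf_ring F; have kR := subf_ring kF.
split; first split.
- by split; [apply: subr_1 | apply: subr_1].
- by move=> a a' [? ?] [? ?]; split; [apply: (subr_B kR) | apply: (subr_B R)].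
- by move=> a a' [? ?] [? ?]; split; [apply: (subr_M kR) | apply: (subr_M R)].
- by move=> a [? ?]; split; [apply: (subf_V kF) | apply: (subf_V F)].
Qed.

Let X (i : 'I_#|T|) := x (enum_val i).
Let V := Vandermonde #|G| (\row_(i < #|G|) act (enum_val i) b).

Lemma orbit_Vandermonde_unit : V \in unitmx.
Proof.
rewrite unitmxE det_Vandermonde unitfE; apply/prodf_neq0 => i _; apply/prodf_neq0 => j lij.
rewrite !mxE subr_eq0; apply: contraTneq lij => /b_inj /enum_val_inj ->.
by rewrite ltnn.
Qed.

(* The entries of the traces [sum_g g (b^j x_t)] on the [x_t]; by the
   Vandermonde matrix of [b], the traces span the [k]-span of the [x_t]. *)
Let C : 'M[K]_(#|{: 'I_#|G| * 'I_#|T|}|, #|T|) :=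
  \matrix_(r < #|{: 'I_#|G| * 'I_#|T|}|, i < #|T|)
  \sum_g act g b ^+ (enum_val r).1 * d g (enum_val (enum_val r).2)
         * (enum_val i == pi g (enum_val (enum_val r).2))%:R.

Lemma traces_full : row_full C.
Proof.
have d1 t : d 1%g t = 1.
  have x0 := indep_neq0 (subf_ring kF) x_indep t.
  by apply: (mulIf x0); rewrite mul1r -{2}[x t]act1 act_x pi1.
apply/row_fullP.
(* This row of the inverse Vandermonde matrix combines the traces of [b^j x_t] so that only the
   summand of [g = 1] survives. *)
pose w j := invmx V (enum_rank 1%g) j.
exists (\matrix_(i < #|T|, r < #|{: 'I_#|G| * 'I_#|T|}|) (w (enum_val r).1 * ((enum_val r).2 == i)%:R)).
apply/matrixP => i i'; rewrite !mxE.
transitivity (\sum_(jt : 'I_#|G| * 'I_#|T|) w jt.1 * (jt.2 == i)%:R *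
    \sum_g act g b ^+ jt.1 * d g (enum_val jt.2) * (enum_val i' == pi g (enum_val jt.2))%:R).
  rewrite (reindex_onto (@enum_rank _) (@enum_val _ _)) /=; last by move=> r _; rewrite enum_valK.
  by apply: eq_big => [jt|jt _]; rewrite ?enum_rankK ?eqxx // !mxE !enum_rankK.
transitivity (\sum_j \sum_t w j * (t == i)%:R *
    \sum_g act g b ^+ j * d g (enum_val t) * (enum_val i' == pi g (enum_val t))%:R).
  by rewrite [RHS](pair_big xpredT xpredT).
transitivity (\sum_j w j * \sum_g act g b ^+ j * d g (enum_val i) * (enum_val i' == pi g (enum_val i))%:R).
  apply: eq_bigr => j _; rewrite (bigD1 i) //= eqxx mulr1 [X in _ + X]big1 ?addr0 // => t /negPf ->.
  by rewrite mulr0 mul0r.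
under eq_bigr do rewrite mulr_sumr.
rewrite exchange_big /= (bigD1 1%g) //=.
have wV g : \sum_j w j * act g b ^+ j = (1%g == g)%:R.
  have := mulVmx orbit_Vandermonde_unit => /matrixP /(_ (enum_rank 1%g) (enum_rank g)).
  rewrite !mxE (inj_eq enum_rank_inj) => <-; apply: eq_bigr => j _.
  by rewrite !mxE enum_rankK.
have pull g : \sum_j w j * (act g b ^+ j * d g (enum_val i) * (enum_val i' == pi g (enum_val i))%:R)
    = (1%g == g)%:R * (d g (enum_val i) * (enum_val i' == pi g (enum_val i))%:R).
  by rewrite -wV mulr_suml; apply: eq_bigr => j _; rewrite !mulrA.
rewrite pull eqxx mul1r d1 mul1r pi1 (inj_eq enum_val_inj) eq_sym.
by rewrite big1 ?addr0 // => g /negPf ne; rewrite pull eq_sym ne mul0r.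
Qed.

Lemma kC r i : k (C r i).
Proof.
have kR := subf_ring kF; rewrite mxE; apply: (subr_sum kR) => g _.
apply: (subr_M kR); last exact: (subr_nat kR).
by apply: (subr_M kR) => //; apply: (subr_X kR); apply: kact.
Qed.

(** The no-name lemma. The [k]-span of the [x_t] is a semilinear representation, hence has an
    invariant basis [z], obtained from traces. Invariant fractions in [z] then have invariant
    numerators and denominators, whose coefficients can be made invariant by averaging. *)
Lemma galois_descent : exists z : 'I_#|T| -> K,
  [/\ forall i, adjoin k x (z i), forall i, inv_by [set: G] (z i), indep fixed_in z
    & forall w, adjoin k x w -> inv_by [set: G] w -> adjoin fixed_in z w].
Proof.
have kR := subf_ring kF.
(* A choice of [#|T|] independent traces; the invertible matrix [Z] is the change of basis from the
   [x_t] to them. *)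
pose Z := rowsub (fullrankfun traces_full) C.
have uZ : Z \in unitmx := fullrowsub_unit traces_full.
have kZ i j : k (Z i j) by rewrite mxE; apply: kC.
pose z i := \sum_j Z i j * X j.
have adz i : adjoin k x (z i).
  have R := subf_ring (adjoin_field kR x); apply: (subr_sum R) => j _.
  apply: (subr_M R); first exact: adjoin_base.
  exact: adjoin_gen.
have iz i : inv_by [set: G] (z i).
  move=> h _; pose r := fullrankfun traces_full i.
  have -> : z i = \sum_g act g (b ^+ (enum_val r).1 * x (enum_val (enum_val r).2)).
    rewrite /z; under eq_bigr do rewrite !mxE mulr_suml.
    rewrite exchange_big /=; apply: eq_bigr => g _.
    rewrite rmorphM rmorphXn act_x mulrA (bigD1 (enum_rank (pi g (enum_val (enum_val r).2)))) //=.
    rewrite big1 ?addr0 => [|j ne]; first by rewrite /X enum_rankK eqxx mulr1.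
    by rewrite -(inj_eq enum_val_inj) enum_rankK in ne; rewrite (negPf ne) mulr0 mul0r.
  rewrite rmorph_sum [RHS](reindex_inj (mulgI h)).
  by apply: eq_bigr => g _; rewrite actM.
have Xi : indep k X.
  apply: indep_inj x_indep => //; last exact: enum_val_inj.
  by apply: indep_neq0 x_indep.
have zi : indep k z by apply: indep_linear.
have kz w : adjoin k x w -> adjoin k z w.
  apply: adjoin_min; [exact: adjoin_field | by move=> a; apply: adjoin_base |].
  move=> t; have R := subf_ring (adjoin_field kR z).
  have -> : x t = \sum_i invmx Z (enum_rank t) i * z i.
    rewrite /z; under eq_bigr do rewrite mulr_sumr.
    rewrite exchange_big /= (bigD1 (enum_rank t)) //= [X in _ + X]big1 => [|j ne].
      rewrite addr0; under eq_bigr do rewrite mulrA.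
      rewrite -mulr_suml /X enum_rankK.
      have := mulVmx uZ => /matrixP /(_ (enum_rank t) (enum_rank t)).
      by rewrite !mxE eqxx => ->; rewrite mul1r.
    under eq_bigr do rewrite mulrA.
    rewrite -mulr_suml.
    have := mulVmx uZ => /matrixP /(_ (enum_rank t) j).
    by rewrite !mxE eq_sym (negPf ne) => ->; rewrite mul0r.
  apply: (subr_sum R) => i _; apply: (subr_M R); last exact: adjoin_gen.
  by apply: adjoin_base => //; apply: subf_invmx.
have zact g r : act g (\sum_(a <- r) a.1 * monom z a.2) = \sum_(a <- r) act g a.1 * monom z a.2.
  rewrite rmorph_sum; apply: eq_bigr => a _; rewrite rmorphM; congr (_ * _).
  by rewrite rmorph_prod; apply: eq_bigr => i _; rewrite rmorphXn iz ?inE.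
exists z; split=> //; first by apply: indep_sub zi => a [].
(* As the [z i] are invariant, averaging the polynomial only averages its coefficients; this divides
   by the order of [G]. *)
have average p : poly_in k z p -> inv_by [set: G] p -> poly_in fixed_in z p.
  move=> [r kr ep] ip.
  exists [seq (#|G|%:R^-1 * \sum_g act g a.1, a.2) | a <- r].
    move=> _ /mapP[a /kr ka ->] /=; split.
      apply: (subr_M kR); first exact/(subf_V kF)/(subr_nat kR).
      by apply: (subr_sum kR) => g _; apply: kact.
    move=> h _; rewrite rmorphM fmorphV rmorph_nat rmorph_sum; congr (_ * _).
    by rewrite [RHS](reindex_inj (mulgI h)); apply: eq_bigr => g _; rewrite actM.
  rewrite big_map; apply: (mulfI cardG_neq0); rewrite mulr_sumr.
  under eq_bigr do rewrite /= mulrA mulVKf // mulr_suml.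
  rewrite exchange_big /= mulr_natl -sumr_const; apply: eq_bigr => g _.
  by rewrite -zact -ep ip ?inE.
move=> w /kz [p [q [pp pq q0 ->]]] iw.
have [] := @inv_frac [group of [set: G]] (poly_in k z) p q => //.
- exact: poly_in_ring.
- by move=> g _ _ [r kr ->]; rewrite zact; exists [seq (act g a.1, a.2) | a <- r];
    rewrite ?big_map // => _ /mapP[a /kr ka ->]; apply: kact.
move=> p' [q' [[pp' ip'] [pq' iq'] q0' ->]].
by exists p', q'; split=> //; apply: average.
Qed.

End Descent.

(** * Kummer descent along one automorphism *)

Section Kummer.

Variables (k : K -> Prop) (kF : is_subfield k) (s : G) (N : nat) (theta y : K).
Hypothesis ks : forall a, k a -> act s a = a.
Hypotheses (kt : k theta) (prim_theta : N.-primitive_root theta) (act_y : act s y = theta * y).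
Hypothesis N_neq0 : N%:R != 0 :> K.

(** Averaging over the first [N] powers of [s] multiplies a monomial [y^e] by a geometric sum in
    [theta^e], which vanishes unless [N] divides [e]; only powers of [y^N] survive. *)
Lemma kummer_descent w : adjoin k (fun _ : 'I_1 => y) w -> act s w = w ->
  adjoin k (fun _ : 'I_1 => y ^+ N) w.
Proof.
have kR := subf_ring kF.
have ksi i a : k a -> act (s ^+ i)%g a = a.
  by move=> ka; elim: i => [|i IH]; rewrite ?expg0 ?act1 // expgSr actM ks.
have yi i : act (s ^+ i)%g y = theta ^+ i * y.
  elim: i => [|i IH]; first by rewrite expg0 act1 expr0 mul1r.
  by rewrite expgSr actM act_y rmorphM IH ksi // mulrA exprS.
have mone (m : {ffun 'I_1 -> nat}) (v : K) : monom (fun _ : 'I_1 => v) m = v ^+ m ord0.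
  by rewrite /monom big_ord1.
have acti i r : {in r, forall a : K * {ffun 'I_1 -> nat}, k a.1} ->
    act (s ^+ i)%g (\sum_(a <- r) a.1 * monom (fun=> y) a.2) =
    \sum_(a <- r) a.1 * theta ^+ (i * a.2 ord0) * monom (fun=> y) a.2.
  move=> kr; rewrite rmorph_sum big_seq [RHS]big_seq; apply: eq_bigr => a /kr ka.
  by rewrite rmorphM ksi // mone rmorphXn yi exprMn -exprM mulrA.
have average p : poly_in k (fun _ : 'I_1 => y) p -> inv_by <[s]>%g p ->
    poly_in k (fun _ : 'I_1 => y ^+ N) p.
  move=> [r kr ep] ip.
  have R := poly_in_ring kR (fun _ : 'I_1 => y ^+ N).
  have -> : p = N%:R^-1 * \sum_(i < N) act (s ^+ i)%g p.
    rewrite (eq_bigr (fun=> p)) => [|i _]; last by rewrite ip // mem_cycle.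
    by rewrite sumr_const card_ord -[p *+ N]mulr_natl mulKf.
  apply: (subr_M R); first by apply: poly_in_base; apply/(subf_V kF)/(subr_nat kR).
  rewrite ep; under eq_bigr do rewrite acti //.
  rewrite exchange_big big_seq; apply: (subr_sum R) => a /kr ka /=.
  rewrite -mulr_suml -mulr_sumr mone.
  have [/dvdnP[e ->]|nd] := boolP (N %| a.2 ord0)%N.
    apply: (subr_M R); last first.
      by rewrite mulnC exprM; apply: (subr_X R); apply: (poly_in_gen kR (fun _ : 'I_1 => y ^+ N) ord0).
    apply: (subr_M R); first exact: poly_in_base.
    apply: (subr_sum R) => i _; apply: poly_in_base; exact: (subr_X kR).
  rewrite (_ : \sum_i _ = 0) ?mulr0 ?mul0r; last first.
    have ne : theta ^+ a.2 ord0 - 1 != 0.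
      by rewrite subr_eq0 -(prim_order_dvd prim_theta).
    apply: (mulfI ne); rewrite mulr0; transitivity ((theta ^+ a.2 ord0) ^+ N - 1).
      by rewrite [RHS]subrX1; congr (_ * _); apply: eq_bigr => i _; rewrite -exprM mulnC.
    by rewrite -exprM mulnC exprM (prim_expr_order prim_theta) expr1n subrr.
  exact: (subr_0 R).
move=> [p [q [pp pq q0 ->]]] iw.
have iws g : g \in <[s]>%g -> act g (p / q) = p / q.
  by case/cycleP => i ->; elim: i => [|i IH]; rewrite ?expg0 ?act1 // expgSr actM iw.
have [] := @inv_frac <[s]>%G (poly_in k (fun _ : 'I_1 => y)) p q => //.
- exact: poly_in_ring.
- move=> _ _ /cycleP[i ->] [r kr ->]; rewrite acti //.
  exists [seq (a.1 * theta ^+ (i * a.2 ord0), a.2) | a : K * {ffun 'I_1 -> nat} <- r]; rewrite ?big_map //.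
  by move=> _ /mapP[a /kr ka ->]; apply: (subr_M kR) => //; apply: (subr_X kR).
move=> p' [q' [[pp' ip'] [pq' iq'] q0' ->]].
by exists p', q'; split=> //; apply: average.
Qed.

End Kummer.

End GroupAction.

(** * The group *)

Section Metacyclic.

Variables (G : finGroupType) (n m : nat) (s t : G).

(** Collects what the later arguments take from the presentation. The relation is written so that
    [t] moves to the left, towards the normal form [t^i s^j]. *)
Record metacyclic_gens : Prop := MetacyclicGens {
  mg_n_odd : odd n;
  mg_m_gt0 : (0 < m)%N;
  mg_coprime : coprime n (2 * m);
  mg_s : (s ^+ n = 1)%g;
  mg_t : (t ^+ (2 * m) = 1)%g;
  mg_st : (s * t = t * s^-1)%g;
  mg_gen : forall g, exists i j, (g = t ^+ i * s ^+ j)%g;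
  mg_card : #|G| = (n * (2 * m))%N }.

End Metacyclic.

(** The normal form bounds the order from above. The lower bound comes from two groups that satisfy
    the presentation, hence are images of [G]: the cyclic group of order [2m] and, for [n > 1], the
    semidirect product in which a generator of order [2m] inverts a cyclic group of order [n]. *)
Lemma metacyclic_presentation (G : finGroupType) (n m : nat) :
  (1 <= n)%N -> (1 <= m)%N -> coprime n (2 * m) ->
  ([set: G] \isog Grp (s : t : s ^+ n = t ^+ (2 * m)%N = 1, t * s * t^-1 = s^-1))%g ->
  exists s t : G, metacyclic_gens n m s t.
Proof.
move=> n1 m1 co pres.
have n_odd : odd n by move: co; rewrite coprimeMr coprimen2 => /andP[].
have := isoGrp_hom pres; case/existsP => -[s t] /= /eqP[defG sn].
rewrite -/((2 * m)%N) => tm rel; exists s, t.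
have st : (s * t = t * s^-1)%g.
  have e : (s = t * s^-1 * t^-1)%g.
    by rewrite -[LHS]invgK -[in LHS]rel !invMg invgK mulgA.
  by rewrite {1}e mulgKV.
have gen g : exists i j, (g = t ^+ i * s ^+ j)%g.
  have : g \in (<[t]> * <[s]>)%g.
    rewrite -norm_joinEl; last by rewrite cycle_subG; apply/normP; rewrite -cycleJ conjgE st mulKg cycleV.
    by rewrite joingC defG inE.
  by case/mulsgP => _ _ /cycleP[i ->] /cycleP[j ->] ->; exists i, j.
have hom2m : (2 * m %| #|G|)%N.
  have : ([set: 'Z_(2 * m)] \homg [set: G])%g.
    rewrite pres; apply/existsP; exists (1%g, Zp1); rewrite /= !xpair_eqE /=.
    rewrite cycle1 joing1G expg1n mulg1 mulgV invg1 !eqxx andbT /=.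
    apply/andP; split; first exact/eqP/esym/Zp_cycle.
    by rewrite -order_dvdn order_Zp1 Zp_cast //; lia.
  by move/card_homg; rewrite !cardsT card_ord Zp_cast //; lia.
have homn : (1 < n)%N -> (n * (2 * m) %| #|G|)%N.
  move=> n_gt1; have m2_gt1 : (1 < 2 * m)%N by lia.
  have ev : (2 %| 2 * m)%N by rewrite dvdn_mulr.
  have hom : ([set: Extremal.gtype n (2 * m) n.-1] \homg [set: G])%g.
    rewrite pres; have := isoGrp_hom (Grp_ext_dihedral n_gt1 m2_gt1 ev).
    case/existsP => -[x y] /= /eqP[def xn yp xy]; apply/existsP; exists (x, y).
    rewrite /= !xpair_eqE /= def xn yp !eqxx /=; apply/eqP.
    have xyE : (x * y = y * x^-1)%g by rewrite -xy conjgE mulKVg.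
    by apply: (mulgI x); rewrite mulgV !mulgA xyE mulgKV mulgV.
  have := card_homg hom; rewrite card_ext_dihedral // cardsT mul2n doubleK.
  by rewrite -mul2n mulnA [(m * 2)%N]mulnC [(_ * n)%N]mulnC -mul2n.
have cardG : #|G| = (n * (2 * m))%N.
  apply/eqP; rewrite eqn_leq; apply/andP; split; last first.
    have G_gt0 : (0 < #|G|)%N by apply/card_gt0P; exists 1%g.
    apply: dvdn_leq => //; have [|n_le1] := ltnP 1 n; first exact: homn.
    by rewrite (_ : n = 1)%N ?mul1n //; lia.
  pose f (ij : 'I_n * 'I_(2 * m)) : G := (t ^+ ij.2 * s ^+ ij.1)%g.
  rewrite -[X in (_ <= X * _)%N]card_ord -[X in (_ <= _ * X)%N]card_ord -card_prod.
  rewrite -cardsT; apply: leq_trans (leq_imset_card f predT).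
  apply/subset_leq_card/subsetP => g _; have [i [j ->]] := gen g.
  have i_lt : (i %% (2 * m) < 2 * m)%N by rewrite ltn_mod; lia.
  have j_lt : (j %% n < n)%N by rewrite ltn_mod.
  apply/imsetP; exists (Ordinal j_lt, Ordinal i_lt) => //.
  by rewrite /f /= (expg_mod _ tm) (expg_mod _ sn).
by split.
Qed.

(** * Normal forms and the characters read off from them *)

Section NormalForm.

Variables (G : finGroupType) (n m : nat) (s t : G).
Hypothesis mg : metacyclic_gens n m s t.

Lemma n_gt0 : (0 < n)%N. Proof. by case: mg; case: n. Qed.

Lemma tm2_gt0 : (0 < 2 * m)%N. Proof. by case: mg => _; case: m. Qed.

Lemma sVt : (s^-1 * t = t * s)%g.
Proof. by apply: (mulgI s); rewrite mulKVg mulgA (mg_st mg) mulgKV. Qed.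

Lemma sXt i : (s ^+ i * t = t * s ^- i)%g.
Proof.
elim: i => [|i IH]; first by rewrite expg0 invg1 mul1g mulg1.
by rewrite {1}expgSr -mulgA (mg_st mg) mulgA IH -mulgA -invMg -expgS.
Qed.

Lemma sVXt i : (s ^- i * t = t * s ^+ i)%g.
Proof. by apply: (mulgI (s ^+ i)%g); rewrite mulKVg mulgA sXt mulgKV. Qed.

Lemma s_t2 : (s * t ^+ 2 = t ^+ 2 * s)%g.
Proof. by rewrite expgS expg1 mulgA (mg_st mg) -mulgA sVt mulgA. Qed.

Lemma mg_TI : (<[t]> :&: <[s]> = 1)%g.
Proof.
have os : (#[s]%g %| n)%N by rewrite order_dvdn (mg_s mg).
have ot : (#[t]%g %| 2 * m)%N by rewrite order_dvdn (mg_t mg).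
apply: coprime_TIg; rewrite -!orderE coprime_sym.
exact: coprime_dvdl os (coprime_dvdr ot (mg_coprime mg)).
Qed.

(** [G] is the product of the two cyclic subgroups, so its order [n * (2 * m)] forces both orders to
    reach their bounds. *)
Lemma mg_orders : #[s]%g = n /\ #[t]%g = (2 * m)%N.
Proof.
have os : (#[s]%g %| n)%N by rewrite order_dvdn (mg_s mg).
have ot : (#[t]%g %| 2 * m)%N by rewrite order_dvdn (mg_t mg).
have sub : [set: G] \subset (<[t]> * <[s]>)%g.
  apply/subsetP => g _; have [a [b ->]] := mg_gen mg g.
  by rewrite mem_mulg ?mem_cycle.
have le : (n * (2 * m) <= #[s]%g * #[t]%g)%N.
  rewrite -(mg_card mg) -cardsT mulnC; apply: leq_trans (subset_leq_card sub) _.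
  by rewrite mul_cardG mg_TI cards1 muln1.
have := dvdn_leq n_gt0 os; have := dvdn_leq tm2_gt0 ot.
have := n_gt0; have := tm2_gt0; have := order_gt0 s; have := order_gt0 t; nia.
Qed.

Lemma nf_uniq i j i' j' : (t ^+ i * s ^+ j = t ^+ i' * s ^+ j')%g ->
  i = i' %[mod 2 * m] /\ j = j' %[mod n].
Proof.
have [eos eot] := mg_orders.
move=> e; have e' : (t ^- i' * t ^+ i = s ^+ j' * s ^- j)%g.
  by apply: (mulIg (s ^+ j)%g); rewrite mulgKV -mulgA e mulKg.
have : (t ^- i' * t ^+ i)%g \in (<[t]>%g :&: <[s]>%g).
  by rewrite inE {2}e' !groupM ?groupV ?mem_cycle.
rewrite mg_TI inE => /eqP e1; have e2 := e'; rewrite e1 in e2.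
have {}e1 : (t ^+ i = t ^+ i')%g by apply: (mulgI (t ^- i')%g); rewrite e1 mulVg.
have {}e2 : (s ^+ j = s ^+ j')%g by apply: (mulIg (s ^- j)%g); rewrite -e2 mulgV.
by rewrite -eot -eos; split; apply/eqP; rewrite -eq_expg_mod_order ?e1 ?e2.
Qed.

Lemma nf_exists g : exists ij : nat * nat,
  [&& ij.1 < 2 * m, ij.2 < n & g == (t ^+ ij.1 * s ^+ ij.2)%g]%N.
Proof.
have [i [j ->]] := mg_gen mg g; exists (i %% (2 * m), j %% n)%N.
by rewrite !ltn_mod tm2_gt0 n_gt0 /= (expg_mod _ (mg_t mg)) (expg_mod _ (mg_s mg)).
Qed.

Definition nf g : nat * nat := xchoose (nf_exists g).

Definition nft g := (nf g).1.
Definition nfs g := (nf g).2.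

Lemma nfE g : (g = t ^+ nft g * s ^+ nfs g)%g.
Proof. by have /and3P[_ _ /eqP] := xchooseP (nf_exists g). Qed.

Lemma nft_lt g : (nft g < 2 * m)%N.
Proof. by have /and3P[] := xchooseP (nf_exists g). Qed.

Lemma nfs_lt g : (nfs g < n)%N.
Proof. by have /and3P[] := xchooseP (nf_exists g). Qed.

Lemma nf_eq i j g : (g = t ^+ i * s ^+ j)%g -> nft g = i %[mod 2 * m] /\ nfs g = j %[mod n].
Proof. by move=> e; apply: nf_uniq; rewrite -nfE. Qed.

Lemma nf_1 : nft 1%g = 0%N /\ nfs 1%g = 0%N.
Proof.
have [] := @nf_eq 0 0 1%g; first by rewrite !expg0 mulg1.
by rewrite !modn_small ?nft_lt ?nfs_lt ?tm2_gt0 ?n_gt0.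
Qed.

Lemma sX_tX j i : (s ^+ j * t ^+ i = t ^+ i * (if odd i then s ^- j else s ^+ j))%g.
Proof.
elim: i => [|i IH]; first by rewrite expg0 mul1g mulg1.
rewrite expgSr mulgA IH -!mulgA /=; congr (_ * _)%g.
by case: (odd i); rewrite ?sVXt ?sXt.
Qed.

Section Characters.

Variables (F : fieldType) (zeta eta : F).
Hypotheses (prim_zeta : n.-primitive_root zeta) (prim_eta : (2 * m).-primitive_root eta).

Definition chi_t (g : G) : F := eta ^+ nft g.
(** Unlike [chi_t] this is not a character: by [chi_sM] it is twisted by the parity [odd_t]. It is
    the coefficient with which [g] sends [u] to [u] or [v]. *)
Definition chi_s (g : G) : F := zeta ^+ nfs g.
Definition odd_t (g : G) : bool := odd (nft g).

Lemma zetaX_mod i j : i = j %[mod n] -> zeta ^+ i = zeta ^+ j.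
Proof. by move=> e; apply/eqP; rewrite (eq_prim_root_expr prim_zeta) e. Qed.

Lemma etaX_mod i j : i = j %[mod 2 * m] -> eta ^+ i = eta ^+ j.
Proof. by move=> e; apply/eqP; rewrite (eq_prim_root_expr prim_eta) e. Qed.

Lemma odd_mod2m i j : i = j %[mod 2 * m] -> odd i = odd j.
Proof. by move=> e; rewrite -(odd_mod i (_ : odd (2 * m) = false)) ?e ?odd_mod ?oddM. Qed.

Lemma zeta_neq0 : zeta != 0.
Proof.
apply/eqP => z0; have := prim_expr_order prim_zeta; rewrite z0 expr0n gtn_eqF ?n_gt0 //=.
by move/esym/eqP; rewrite oner_eq0.
Qed.

Lemma nf_mul g h : nft (g * h)%g = (nft g + nft h)%N %[mod 2 * m] /\
  nfs (g * h)%g = ((if odd_t h then n - nfs g else nfs g) + nfs h)%N %[mod n].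
Proof.
apply: nf_eq; rewrite {1}[g]nfE {1}[h]nfE !mulgA -[(_ * t ^+ nft h)%g]mulgA sX_tX.
rewrite /odd_t expgD mulgA expgD -!mulgA; congr (_ * (_ * (_ * _)))%g.
case: ifP => // _; apply: (mulIg (s ^+ nfs g)%g); rewrite mulVg -expgD subnK ?(mg_s mg) //.
exact: ltnW (nfs_lt g).
Qed.

Lemma chi_tM g h : chi_t (g * h)%g = chi_t g * chi_t h.
Proof. by rewrite /chi_t -exprD; apply: etaX_mod; case: (nf_mul g h). Qed.

Lemma odd_tM g h : odd_t (g * h)%g = odd_t g (+) odd_t h.
Proof. by rewrite /odd_t -oddD; apply: odd_mod2m; case: (nf_mul g h). Qed.

Lemma chi_sM g h : chi_s (g * h)%g = (if odd_t h then (chi_s g)^-1 else chi_s g) * chi_s h.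
Proof.
have [_ /zetaX_mod e] := nf_mul g h; rewrite /chi_s e exprD; congr (_ * _).
case: ifP => // _; apply: (mulIf (expf_neq0 (nfs g) zeta_neq0)).
rewrite mulVf ?expf_neq0 ?zeta_neq0 // -exprD subnK ?(prim_expr_order prim_zeta) //.
exact: ltnW (nfs_lt g).
Qed.

Lemma chi_gens : [/\ chi_t s = 1, chi_t t = eta, chi_s s = zeta, chi_s t = 1 &
  odd_t s = false /\ odd_t t = true].
Proof.
have [] := @nf_eq 0 1 s; first by rewrite expg0 mul1g.
have [] := @nf_eq 1 0 t; first by rewrite expg0 mulg1.
rewrite /chi_t /chi_s /odd_t => /[dup] /etaX_mod -> /odd_mod2m -> /zetaX_mod ->.
by move=> /[dup] /etaX_mod -> /odd_mod2m -> /zetaX_mod ->; rewrite !expr0 !expr1.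
Qed.

Lemma chi_faithful g : chi_t g = 1 -> chi_s g = 1 -> g = 1%g.
Proof.
move=> /eqP; rewrite -(prim_order_dvd prim_eta) => ht.
move=> /eqP; rewrite -(prim_order_dvd prim_zeta) => hs.
have t0 : nft g = 0%N.
  by apply/eqP; case: posnP ht => // g0 /(dvdn_leq g0); rewrite leqNgt nft_lt.
have s0 : nfs g = 0%N.
  by apply/eqP; case: posnP hs => // g0 /(dvdn_leq g0); rewrite leqNgt nfs_lt.
by rewrite [g]nfE t0 s0 !expg0 mulg1.
Qed.

End Characters.

End NormalForm.

(** * Left cosets as an index type *)

Section CosetType.

Variables (G : finGroupType) (H : {group G}).

Definition coset_type := {C : {set G} | C \in lcosets H [set: G]}.

Lemma lcoset_in g : (g *: H)%g \in lcosets H [set: G].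
Proof. by apply/lcosetsP; exists g. Qed.

Definition mkcoset (g : G) : coset_type :=
  exist (fun C => C \in lcosets H [set: G]) _ (lcoset_in g).

Lemma eq_mkcoset g h : (mkcoset g == mkcoset h) = (g^-1 * h \in H)%g.
Proof.
rewrite -(inj_eq val_inj) /= -mem_lcoset; apply/eqP/idP => [->|]; first exact: lcoset_refl.
by move/lcoset_eqP.
Qed.

Lemma mkcoset_surj (C : coset_type) : exists g, C == mkcoset g.
Proof.
case: C => C CH; have /lcosetsP[g _ e] := CH.
by exists g; apply/eqP/val_inj.
Qed.

Definition coset_rep (C : coset_type) : G := xchoose (mkcoset_surj C).

Lemma coset_repK : cancel coset_rep mkcoset.
Proof. by move=> C; apply/esym/eqP; apply: (xchooseP (mkcoset_surj C)). Qed.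

Lemma card_coset_type : (#|{: coset_type}| * #|H|)%N = #|G|.
Proof.
rewrite card_sig (eq_card (B := mem (lcosets H [set: G]))) => [|C]; last by rewrite inE.
by rewrite card_lcosets mulnC Lagrange ?subsetT // cardsT.
Qed.

Lemma coset_fun_rep (A : Type) (f : G -> A) : (forall g h, h \in H -> f (g * h)%g = f g) ->
  forall g, f (coset_rep (mkcoset g)) = f g.
Proof.
move=> fH g; have := coset_repK (mkcoset g) => /esym/eqP; rewrite eq_mkcoset => h.
by rewrite -(fH g _ h) mulKVg.
Qed.

End CosetType.

(** * The chain lattice *)

Section Relations.

Variables (G : finGroupType) (n m : nat) (s t : G).
Hypothesis mg : metacyclic_gens n m s t.
Variables (ep om : int).

Section Formulas.

Variables (H : zmodType) (e1 e2 r1 r2 : G -> H) (o : H).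

(* [e1] and [e2] stand for the edges from [h] to [h t] and to [h t s]. The
   [rel_*] below are cycles, and in a quotient where they all vanish (and
   [r1], [r2] are invariant under right translation by [t ^+ 2], resp. [s]) so
   do [o], [r1] and [r2], which makes [e1] and [e2] the increments of a single
   function on [G], namely [crossed]. *)
Definition rel_a h := \sum_(j < 2 * m) e1 (h * t ^+ j)%g +
  (\sum_(i < n) (r1 (h * s ^- i)%g + r1 (h * t * s ^- i)%g) *+ (n.-1 - i)) *~ ep.

Definition rel_b h := \sum_(j < 2 * m) e2 (h * (t * s) ^+ j)%g +
  (\sum_(i < n) (r1 (h * t * s ^- i)%g + r1 (h * (t * s) * t * s ^- i)%g) *+ (n.-1 - i)) *~ ep
  - o *~ ep.

Definition rel_c h := e1 h + e1 (h * t)%g - e2 h - e2 (h * (t * s))%g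
  - (r1 h *~ (2 * om) + r2 h *~ ep).

(** The signs are chosen so that [alt_sum h] and [alt_sum (h t)] add up to a telescoping sum, namely
    the sum over [i < m] of [r2 (h t^(2i)) - r2 h]. *)
Definition alt_sum h :=
  \sum_(i < m) \sum_(j < 2 * i) (r2 (h * t ^+ j)%g) *~ (-1) ^+ j.+1.

Definition rel_w h := \sum_(i < n) (e1 (h * s ^+ i)%g - e2 (h * s ^+ i)%g)
  - (alt_sum h *~ (2 * om) + o *~ om).

Definition rel_i h := \sum_(i < n) r1 (h * s ^+ i)%g - \sum_(i < m) r2 (h * (t ^+ 2) ^+ i)%g.

(* The edges of [t] and [t s] traversed from [h] to [h s]. *)
Definition crossed_step h := e2 (h * t^-1)%g - e1 (h * t^-1)%g.

Definition crossed_path i j :=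
  \sum_(k < i) e1 (t ^+ k)%g + \sum_(l < j) crossed_step (t ^+ i * s ^+ l)%g.

Definition crossed g := crossed_path (nft mg g) (nfs mg g).

End Formulas.

Section Cyclic.

Variables (H : zmodType) (a : G) (N : nat).
Hypothesis aN : (a ^+ N = 1)%g.

Lemma cyclic_shift (f : G -> H) h :
  \sum_(j < N) f (h * a * a ^+ j)%g = \sum_(j < N) f (h * a ^+ j)%g.
Proof.
case: N aN => [|N'] aN'; first by rewrite !big_ord0.
rewrite big_ord_recr [RHS]big_ord_recl /= addrC -mulgA -expgS aN' expg0.
by congr (_ + _); apply: eq_bigr => j _; rewrite -mulgA -expgS.
Qed.


Lemma cyclic_rev (f : G -> H) h :
  \sum_(j < N) f (h * a ^- j)%g = \sum_(j < N) f (h * a ^+ j)%g.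
Proof.
case: N aN => [|N'] aN'; first by rewrite !big_ord0.
rewrite big_ord_recl [RHS]big_ord_recl; congr (_ + _); first by rewrite invg1.
rewrite (reindex_inj rev_ord_inj) /=; apply: eq_bigr => j _.
congr (f (h * _)%g); apply: (mulIg (a ^+ (bump 0 (N' - j.+1)))%g).
rewrite mulVg -expgD -[LHS]aN'; congr (_ ^+ _)%g; rewrite /bump /=; have := ltn_ord j; lia.
Qed.

End Cyclic.

Lemma parity_sum (H : zmodType) (f : nat -> H) k :
  \sum_(i < k) (f (2 * i)%N + f (2 * i).+1) = \sum_(j < 2 * k) f j.
Proof.
elim: k => [|k IH]; first by rewrite muln0 !big_ord0.
by rewrite big_ord_recr IH /= [in RHS]mulnS !big_ord_recr /= addrA.
Qed.

(** Summation by parts. It explains the weights [n.-1 - i] in [rel_a] and [rel_b]: the difference of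
    the two correction terms becomes [n] times a value of [r1] minus its sum over an [s]-orbit. *)
Lemma abel_sum (H : zmodType) (R : nat -> H) k :
  \sum_(i < k) (R i - R i.+1) *+ (k.-1 - i) = R 0%N *+ k - \sum_(i < k) R i.
Proof.
elim: k => [|k IH]; first by rewrite !big_ord0 subrr.
rewrite big_ord_recr /= subnn mulr0n addr0.
rewrite (eq_bigr (fun i : 'I_k => (R i - R i.+1) *+ (k.-1 - i) + (R i - R i.+1))); last first.
  by move=> i _; rewrite -mulrSr; congr (_ *+ _); have := ltn_ord i; lia.
rewrite big_split /= IH big_ord_recr /= mulrSr.
have -> : \sum_(i < k) (R i - R i.+1) = R 0%N - R k.
  elim: k {IH} => [|k IH]; first by rewrite big_ord0 subrr.
  by rewrite big_ord_recr IH /= addrA subrK.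
by rewrite opprD addrACA.
Qed.

Lemma alt_telescope (H : zmodType) (R : nat -> H) k :
  \sum_(j < k) (R j + R j.+1) *~ (-1) ^+ j.+1 = R k *~ (-1) ^+ k - R 0%N.
Proof.
elim: k => [|k IH]; first by rewrite big_ord0 expr0 mulr1z subrr.
rewrite big_ord_recr IH /= exprS mulN1r mulrzDl !mulrNz.
by rewrite [X in X + _ = _]addrC -addrA addNKr addrC.
Qed.

(** * What follows when the relations hold *)

Section Consequences.

Variables (H : zmodType) (e1 e2 r1 r2 : G -> H) (o : H).
Hypotheses (r1z : forall h, r1 (h * t ^+ 2)%g = r1 h) (r2s : forall h, r2 (h * s)%g = r2 h).

Lemma r1zi h i : r1 (h * (t ^+ 2) ^+ i)%g = r1 h.
Proof. by elim: i => [|i IH]; rewrite ?expg0 ?mulg1 // expgSr mulgA r1z. Qed.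

Lemma r2sX h j : r2 (h * s ^+ j)%g = r2 h.
Proof. by elim: j => [|j IH]; rewrite ?expg0 ?mulg1 // expgSr mulgA r2s. Qed.

Lemma r2_st h j : r2 (h * s * t ^+ j)%g = r2 (h * t ^+ j)%g.
Proof.
have r2V g i : r2 (g * s ^- i)%g = r2 g by rewrite -[in RHS](mulgKV (s ^+ i)%g g) r2sX.
by rewrite -mulgA -{1}[s]expg1 (sX_tX mg) mulgA; case: ifP => _; rewrite ?r2V ?r2sX.
Qed.

Lemma ts2 : ((t * s) ^+ 2 = t ^+ 2)%g.
Proof. by rewrite !expgS !expg0 !mulg1 mulgA -[(t * s * t)%g]mulgA (mg_st mg) mulgA mulgKV. Qed.

Lemma tsX : ((t * s) ^+ (2 * m) = 1)%g.
Proof. by rewrite expgM ts2 -expgM (mg_t mg). Qed.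

Lemma z_central g : (t ^+ 2 * g = g * t ^+ 2)%g.
Proof.
rewrite [g](nfE mg) mulgA -expgD addnC expgD -!mulgA; congr (_ * _)%g.
have c : commute (t ^+ 2)%g s by rewrite /commute (s_t2 mg).
by rewrite mulgA; apply: (@commuteX _ _ _ (nfs mg g) c).
Qed.

Lemma r1_tt h g : r1 (h * t * t * g)%g = r1 (h * g)%g.
Proof.
rewrite -[RHS]r1z; congr r1; rewrite -[RHS]mulgA -z_central [RHS]mulgA.
by congr (_ * _)%g; rewrite -mulgA.
Qed.

(** The shift by [t] exchanges the two halves of the [r1] sum, because [r1] does not see the central
    element [t^2]. *)
Lemma rel_a_t h : rel_a e1 r1 (h * t)%g = rel_a e1 r1 h.
Proof.
rewrite /rel_a (cyclic_shift (mg_t mg)); congr (_ + _ *~ _).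
by apply: eq_bigr => i _; rewrite addrC r1_tt.
Qed.

Lemma r1_tst h g : r1 (h * (t * s) * t * g)%g = r1 (h * s^-1 * g)%g.
Proof.
have -> : (h * (t * s) * t * g = h * t * t * (s^-1 * g))%g.
  by rewrite -!mulgA (mulgA s t) (mg_st mg) !mulgA.
by rewrite r1_tt mulgA.
Qed.

Lemma rel_b_ts h : rel_b e2 r1 o (h * (t * s))%g = rel_b e2 r1 o h.
Proof.
rewrite /rel_b (cyclic_shift tsX); congr (_ + _ *~ _ - _).
apply: eq_bigr => i _; rewrite addrC; congr ((_ + _) *+ _).
by rewrite r1_tst mulgA mulgK.
Qed.

Lemma alt_sum_s h : alt_sum r2 (h * s)%g = alt_sum r2 h.
Proof. by apply: eq_bigr => i _; apply: eq_bigr => j _; rewrite r2_st. Qed.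

Lemma rel_w_s h : rel_w e1 e2 r2 o (h * s)%g = rel_w e1 e2 r2 o h.
Proof.
by rewrite /rel_w alt_sum_s (cyclic_shift (mg_s mg) (fun g => e1 g - e2 g)).
Qed.

Lemma rel_i_s h : rel_i r1 r2 (h * s)%g = rel_i r1 r2 h.
Proof.
rewrite /rel_i (cyclic_shift (mg_s mg)); congr (_ - _).
by apply: eq_bigr => i _; rewrite -expgM r2_st.
Qed.

Lemma zX : ((t ^+ 2) ^+ m = 1)%g. Proof. by rewrite -expgM (mg_t mg). Qed.

Lemma rel_i_z h : rel_i r1 r2 (h * t ^+ 2)%g = rel_i r1 r2 h.
Proof.
rewrite /rel_i (cyclic_shift zX); congr (_ - _).
by apply: eq_bigr => i _; rewrite -mulgA z_central mulgA r1z.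
Qed.

Section Vanish.

Hypothesis bezout : n%:Z * ep + (2 * m)%:Z * om = 1.
Hypotheses (a0 : forall h, rel_a e1 r1 h = 0) (b0 : forall h, rel_b e2 r1 o h = 0)
  (c0 : forall h, rel_c e1 e2 r1 r2 h = 0) (w0 : forall h, rel_w e1 e2 r2 o h = 0)
  (i0 : forall h, rel_i r1 r2 h = 0).

(** The difference between the [e1]-sum along a [t]-orbit and the [e2]-sum along a [t s]-orbit is
    computed in two ways. Both contain the same [s]-orbit sum of [r1]; after cancelling it, Bezout
    leaves [r1 h] itself. *)
Lemma r1_o h : r1 h = - (o *~ ep).
Proof.
have c h' : e1 h' + e1 (h' * t)%g - (e2 h' + e2 (h' * (t * s))%g) = r1 h' *~ (2 * om) + r2 h' *~ ep.
  by apply/eqP; rewrite -subr_eq0 opprD addrA; apply/eqP/c0.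
(* The first way sums [rel_c] over the powers of [t^2]; [rel_i] turns the resulting sum of [r2] into
   a sum of [r1]. *)
have sumc : \sum_(j < 2 * m) e1 (h * t ^+ j)%g - \sum_(j < 2 * m) e2 (h * (t * s) ^+ j)%g =
    r1 h *~ (2 * om * m%:Z) + (\sum_(i < n) r1 (h * s ^+ i)%g) *~ ep.
  rewrite -(parity_sum (fun j => e1 (h * t ^+ j)%g)) -(parity_sum (fun j => e2 (h * (t * s) ^+ j)%g)).
  rewrite -sumrB; transitivity (\sum_(i < m) (r1 h *~ (2 * om) + r2 (h * (t ^+ 2) ^+ i)%g *~ ep)).
    apply: eq_bigr => i _; rewrite -(r1zi h i) -c !(expgSr _ (2 * i)) !expgM ts2.
    by rewrite !mulgA.
  rewrite big_split /= sumr_const card_ord -mulrz_suml pmulrn; congr (_ + _ *~ _).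
    by rewrite -mulrzA.
  by apply/eqP; rewrite eq_sym -subr_eq0; apply/eqP/i0.
(* The second way subtracts [rel_b] from [rel_a] and sums by parts. *)
have ab : \sum_(j < 2 * m) e1 (h * t ^+ j)%g - \sum_(j < 2 * m) e2 (h * (t * s) ^+ j)%g =
    (\sum_(i < n) r1 (h * s ^+ i)%g - r1 h *+ n) *~ ep - o *~ ep.
  pose A := \sum_(j < 2 * m) e1 (h * t ^+ j)%g.
  pose B := \sum_(j < 2 * m) e2 (h * (t * s) ^+ j)%g.
  pose A' := \sum_(i < n) (r1 (h * s ^- i)%g + r1 (h * t * s ^- i)%g) *+ (n.-1 - i).
  pose B' := \sum_(i < n) (r1 (h * t * s ^- i)%g + r1 (h * (t * s) * t * s ^- i)%g) *+ (n.-1 - i).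
  have ha : A + A' *~ ep = 0 := a0 h.
  have hb : B + B' *~ ep - o *~ ep = 0 := b0 h.
  rewrite -/A -/B.
  have AB : A' - B' = r1 h *+ n - \sum_(i < n) r1 (h * s ^+ i)%g.
    have := abel_sum (fun i => r1 (h * s ^- i)%g) n.
    rewrite expg0 invg1 mulg1 (cyclic_rev (mg_s mg)) => <-.
    rewrite /A' /B' -sumrB; apply: eq_bigr => i _; rewrite -mulrnBl; congr (_ *+ _).
    rewrite r1_tst -[(h * s^-1 * _)%g]mulgA -invMg -expgSr.
    by rewrite opprD addrA addrK.
  have -> : A = - (A' *~ ep) by rewrite -[LHS]addr0 -[X in _ + X](subrr (A' *~ ep)) addrA ha sub0r.
  have -> : B = - (B' *~ ep) + o *~ ep.
    by rewrite -[LHS]addr0 -[X in _ + X](subrr (B' *~ ep - o *~ ep)) addrA addrA hb sub0r opprB addrC.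
  rewrite -[\sum_(i < n) _ - r1 h *+ n]opprB -AB mulNrz mulrzBl.
  by rewrite !opprD !opprK addrA.
rewrite ab mulrzBl in sumc.
have bezout' : n%:Z * ep + 2 * om * m%:Z = 1.
  by rewrite -[RHS]bezout; congr (_ + _); rewrite PoszM mulrAC.
have -> : r1 h = r1 h *+ n *~ ep + r1 h *~ (2 * om * m%:Z).
  by rewrite pmulrn -mulrzA -mulrzDr bezout'.
have -> : r1 h *~ (2 * om * m%:Z) = - (r1 h *+ n *~ ep) - o *~ ep.
  apply: (addIr ((\sum_(i < n) r1 (h * s ^+ i)%g) *~ ep)); rewrite -sumc.
  by rewrite [RHS]addrC addrA.
by rewrite addrA subrr sub0r.
Qed.

(** Here [rel_c] summed over an [s]-orbit is compared with [rel_w] at [h] and at [h t]. The orbit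
    sums of [r1] cancel and the multiples of [r2 h] add up to a Bezout combination. *)
Lemma r2_o h : r2 h = o *~ (2 * om).
Proof.
have c h' : e1 h' + e1 (h' * t)%g - (e2 h' + e2 (h' * (t * s))%g) = r1 h' *~ (2 * om) + r2 h' *~ ep.
  by apply/eqP; rewrite -subr_eq0 opprD addrA; apply/eqP/c0.
have w h' : \sum_(i < n) (e1 (h' * s ^+ i)%g - e2 (h' * s ^+ i)%g) =
    alt_sum r2 h' *~ (2 * om) + o *~ om by apply/eqP; rewrite -subr_eq0; apply/eqP/w0.
have alt : alt_sum r2 h + alt_sum r2 (h * t)%g =
    \sum_(i < n) r1 (h * s ^+ i)%g - r2 h *+ m.
  rewrite /alt_sum -big_split /=.
  rewrite (eq_bigr (fun i : 'I_m => r2 (h * (t ^+ 2) ^+ i)%g - r2 h)) => [|i _].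
    rewrite sumrB sumr_const card_ord; congr (_ - _).
    by apply/eqP; rewrite eq_sym -subr_eq0; apply/eqP/i0.
  rewrite -big_split /=.
  have := alt_telescope (fun j => r2 (h * t ^+ j)%g) (2 * i).
  rewrite expg0 mulg1 exprM sqrrN !expr1n mulr1z expgM => <-.
  by apply: eq_bigr => j _; rewrite mulrzDl -mulgA -expgS.
have sumw : (\sum_(i < n) r1 (h * s ^+ i)%g) *~ (2 * om) + r2 h *+ n *~ ep =
    (\sum_(i < n) r1 (h * s ^+ i)%g - r2 h *+ m) *~ (2 * om) + o *~ (2 * om).
  have -> : o *~ (2 * om) = o *~ om + o *~ om by rewrite -mulrzDr mulr_natl mulr2n.
  rewrite -alt mulrzDl.
  transitivity (\sum_(i < n) (e1 (h * s ^+ i)%g - e2 (h * s ^+ i)%g) +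
      \sum_(i < n) (e1 (h * t * s ^+ i)%g - e2 (h * t * s ^+ i)%g)); last first.
    by rewrite !w addrACA.
  transitivity (\sum_(i < n) (r1 (h * s ^+ i)%g *~ (2 * om) + r2 (h * s ^+ i)%g *~ ep)).
    rewrite big_split /=; congr (_ + _); rewrite -mulrz_suml; congr (_ *~ _).
    by rewrite (eq_bigr (fun=> r2 h)) ?sumr_const ?card_ord // => i _; rewrite r2sX.
  under eq_bigr do rewrite -c opprD addrACA.
  rewrite big_split /=; congr (_ + _); rewrite !sumrB; congr (_ - _).
    under eq_bigr do rewrite -mulgA (sXt mg) mulgA.
    exact: (cyclic_rev (mg_s mg)).
  under eq_bigr do rewrite -mulgA (mulgA _ t s) (sXt mg) -(mulgA t) mulgA.
  have sC i : (s ^- i * s = s * s ^- i)%g.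
    by apply: (mulgI (s ^+ i)%g); rewrite mulKVg mulgA -expgSr expgS mulgK.
  under eq_bigr do rewrite sC mulgA.
  by rewrite (cyclic_rev (mg_s mg)) (cyclic_shift (mg_s mg)).
move: sumw; rewrite mulrzBl -!addrA => /addrI e.
have -> : r2 h = r2 h *+ n *~ ep + r2 h *+ m *~ (2 * om).
  rewrite !pmulrn -!mulrzA -mulrzDr -[LHS]mulr1z -[in LHS]bezout; congr (_ *~ (_ + _)).
  by rewrite PoszM mulrA [(m%:Z * 2)]mulrC.
by rewrite e addrAC addNr add0r.
Qed.

(** With [r1] and [r2] constant multiples of [o], [rel_i] says that [- n ep o] equals [2 m om o],
    while the sum of [n ep o] and [2 m om o] is [o] by Bezout. *)
Lemma o_eq0 : o = 0.
Proof.
have /eqP := i0 1%g; rewrite /rel_i; under eq_bigr do rewrite r1_o.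
under [X in _ - X]eq_bigr do rewrite r2_o.
rewrite !sumr_const !card_ord subr_eq0 => /eqP.
rewrite !pmulrn mulNrz -!mulrzA => e.
rewrite -[LHS]mulr1z -bezout mulrzDr [(n%:Z * _)]mulrC.
have -> : (2 * m)%:Z * om = 2 * om * m%:Z by rewrite PoszM mulrAC.
by rewrite -e subrr.
Qed.

Lemma r1_eq0 h : r1 h = 0. Proof. by rewrite r1_o o_eq0 mul0rz oppr0. Qed.

Lemma r2_eq0 h : r2 h = 0. Proof. by rewrite r2_o o_eq0 mul0rz. Qed.

Lemma norm_e1 h : \sum_(j < 2 * m) e1 (h * t ^+ j)%g = 0.
Proof.
rewrite -[RHS](a0 h) /rel_a [X in X *~ ep]big1 ?mul0rz ?addr0 // => i _.
by rewrite !r1_eq0 addr0 mul0rn.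
Qed.

Lemma norm_e12 h : \sum_(i < n) (e1 (h * s ^+ i)%g - e2 (h * s ^+ i)%g) = 0.
Proof.
rewrite -[RHS](w0 h) /rel_w o_eq0 mul0rz addr0 /alt_sum [X in X *~ _]big1 ?mul0rz ?subr0 // => i _.
by rewrite big1 // => j _; rewrite r2_eq0 mul0rz.
Qed.

Lemma square_e h : e1 h + e1 (h * t)%g = e2 h + e2 (h * (t * s))%g.
Proof.
have := c0 h; rewrite /rel_c r1_eq0 r2_eq0 !mul0rz addr0 subr0 -[_ - _ - _]addrA -opprD.
by move/eqP; rewrite subr_eq0 => /eqP.
Qed.

Let D := crossed_path e1 e2.
Let d := crossed_step e1 e2.

(** Raising [i] by [2 * m] adds a full [t]-cycle of [e1], and raising [j] by [n] adds a full
    [s]-cycle of [e2 - e1]. Both sums vanish, so the path sum depends only on its end point. *)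
Lemma crossed_path_eq i j i' j' : (t ^+ i * s ^+ j = t ^+ i' * s ^+ j')%g -> D i j = D i' j'.
Proof.
have shiftT p q k : D (p + k * (2 * m))%N q = D p q.
  elim: k => [|k IH]; first by rewrite addn0.
  rewrite mulSn addnCA -[RHS]IH; set a := (p + _)%N.
  have tE : (t ^+ (2 * m + a) = t ^+ a)%g by rewrite expgD (mg_t mg) mul1g.
  rewrite /D /crossed_path tE; congr (_ + _); rewrite addnC big_split_ord /=.
  rewrite [X in _ + X](_ : _ = 0) ?addr0 // -[RHS](norm_e1 (t ^+ a)%g).
  by apply: eq_bigr => l _; rewrite expgD.
have shiftS p q k : D p (q + k * n)%N = D p q.
  elim: k => [|k IH]; first by rewrite addn0.
  rewrite mulSn addnCA -[RHS]IH; set a := (q + _)%N.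
  rewrite /D /crossed_path addnC big_split_ord /=; congr (_ + _).
  rewrite [X in _ + X](_ : _ = 0) ?addr0 // -[RHS]oppr0.
  rewrite -[in RHS](norm_e12 (t ^+ p * s ^+ a * t^-1)%g) -sumrN.
  rewrite -(cyclic_rev (mg_s mg) (fun g => - (e1 g - e2 g))).
  apply: eq_bigr => l _; rewrite /crossed_step opprB expgD mulgA.
  have e : (s ^+ l * t^-1 = t^-1 * s ^- l)%g.
    by apply: (mulgI t); rewrite mulKVg mulgA -(sVXt mg) mulgK.
  by rewrite -(mulgA _ (s ^+ l)%g) e !mulgA.
move=> /(nf_uniq mg)[ei ej].
rewrite (divn_eq i (2 * m)) (divn_eq j n) (divn_eq i' (2 * m)) (divn_eq j' n) ei ej.
by rewrite ![(_ * (2 * m) + _)%N]addnC ![(_ * n + _)%N]addnC !shiftT !shiftS.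
Qed.

Lemma crossedE g i j : (g = t ^+ i * s ^+ j)%g -> crossed e1 e2 g = D i j.
Proof. by move=> e; apply: crossed_path_eq; rewrite -(nfE mg). Qed.

Lemma crossed_s g : crossed e1 e2 (g * s)%g = crossed e1 e2 g + d g.
Proof.
rewrite (@crossedE _ (nft mg g) (nfs mg g).+1); last by rewrite expgSr mulgA -(nfE mg).
by rewrite /D /crossed_path big_ord_recr /= addrA -(nfE mg).
Qed.

(** On powers of [t] this is the definition of the path. The relation [square_e] transports the
    increment across one more step [s]. *)
Lemma crossed_t g : crossed e1 e2 (g * t)%g = crossed e1 e2 g + e1 g.
Proof.
have [i [j ->]] := mg_gen mg g; elim: j => [|j IH].
  rewrite !expg0 !mulg1 (@crossedE _ i.+1 0) ?expgSr ?expg0 ?mulg1 //.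
  rewrite (@crossedE _ i 0) ?expg0 ?mulg1 // /D /crossed_path !big_ord0 !addr0.
  by rewrite big_ord_recr.
move: IH; rewrite expgSr mulgA; set h := (t ^+ i * s ^+ j)%g => IH.
rewrite crossed_s -[(h * s * t)%g]mulgA (mg_st mg) mulgA.
have /eqP := crossed_s (h * t * s^-1)%g; rewrite mulgKV IH -subr_eq => /eqP <-.
rewrite /d /crossed_step -[(h * t * _ * _)%g]mulgA.
have -> : (s^-1 * t^-1 = t^-1 * s)%g by apply: (mulgI t); rewrite mulKVg mulgA -(mg_st mg) mulgK.
rewrite mulgA mulgK; have := square_e (h * t^-1)%g; rewrite mulgKV !mulgA mulgKV => e.
have -> : e1 h = e2 (h * t^-1)%g - e1 (h * t^-1)%g + e2 (h * s)%g.
  by apply: (addrI (e1 (h * t^-1)%g)); rewrite e [RHS]addrA [e1 _%g + _]addrC subrK.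
rewrite opprB -!addrA; congr (_ + (_ + (_ + _))).
by congr (_ + _); rewrite addrCA subrr addr0.
Qed.

Lemma crossed_ts g : crossed e1 e2 (g * (t * s))%g = crossed e1 e2 g + e2 g.
Proof. by rewrite mulgA crossed_s crossed_t /d /crossed_step mulgK -addrA [e1 g + _]addrC subrK. Qed.

End Vanish.
End Consequences.

(** * Behaviour of the relations under additive maps and translations *)

Section Morphism.

Variables (H H' : zmodType) (f : {additive H -> H'}) (e1 e2 r1 r2 : G -> H) (o : H).

Lemma rel_a_morph h : f (rel_a e1 r1 h) = rel_a (f \o e1) (f \o r1) h.
Proof.
rewrite /rel_a raddfD raddf_sum raddfMz raddf_sum; congr (_ + _ *~ _).
by apply: eq_bigr => i _; rewrite raddfMn raddfD.
Qed.

Lemma rel_b_morph h : f (rel_b e2 r1 o h) = rel_b (f \o e2) (f \o r1) (f o) h.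
Proof.
rewrite /rel_b raddfB raddfD raddf_sum !(raddfMz f) raddf_sum; congr (_ + _ *~ _ - _).
by apply: eq_bigr => i _; rewrite raddfMn raddfD.
Qed.

Lemma rel_c_morph h : f (rel_c e1 e2 r1 r2 h) = rel_c (f \o e1) (f \o e2) (f \o r1) (f \o r2) h.
Proof. by rewrite /rel_c raddfB raddfB raddfB !raddfD !(raddfMz f). Qed.

Lemma rel_w_morph h : f (rel_w e1 e2 r2 o h) = rel_w (f \o e1) (f \o e2) (f \o r2) (f o) h.
Proof.
rewrite /rel_w raddfB raddfD !(raddfMz f) /alt_sum !raddf_sum; congr (_ - (_ *~ _ + _)).
  by apply: eq_bigr => i _; rewrite raddfB.
apply: eq_bigr => i _; rewrite raddf_sum; apply: eq_bigr => j _.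
by rewrite raddfMz.
Qed.

Lemma rel_i_morph h : f (rel_i r1 r2 h) = rel_i (f \o r1) (f \o r2) h.
Proof. by rewrite /rel_i raddfB !raddf_sum. Qed.

Lemma crossed_morph g : f (crossed e1 e2 g) = crossed (f \o e1) (f \o e2) g.
Proof.
rewrite /crossed /crossed_path raddfD !raddf_sum; congr (_ + _).
by apply: eq_bigr => l _; rewrite /crossed_step raddfB.
Qed.

End Morphism.

Section Equivariance.

Variables (H : zmodType) (f : {additive H -> H}) (e1 e2 r1 r2 : G -> H) (o : H) (g : G).
Hypotheses (fe1 : forall h, f (e1 h) = e1 (g * h)%g) (fe2 : forall h, f (e2 h) = e2 (g * h)%g).
Hypotheses (fr1 : forall h, f (r1 h) = r1 (g * h)%g) (fr2 : forall h, f (r2 h) = r2 (g * h)%g).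
Hypothesis fo : f o = o.

Lemma rel_a_equiv h : f (rel_a e1 r1 h) = rel_a e1 r1 (g * h)%g.
Proof.
rewrite rel_a_morph /rel_a; congr (_ + _ *~ _); apply: eq_bigr => j _ /=.
  by rewrite fe1 mulgA.
by rewrite !fr1 !mulgA.
Qed.

Lemma rel_b_equiv h : f (rel_b e2 r1 o h) = rel_b e2 r1 o (g * h)%g.
Proof.
rewrite rel_b_morph /rel_b fo; congr (_ + _ *~ _ - _); apply: eq_bigr => j _ /=.
  by rewrite fe2 mulgA.
by rewrite !fr1 !mulgA.
Qed.

Lemma rel_c_equiv h : f (rel_c e1 e2 r1 r2 h) = rel_c e1 e2 r1 r2 (g * h)%g.
Proof. by rewrite rel_c_morph /rel_c /= !fe1 !fe2 fr1 fr2 !mulgA. Qed.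

Lemma rel_w_equiv h : f (rel_w e1 e2 r2 o h) = rel_w e1 e2 r2 o (g * h)%g.
Proof.
rewrite rel_w_morph /rel_w /alt_sum fo; congr (_ - (_ *~ _ + _)); apply: eq_bigr => j _.
  by rewrite /= fe1 fe2 mulgA.
by apply: eq_bigr => l _; rewrite /= fr2 mulgA.
Qed.

Lemma rel_i_equiv h : f (rel_i r1 r2 h) = rel_i r1 r2 (g * h)%g.
Proof.
rewrite rel_i_morph /rel_i; congr (_ - _); apply: eq_bigr => j _ /=.
  by rewrite fr1 mulgA.
by rewrite fr2 mulgA.
Qed.

End Equivariance.

(** * The relations are cycles *)

Section Boundary.

Variables (H : zmodType) (u : G -> H).

Let e1 h := u (h * t)%g - u h.
Let e2 h := u (h * (t * s))%g - u h.
Let r0 (h : G) : H := 0.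

Lemma telescope_cyclic (a : G) N h : (a ^+ N = 1)%g ->
  \sum_(j < N) (u (h * a ^+ j * a)%g - u (h * a ^+ j)%g) = 0.
Proof.
move=> aN; rewrite sumrB; under eq_bigr do rewrite -mulgA -expgSr expgS mulgA.
by rewrite (cyclic_shift aN) subrr.
Qed.

Lemma rel_a_boundary h : rel_a e1 r0 h = 0.
Proof.
rewrite /rel_a telescope_cyclic ?(mg_t mg) // add0r big1 ?mul0rz // => i _.
by rewrite addr0 mul0rn.
Qed.

Lemma rel_b_boundary h : rel_b e2 r0 0 h = 0.
Proof.
rewrite /rel_b telescope_cyclic ?tsX // add0r big1 ?mul0rz ?subrr // => i _.
by rewrite addr0 mul0rn.
Qed.

Lemma rel_c_boundary h : rel_c e1 e2 r0 r0 h = 0.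
Proof.
rewrite /rel_c !mul0rz addr0 subr0 /e1 /e2.
have -> : (h * (t * s) * (t * s) = h * t * t)%g.
  by rewrite -!mulgA; have := ts2; rewrite !expgS !expg0 !mulg1 -!mulgA => ->.
rewrite [_ + (u (h * t * t)%g - _)]addrC addrA subrK -addrA -opprD.
by rewrite [_ + (u (h * t * t)%g - _)]addrC addrA subrK subrr.
Qed.

Lemma rel_w_boundary h : rel_w e1 e2 r0 0 h = 0.
Proof.
have -> : rel_w e1 e2 r0 0 h = \sum_(i < n) (u (h * s ^+ i * t)%g - u (h * s ^+ i * (t * s))%g).
  rewrite /rel_w /alt_sum [X in X *~ (2 * om)]big1 => [|i _]; last by rewrite big1 // => j _; rewrite mul0rz.
  rewrite !mul0rz addr0 subr0; apply: eq_bigr => i _.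
  by rewrite /e1 /e2 opprB addrA subrK.
have sC i : (s ^- i * s = s * s ^- i)%g.
  by apply: (mulgI (s ^+ i)%g); rewrite mulKVg mulgA -expgSr expgS mulgK.
rewrite sumrB; under eq_bigr do rewrite -mulgA (sXt mg) mulgA.
under [X in _ - X]eq_bigr do rewrite -mulgA (mulgA _ t s) (sXt mg) -(mulgA t) sC !mulgA.
by rewrite !(cyclic_rev (mg_s mg)) (cyclic_shift (mg_s mg)) subrr.
Qed.

Lemma rel_i_boundary h : rel_i r0 r0 h = 0.
Proof. by rewrite /rel_i [X in X - _]big1 // sub0r big1 ?oppr0. Qed.

Lemma crossed_boundary g : crossed e1 e2 g = u g - u 1%g.
Proof.
rewrite /crossed /crossed_path; set i := nft mg g; set j := nfs mg g.
have -> : \sum_(k < i) e1 (t ^+ k)%g = u (t ^+ i)%g - u 1%g.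
  elim: i => [|i IH]; first by rewrite big_ord0 expg0 subrr.
  by rewrite big_ord_recr IH /= /e1 expgSr addrC addrA subrK.
have -> : \sum_(l < j) crossed_step e1 e2 (t ^+ i * s ^+ l)%g = u (t ^+ i * s ^+ j)%g - u (t ^+ i)%g.
  elim: j => [|j IH]; first by rewrite big_ord0 expg0 mulg1 subrr.
  have dE h : crossed_step e1 e2 h = u (h * s)%g - u h.
    by rewrite /crossed_step /e1 /e2 opprB addrA subrK mulgKV mulgA mulgKV.
  by rewrite big_ord_recr IH /= dE addrC expgSr mulgA addrA subrK.
by rewrite addrC addrA subrK -(nfE mg).
Qed.

End Boundary.

Section BoundaryMorph.

Variables (H H' : zmodType) (f : {additive H -> H'}) (e1 e2 r1 r2 : G -> H) (o : H) (u : G -> H').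
Hypothesis fe1 : forall h, f (e1 h) = u (h * t)%g - u h.
Hypothesis fe2 : forall h, f (e2 h) = u (h * (t * s))%g - u h.
Hypotheses (fr1 : forall h, f (r1 h) = 0) (fr2 : forall h, f (r2 h) = 0) (fo : f o = 0).

Let E1 : f \o e1 = fun h => u (h * t)%g - u h. Proof. exact/boolp.funext. Qed.
Let E2 : f \o e2 = fun h => u (h * (t * s))%g - u h. Proof. exact/boolp.funext. Qed.
Let R1 : f \o r1 = fun=> 0. Proof. exact/boolp.funext. Qed.
Let R2 : f \o r2 = fun=> 0. Proof. exact/boolp.funext. Qed.

Lemma rel_a_vanish h : f (rel_a e1 r1 h) = 0.
Proof. by rewrite rel_a_morph E1 R1 rel_a_boundary. Qed.

Lemma rel_b_vanish h : f (rel_b e2 r1 o h) = 0.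
Proof. by rewrite rel_b_morph E2 R1 fo rel_b_boundary. Qed.

Lemma rel_c_vanish h : f (rel_c e1 e2 r1 r2 h) = 0.
Proof. by rewrite rel_c_morph E1 E2 R1 R2 rel_c_boundary. Qed.

Lemma rel_w_vanish h : f (rel_w e1 e2 r2 o h) = 0.
Proof. by rewrite rel_w_morph E1 E2 R2 fo rel_w_boundary. Qed.

Lemma rel_i_vanish h : f (rel_i r1 r2 h) = 0.
Proof. by rewrite rel_i_morph R1 R2 rel_i_boundary. Qed.

Lemma crossed_vertex g : f (crossed e1 e2 g) = u g - u 1%g.
Proof. by rewrite crossed_morph E1 E2 crossed_boundary. Qed.

End BoundaryMorph.

Lemma crossed1 (H : zmodType) (e1 e2 : G -> H) : crossed e1 e2 1%g = 0.
Proof. by have [a b] := nf_1 mg; rewrite /crossed /crossed_path a b !big_ord0 addr0. Qed.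

End Relations.

(** * The permutation lattice [Z[P]] and the basis of cycles *)

Section Lattice.

Variables (G : finGroupType) (n m : nat) (s t : G).
Hypothesis mg : metacyclic_gens n m s t.
Variables (ep om : int).
Hypothesis bezout : n%:Z * ep + (2 * m)%:Z * om = 1.

Local Notation Hs := <[s]>%G.
Local Notation Hz := <[t ^+ 2]>%G.
Local Notation Ht := <[t]>%G.
Local Notation Hb := <[t * s]>%G.
Local Notation Hsz := (<[s]> <*> <[t ^+ 2]>)%G.

(* [P] and [Q]: the first two summands of [pidx] are the edges, the other three
   index [o], [r1] and [r2]; [qidx] indexes [rel_a], [rel_b], [rel_c], [rel_w]
   and [rel_i], each up to the right translations that fix it. *)
Definition pidx := ((G + G) + (unit + (coset_type Hz + coset_type Hs)))%type.
Definition qidx := ((coset_type Ht + coset_type Hb) + (G + (coset_type Hs + coset_type Hsz)))%type.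

Local Notation lattice := {ffun pidx -> int}.

Definition bas (p : pidx) : lattice := [ffun p' => (p' == p)%:Z].

Section LinExt.
Variables (H : zmodType) (phi : pidx -> H).
Definition linext (v : lattice) : H := \sum_p phi p *~ v p.

Lemma linext_zmod : zmod_morphism linext.
Proof.
move=> v w; rewrite /linext -sumrB; apply: eq_bigr => p _.
by rewrite !ffunE mulrzBr.
Qed.

HB.instance Definition _ := GRing.isZmodMorphism.Build lattice H linext linext_zmod.

Lemma linext_bas p : linext (bas p) = phi p.
Proof.
rewrite /linext (bigD1 p) //= ffunE eqxx mulr1z big1 ?addr0 // => q /negPf ne.
by rewrite ffunE ne mulr0z.
Qed.
End LinExt.

Lemma lattice_bas (v : lattice) : v = \sum_p bas p *~ v p.
Proof.
apply/ffunP => q; rewrite sum_ffunE (bigD1 q) //= big1 => [|p /negPf ne].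
  by rewrite ffunMzE ffunE eqxx addr0 intz.
by rewrite ffunMzE ffunE eq_sym ne mul0rz.
Qed.

Definition ce1 h : pidx := inl (inl h).
Definition ce2 h : pidx := inl (inr h).
Definition co : pidx := inr (inl tt).
Definition cr1 h : pidx := inr (inr (inl (mkcoset Hz h))).
Definition cr2 h : pidx := inr (inr (inr (mkcoset Hs h))).

Definition be1 h := bas (ce1 h).
Definition be2 h := bas (ce2 h).
Definition bo := bas co.
Definition br1 h := bas (cr1 h).
Definition br2 h := bas (cr2 h).

Lemma br1z h : br1 (h * t ^+ 2)%g = br1 h.
Proof.
congr (bas (inr (inr (inl _)))); apply/eqP; rewrite eq_mkcoset invMg mulgKV.
by rewrite groupV cycle_id.
Qed.

Lemma br2s h : br2 (h * s)%g = br2 h.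
Proof.
congr (bas (inr (inr (inr _)))); apply/eqP; rewrite eq_mkcoset invMg mulgKV.
by rewrite groupV cycle_id.
Qed.

Definition ja h := rel_a n m s t ep be1 br1 h.
Definition jb h := rel_b n m s t ep be2 br1 bo h.
Definition jc h := rel_c s t ep om be1 be2 br1 br2 h.
Definition jw h := rel_w n m s t om be1 be2 br2 bo h.
Definition ji h := rel_i n m s t br1 br2 h.

Definition jrel (q : qidx) : lattice :=
  match q with
  | inl (inl C) => ja (coset_rep C)
  | inl (inr C) => jb (coset_rep C)
  | inr (inl h) => jc h
  | inr (inr (inl C)) => jw (coset_rep C)
  | inr (inr (inr C)) => ji (coset_rep C)
  end.

(** A chain from 1 to [g]. For [g != 1] these lift the basis [g - 1] of the augmentation ideal, and
    with the cycles [jrel] they form a basis of the lattice. *)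
Definition lam (g : G) : lattice := crossed mg be1 be2 g.

Lemma lam1 : lam 1%g = 0. Proof. exact: crossed1. Qed.

Lemma cycle_inv (a : G) (A : Type) (f : G -> A) : (forall g, f (g * a)%g = f g) ->
  forall g h, h \in <[a]>%g -> f (g * h)%g = f g.
Proof.
move=> fa g _ /cycleP[i ->]; elim: i => [|i IH]; first by rewrite expg0 mulg1.
by rewrite expgSr mulgA fa.
Qed.

Lemma join_inv (A : Type) (f : G -> A) : (forall g, f (g * s)%g = f g) ->
  (forall g, f (g * t ^+ 2)%g = f g) ->
  forall g h, h \in Hsz -> f (g * h)%g = f g.
Proof.
move=> fs fz g h; rewrite /= norm_joinEl; last first.
  rewrite cents_norm // cycle_subG; apply/centP => _ /cycleP[i ->].
  by apply/commuteX; rewrite /commute (s_t2 mg).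
by case/mulsgP => x y xs yz ->; rewrite mulgA (cycle_inv fz) ?(cycle_inv fs).
Qed.

Lemma jrel_a h : jrel (inl (inl (mkcoset Ht h))) = ja h.
Proof. by apply: coset_fun_rep; apply: cycle_inv => g; apply: (rel_a_t mg) br1z _. Qed.

Lemma jrel_b h : jrel (inl (inr (mkcoset Hb h))) = jb h.
Proof. by apply: coset_fun_rep; apply: cycle_inv => g; apply: (rel_b_ts mg _ _ _ br1z). Qed.

Lemma jrel_w h : jrel (inr (inr (inl (mkcoset Hs h)))) = jw h.
Proof. by apply: coset_fun_rep; apply: cycle_inv => g; apply: (rel_w_s mg _ _ _ _ br2s). Qed.

Lemma jrel_i h : jrel (inr (inr (inr (mkcoset Hsz h)))) = ji h.
Proof.
apply: (@coset_fun_rep _ Hsz); apply: join_inv => g.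
  exact: (rel_i_s mg _ br2s).
exact: (rel_i_z mg _ br1z).
Qed.

Definition cosact (H : {group G}) (g : G) (C : coset_type H) : coset_type H :=
  mkcoset H (g * coset_rep C)%g.

Lemma cosact_mk H g h : cosact g (mkcoset H h) = mkcoset H (g * h)%g.
Proof.
apply/eqP; rewrite eq_mkcoset invMg -mulgA mulKg -eq_mkcoset.
by rewrite coset_repK.
Qed.

Definition pact (g : G) (p : pidx) : pidx :=
  match p with
  | inl (inl h) => ce1 (g * h)%g
  | inl (inr h) => ce2 (g * h)%g
  | inr (inl _) => co
  | inr (inr (inl C)) => inr (inr (inl (cosact g C)))
  | inr (inr (inr C)) => inr (inr (inr (cosact g C)))
  end.

Definition jact (g : G) (q : qidx) : qidx :=
  match q with
  | inl (inl C) => inl (inl (cosact g C))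
  | inl (inr C) => inl (inr (cosact g C))
  | inr (inl h) => inr (inl (g * h)%g)
  | inr (inr (inl C)) => inr (inr (inl (cosact g C)))
  | inr (inr (inr C)) => inr (inr (inr (cosact g C)))
  end.

Lemma cosact1 H C : @cosact H 1%g C = C.
Proof. by rewrite /cosact mul1g coset_repK. Qed.

Lemma cosactM H g h C : @cosact H (g * h)%g C = cosact g (cosact h C).
Proof. by rewrite -{1}[C]coset_repK -[in RHS](coset_repK C) !cosact_mk mulgA. Qed.

Lemma pact1 p : pact 1%g p = p.
Proof. by case: p => [[h|h]|[[]|[C|C]]] //=; rewrite ?cosact1 // /ce1 /ce2 mul1g. Qed.

Lemma pactM g h p : pact (g * h)%g p = pact g (pact h p).
Proof. by case: p => [[x|x]|[[]|[C|C]]] //=; rewrite ?cosactM // mulgA. Qed.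

Lemma jact1 p : jact 1%g p = p.
Proof. by case: p => [[h|h]|[h|[C|C]]] //=; rewrite ?cosact1 // mul1g. Qed.

Definition translate (g : G) : lattice -> lattice := linext (fun p => bas (pact g p)).
HB.instance Definition _ g := GRing.Additive.on (translate g).

(** The relations are built with right multiplications only, so left translation permutes them. *)
Lemma translate_jrel g q : translate g (jrel q) = jrel (jact g q).
Proof.
have E1 h : translate g (be1 h) = be1 (g * h)%g by rewrite /translate linext_bas.
have E2 h : translate g (be2 h) = be2 (g * h)%g by rewrite /translate linext_bas.
have Eo : translate g bo = bo by rewrite /translate linext_bas.
have R1 h : translate g (br1 h) = br1 (g * h)%g by rewrite /translate linext_bas /= cosact_mk.
have R2 h : translate g (br2 h) = br2 (g * h)%g by rewrite /translate linext_bas /= cosact_mk.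
case: q => [[C|C]|[h|[C|C]]]; rewrite /jact /cosact ?jrel_a ?jrel_b ?jrel_w ?jrel_i.
- exact: (rel_a_equiv _ _ _ _ _ E1 R1).
- exact: (rel_b_equiv _ _ _ _ _ E2 R1 Eo).
- exact: (rel_c_equiv _ _ _ _ E1 E2 R1 R2).
- exact: (rel_w_equiv _ _ _ _ _ E1 E2 R2 Eo).
- exact: (rel_i_equiv _ _ _ _ R1 R2).
Qed.

Definition vertex (g : G) : {ffun G -> int} := [ffun x => (x == g)%:Z].

Definition boundary_of (p : pidx) : {ffun G -> int} :=
  match p with
  | inl (inl h) => vertex (h * t)%g - vertex h
  | inl (inr h) => vertex (h * (t * s))%g - vertex h
  | inr _ => 0
  end.

Definition boundary : lattice -> {ffun G -> int} := linext boundary_of.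
HB.instance Definition _ := GRing.Additive.on boundary.

Lemma boundary_jrel q : boundary (jrel q) = 0.
Proof.
have E1 h : boundary (be1 h) = vertex (h * t)%g - vertex h by rewrite /boundary linext_bas.
have E2 h : boundary (be2 h) = vertex (h * (t * s))%g - vertex h by rewrite /boundary linext_bas.
have Eo : boundary bo = 0 by rewrite /boundary linext_bas.
have R1 h : boundary (br1 h) = 0 by rewrite /boundary linext_bas.
have R2 h : boundary (br2 h) = 0 by rewrite /boundary linext_bas.
case: q => [[C|C]|[h|[C|C]]].
- exact: (rel_a_vanish mg _ E1 R1).
- exact: (rel_b_vanish mg _ E2 R1 Eo).
- exact: (rel_c_vanish mg _ _ E1 E2 R1 R2).
- exact: (rel_w_vanish mg _ E1 E2 R2 Eo).
- exact: rel_i_vanish R1 R2 _.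
Qed.

Lemma boundary_lam g : boundary (lam g) = vertex g - vertex 1%g.
Proof.
have E1 h : boundary (be1 h) = vertex (h * t)%g - vertex h by rewrite /boundary linext_bas.
have E2 h : boundary (be2 h) = vertex (h * (t * s))%g - vertex h by rewrite /boundary linext_bas.
have h := crossed_vertex mg E1 E2 g; exact: h.
Qed.

Definition jspan (v : lattice) := exists c : qidx -> int, v = \sum_q jrel q *~ c q.

Definition jspan_pred : {pred lattice} := fun v => boolp.asbool (jspan v).

Lemma jspan_zmod_closed : zmod_closed jspan_pred.
Proof.
split; first by apply/boolp.asboolP; exists (fun=> 0); rewrite big1.
move=> v w /boolp.asboolP[c ->] /boolp.asboolP[d ->]; apply/boolp.asboolP.
exists (fun q => c q - d q); rewrite -sumrB; apply: eq_bigr => q _.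
by rewrite mulrzBr.
Qed.

HB.instance Definition _ := GRing.isZmodClosed.Build lattice jspan_pred jspan_zmod_closed.

Lemma jrel_span q : jspan (jrel q).
Proof.
exists (fun q' => (q' == q)%:Z); rewrite (bigD1 q) //= eqxx mulr1z big1 ?addr0 // => q' /negPf ->.
by rewrite mulr0z.
Qed.

(** Modulo the span of the cycles all relations hold, so [o], [r1], [r2] vanish there and each edge
    is the difference of [crossed] at its end points, which is the image of a difference of two
    [lam]. *)
Lemma lattice_generated p : exists (c : qidx -> int) (d : G -> int),
  bas p = \sum_q jrel q *~ c q + \sum_(g | g != 1%g) lam g *~ d g.
Proof.
(* The abstract group in which the vanishing results for the relations are applied. *)
pose Q := Quotient.quot (jspan_pred : zmodClosed lattice).
pose f : {additive lattice -> Q} := \pi_Q%qT.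
have fP v : f v = 0 <-> jspan v.
  rewrite -(raddf0 f); split=> [/eqP|jv].
    by rewrite -Quotient.idealrBE subr0 => /boolp.asboolP.
  by apply/eqP; rewrite -Quotient.idealrBE subr0; apply/boolp.asboolP.
have fj q : f (jrel q) = 0 by apply/fP/jrel_span.
have a0 h : rel_a n m s t ep (f \o be1) (f \o br1) h = 0 by rewrite -rel_a_morph -/(ja h) -jrel_a fj.
have b0 h : rel_b n m s t ep (f \o be2) (f \o br1) (f bo) h = 0 by rewrite -rel_b_morph -/(jb h) -jrel_b fj.
have c0 h : rel_c s t ep om (f \o be1) (f \o be2) (f \o br1) (f \o br2) h = 0.
  by rewrite -rel_c_morph; apply: (fj (inr (inl h))).
have w0 h : rel_w n m s t om (f \o be1) (f \o be2) (f \o br2) (f bo) h = 0.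
  by rewrite -rel_w_morph -/(jw h) -jrel_w fj.
have i0 h : rel_i n m s t (f \o br1) (f \o br2) h = 0 by rewrite -rel_i_morph -/(ji h) -jrel_i fj.
have r1z h : (f \o br1) (h * t ^+ 2)%g = (f \o br1) h by rewrite /= br1z.
have r2s h : (f \o br2) (h * s)%g = (f \o br2) h by rewrite /= br2s.
have sumU g : \sum_(x | x != 1%g) lam x *~ ((x == g)%:Z) = lam g.
  have [->|g1] := eqVneq g 1%g.
    by rewrite lam1 big1 // => x /negPf ->; rewrite mulr0z.
  rewrite (bigD1 g) //= eqxx mulr1z big1 ?addr0 // => x /andP[_ /negPf ->].
  by rewrite mulr0z.
suff [v [jv [d e]]] : exists v, jspan v /\
    exists d : G -> int, bas p = v + \sum_(g | g != 1%g) lam g *~ d g.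
  by case: jv => c ev; exists c, d; rewrite -ev.
have diff g h : jspan (bas p - (lam g - lam h)) -> exists v, jspan v /\
    exists d : G -> int, bas p = v + \sum_(g | g != 1%g) lam g *~ d g.
  move=> jv; exists (bas p - (lam g - lam h)); split=> //.
  exists (fun x => (x == g)%:Z - (x == h)%:Z).
  under eq_bigr do rewrite mulrzBr.
  by rewrite sumrB !sumU subrK.
have flam g : f (lam g) = crossed mg (f \o be1) (f \o be2) g by apply: crossed_morph.
have zero : jspan (bas p) -> exists v, jspan v /\
    exists d : G -> int, bas p = v + \sum_(g | g != 1%g) lam g *~ d g.
  by move=> jv; apply: (diff 1%g 1%g); rewrite subrr subr0.
case: p diff zero => [[h|h]|[[]|[C|C]]] diff zero.
- apply: (diff (h * t)%g h); apply/fP; rewrite !raddfB /= !flam.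
  rewrite (crossed_t mg r1z r2s bezout a0 b0 c0 w0 i0).
  by rewrite opprK opprD addrAC addNr add0r addrN.
- apply: (diff (h * (t * s))%g h); apply/fP; rewrite !raddfB /= !flam.
  rewrite (crossed_ts mg r1z r2s bezout a0 b0 c0 w0 i0).
  by rewrite opprK opprD addrAC addNr add0r addrN.
- by apply: zero; apply/fP; apply: (o_eq0 mg r1z r2s bezout a0 b0 c0 w0 i0).
- apply: zero; apply/fP; rewrite -[C]coset_repK.
  exact: (r1_eq0 mg r1z r2s bezout a0 b0 c0 w0 i0).
- apply: zero; apply/fP; rewrite -[C]coset_repK.
  exact: (r2_eq0 mg r1z r2s bezout a0 b0 c0 w0 i0).
Qed.

(** With [|G| = 2nm], the lattice [Z[P]] has rank [2|G| + 1 + 2n + 2m] and the cycles number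
    [2n + |G| + 2m + 2]; the difference is [|G| - 1]. *)
Lemma card_pidx_qidx : (#|{: qidx}| + #|{: {g : G | g != 1%g}}| = #|{: pidx}|)%N.
Proof.
have [os ot] := mg_orders mg.
have cH := @card_coset_type G; have cG := mg_card mg.
have n0 := n_gt0 mg; have m0 := tm2_gt0 mg.
have cs : #|{: coset_type Hs}| = (2 * m)%N.
  have := cH Hs; rewrite -orderE os cG; nia.
have ct : #|{: coset_type Ht}| = n.
  have := cH Ht; rewrite -orderE ot cG; nia.
have oz : #[t ^+ 2]%g = m by rewrite orderXdiv ot ?dvdn_mulr // mulKn.
have cz : #|{: coset_type Hz}| = (2 * n)%N.
  have := cH Hz; rewrite -orderE oz cG; nia.
(* The element [(t s)^k] is [t^k] for even [k] and [t^k s] for odd [k], so uniqueness of normal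
   forms makes [2 * m] divide the order. *)
have ob : #[t * s]%g = (2 * m)%N.
  apply/eqP; rewrite eqn_dvd order_dvdn (tsX mg) eqxx /=.
  have e := expg_order (t * s)%g; move: #[(t * s)%g]%g e => k.
  rewrite -{1}(odd_double_half k) addnC expgD -mul2n expgM (ts2 mg) -expgM => e.
  have : (t ^+ (2 * k./2 + odd k) * s ^+ odd k = t ^+ 0 * s ^+ 0)%g.
    rewrite expg0 mulg1 -[RHS]e; case: (odd k); rewrite ?expg0 ?expg1 ?addn0 ?mulg1 //.
    by rewrite expgD expg1 mulgA.
  move/(nf_uniq mg) => [ee _]; rewrite -{1}(odd_double_half k) addnC -mul2n.
  by rewrite /dvdn ee mod0n.
have cb : #|{: coset_type Hb}| = n.
  have := cH Hb; rewrite -orderE ob cG; nia.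
have osz : #|Hsz| = (n * m)%N.
  rewrite /= norm_joinEl; last first.
    rewrite cents_norm // cycle_subG; apply/centP => _ /cycleP[i ->].
    by apply/commuteX; rewrite /commute (s_t2 mg).
  rewrite coprime_cardMg -!orderE ?os ?oz //.
  by have := mg_coprime mg; rewrite coprimeMr => /andP[].
have csz : #|{: coset_type Hsz}| = 2%N.
  have := cH Hsz; rewrite osz cG; nia.
have c1 : (#|{: {g : G | g != 1%g}}| + 1 = #|G|)%N.
  rewrite card_sig (eq_card (B := predC1 (1%g : G))) // cardC1 addn1 prednK //.
  by apply/card_gt0P; exists 1%g.
rewrite !card_sum card_unit cs ct cb csz cz cG; move: c1; rewrite cG; lia.
Qed.

Lemma mulmx1C_rect (R : comUnitRingType) (a b : nat) (A : 'M[R]_(a, b)) (B : 'M[R]_(b, a)) :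
  a = b -> B *m A = 1%:M -> A *m B = 1%:M.
Proof. by move=> e; case: _ / e in A B *; apply: mulmx1C. Qed.

(* The [jrel q] and [lam g], [g != 1], are as many generators as the rank of
   the lattice, so they are a basis. *)
Lemma jrel_indep (c : qidx -> int) : \sum_q jrel q *~ c q = 0 -> forall q, c q = 0.
Proof.
pose T := (qidx + {g : G | g != 1%g})%type.
pose gen (x : T) : lattice := match x with inl q => jrel q | inr g => lam (val g) end.
have /boolp.choice[B hB] p : exists b : T -> int, bas p = \sum_x gen x *~ b x.
  have [c' [d e]] := lattice_generated p.
  exists (fun x => match x with inl q => c' q | inr g => d (val g) end).
  rewrite big_sumType /= e; congr (_ + _).
  rewrite (reindex_omap (val : {g : G | g != 1%g} -> G) insub) => [|g g1]; last by rewrite insubT.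
  by apply: eq_big => [g|//]; rewrite valK eqxx (valP g).
pose A := \matrix_(i < #|{: T}|, j < #|{: pidx}|) gen (enum_val i) (enum_val j).
pose Bm := \matrix_(j < #|{: pidx}|, i < #|{: T}|) B (enum_val j) (enum_val i).
have BA : Bm *m A = 1%:M.
  apply/matrixP => i j; rewrite !mxE.
  have := congr1 (fun v : lattice => v (enum_val j)) (hB (enum_val i)).
  rewrite ffunE (inj_eq enum_val_inj) eq_sym sum_ffunE (reindex_onto enum_val enum_rank) /=; last first.
    by move=> x _; rewrite enum_rankK.
  move=> e; rewrite -mulr_natr mul1r natz e.
  apply: eq_big => [l|l _]; first by rewrite enum_valK eqxx.
  by rewrite !mxE ffunMzE mulrzz mulrC.
have cT : #|{: T}| = #|{: pidx}| by rewrite -card_pidx_qidx card_sum.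
(* Generation gives a one-sided inverse of the coefficient matrix. Since the matrix is square by the
   rank count, the inverse is two-sided, and no combination of rows vanishes. *)
have AB := mulmx1C_rect cT BA.
move=> h q; pose u := \row_(i < #|{: T}|) (match enum_val i with inl q => c q | inr _ => 0 end).
have uA : u *m A = 0.
  apply/rowP => j; rewrite !mxE.
  have {}h : \sum_q (jrel q *~ c q) (enum_val j) = 0.
    by have := congr1 (fun v : lattice => v (enum_val j)) h; rewrite ffunE sum_ffunE.
  transitivity (\sum_(x : T) (match x with inl q => c q | inr _ => 0 end) * gen x (enum_val j)).
    rewrite [RHS](reindex_onto enum_val enum_rank) /=; last by move=> x _; rewrite enum_rankK.
    by apply: eq_big => [l|l _]; rewrite ?enum_valK ?eqxx // !mxE.
  transitivity (\sum_q (jrel q *~ c q) (enum_val j)); last exact: h.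
  rewrite (@big_sumType _ _ _ qidx) -[RHS]addr0; congr (_ + _).
    by apply: eq_bigr => q' _; rewrite ffunMzE mulrzz mulrC.
  by rewrite big1 // => x _; rewrite mul0r.
have := congr1 (mulmx^~ Bm) uA; rewrite -mulmxA AB mulmx1 mul0mx.
by move/rowP => /(_ (enum_rank (inl q : T))); rewrite !mxE enum_rankK.
Qed.

End Lattice.

(** * Monomial actions on rational function fields *)

Section FractionLift.

Variable R : idomainType.
Local Notation tofrac := (@tofrac R).

Lemma fraction_ratio (x : {fraction R}) : exists nd : R * R,
  nd.2 != 0 /\ x = tofrac nd.1 / tofrac nd.2.
Proof.
elim/quotW: x => r; exists (\n_r, \d_r); split; first exact: denom_ratioP.
have d0 : tofrac \d_r != 0 by rewrite tofrac_eq0 denom_ratioP.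
apply: (mulIf d0); rewrite divfK //.
unlock FracField.tofrac; rewrite -[LHS]FracField.pi_mul; apply/eqmodP => /=.
rewrite FracField.equivfE.
rewrite /FracField.mulf !numden_Ratio ?mulf_neq0 ?oner_neq0 ?denom_ratioP //.
by rewrite !mulr1 mulrC.
Qed.

(** Numerators and denominators are chosen once for each fraction; [FE] shows that the value is
    independent of the choice, and additivity and multiplicativity follow. *)
Lemma fraction_lift (L : fieldType) (f : {rmorphism R -> L}) : injective f ->
  {F : {rmorphism {fraction R} -> L} | forall r, F (tofrac r) = f r}.
Proof.
move=> finj; apply: boolp.constructive_indefinite_description.
have /boolp.choice[nd hnd] := fraction_ratio.
pose F x := f (nd x).1 / f (nd x).2.
have f0 r : r != 0 -> f r != 0 by apply: contraNneq => e; apply/eqP/finj; rewrite e rmorph0.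
have FE n d x : d != 0 -> x = tofrac n / tofrac d -> F x = f n / f d.
  move=> d0 e; have [d0' e'] := hnd x.
  apply/eqP; rewrite eqr_div ?f0 // -!rmorphM (inj_eq finj).
  by rewrite -tofrac_eq !rmorphM -eqr_div ?tofrac_eq0 // -e' -e.
have Fr r : F (tofrac r) = f r.
  by rewrite (FE r 1) ?rmorph1 ?divr1 ?oner_neq0.
have FB : zmod_morphism F.
  move=> x y; have [dx ex] := hnd x; have [dy ey] := hnd y.
  rewrite (FE ((nd x).1 * (nd y).2 - (nd y).1 * (nd x).2) ((nd x).2 * (nd y).2)).
  - rewrite rmorphB !rmorphM /F -[- (f (nd y).1 / _)]mulNr addf_div ?f0 //.
    by rewrite mulNr.
  - exact: mulf_neq0.
  - rewrite {1}ex {1}ey -[- (tofrac _ / _)]mulNr addf_div ?tofrac_eq0 //.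
    by rewrite rmorphB !rmorphM mulNr.
have FM : monoid_morphism F.
  split=> [|x y]; first by rewrite -[1](rmorph1 tofrac) Fr rmorph1.
  have [dx ex] := hnd x; have [dy ey] := hnd y.
  rewrite (FE ((nd x).1 * (nd y).1) ((nd x).2 * (nd y).2)).
  - by rewrite !rmorphM /F mulf_div.
  - exact: mulf_neq0.
  - by rewrite {1}ex {1}ey mulf_div !rmorphM.
pose Fz := GRing.isZmodMorphism.Build _ _ F FB.
pose Fm := GRing.isMonoidMorphism.Build _ _ F FM.
pose Fr' : {rmorphism {fraction R} -> L} := HB.pack F Fz Fm.
by exists Fr'.
Qed.

Lemma fraction_morph_eq (L : fieldType) (f g : {rmorphism {fraction R} -> L}) :
  (forall r, f (tofrac r) = g (tofrac r)) -> f =1 g.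
Proof.
move=> e x; have [[n d] [/= d0 ->]] := fraction_ratio x.
by rewrite !fmorph_div !e.
Qed.

End FractionLift.

Section RationalFunctions.

Variables (F : fieldType) (T : finType).
Local Notation poly := {mpoly F[#|T|]}.

Definition ratfun : fieldType := {fraction poly}.
Definition rf_const : {rmorphism F -> ratfun} := @tofrac poly \o @mpolyC #|T| F.
Definition rf_var (t : T) : ratfun := @tofrac poly 'X_(enum_rank t).

Lemma tofrac_mmap (p : poly) :
  mmap rf_const (fun i => rf_var (enum_val i)) p = @tofrac poly p.
Proof.
elim/mpolyind: p => [|c m p _ _ IH]; first by rewrite !raddf0.
rewrite !raddfD /= IH; congr (_ + _).
rewrite mmapZ mmapX -mul_mpolyC rmorphM; congr (_ * _).
rewrite /mmap1 [in RHS]mpolyXE_id rmorph_prod; apply: eq_bigr => i _.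
by rewrite rmorphXn /rf_var enum_valK.
Qed.

Lemma rf_var_indep : indep (image_of rf_const) rf_var.
Proof.
have h : indep (image_of rf_const) (rf_var \o (enum_val : 'I_#|T| -> T)).
  apply/alg_independent_indep => p; rewrite tofrac_mmap => /eqP.
  by rewrite tofrac_eq0 => /eqP.
have R := subf_ring (image_of_field rf_const).
have := indep_inj R (indep_neq0 R h) (@enum_rank_inj T) h.
by apply: eq_indep => t /=; rewrite enum_rankK.
Qed.



(** The condition on [a] is the cocycle identity that makes the monomial substitutions compose like
    [G]. *)
Lemma rf_monomial_action (G : finGroupType) (pi : G -> T -> T) (a : G -> T -> F) :
  (forall t, pi 1%g t = t) -> (forall g h t, pi (g * h)%g t = pi g (pi h t)) ->
  (forall t, a 1%g t = 1) -> (forall g h t, a (g * h)%g t = a h t * a g (pi h t)) ->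
  exists act : G -> {rmorphism ratfun -> ratfun},
    [/\ forall x, act 1%g x = x, forall g h x, act (g * h)%g x = act g (act h x),
        forall g c, act g (rf_const c) = rf_const c &
        forall g t, act g (rf_var t) = rf_const (a g t) * rf_var (pi g t)].
Proof.
move=> pi1 piM a1 aM.
pose img g (i : 'I_#|T|) : poly := a g (enum_val i) *: 'X_(enum_rank (pi g (enum_val i))).
pose Phi g : {rmorphism poly -> poly} := mmap (@mpolyC #|T| F) (img g).
have PhiC g c : Phi g c%:MP = c%:MP by apply: mmapC.
have PhiX g t : Phi g 'X_(enum_rank t) = a g t *: 'X_(enum_rank (pi g t)).
  by rewrite /Phi /= mmapX mmap1U /img enum_rankK.
have Phi_eq (f f' : {rmorphism poly -> poly}) : (forall c, f c%:MP = f' c%:MP) ->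
    (forall t, f 'X_(enum_rank t) = f' 'X_(enum_rank t)) -> f =1 f'.
  move=> hc hv p; rewrite [p]mpolyE !rmorph_sum; apply: eq_bigr => m' _.
  rewrite -mul_mpolyC !rmorphM hc; congr (_ * _); rewrite mpolyXE_id !rmorph_prod.
  by apply: eq_bigr => i _; rewrite !rmorphXn -[i]enum_valK hv.
have Phi1 : Phi 1%g =1 id.
  apply: (Phi_eq (Phi 1%g) idfun) => [c|t]; first by rewrite PhiC.
  by rewrite PhiX a1 pi1 scale1r.
have PhiM g h : Phi (g * h)%g =1 Phi g \o Phi h.
  apply: (Phi_eq (Phi (g * h)%g) (Phi g \o Phi h)) => [c|t] /=; first by rewrite !PhiC.
  by rewrite !PhiX -[in RHS]mul_mpolyC rmorphM PhiC PhiX mul_mpolyC scalerA aM piM.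
(* Each substitution is inverted by that of [g^-1], so it extends to fractions. *)
have Phi_inj g : injective (@tofrac poly \o Phi g).
  move=> p q /= /eqP; rewrite tofrac_eq => /eqP e.
  by rewrite -[p]Phi1 -[q]Phi1 -(mulVg g) !PhiM /= e.
pose act g := sval (fraction_lift (f := @tofrac poly \o Phi g) (Phi_inj g)).
have actE g p : act g (tofrac p) = tofrac (Phi g p) := svalP (fraction_lift (Phi_inj g)) p.
exists act; split.
- by apply: (fraction_morph_eq (g := idfun)) => p; rewrite actE Phi1.
- move=> g h; apply: (fraction_morph_eq (g := act g \o act h)) => p /=.
  apply: etrans (actE _ _) _; rewrite PhiM; apply: esym.
  exact: etrans (congr1 (act g) (actE h p)) (actE g _).
- by move=> g c; rewrite /rf_const /= actE PhiC.
- move=> g t; rewrite /rf_var actE PhiX -mul_mpolyC rmorphM.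
  by [].
Qed.

(** Stated for the bare field of fractions, to which [gcp_field] unfolds when [S] is the type of
    triples. *)
Lemma rf_embedding (S : finType) (j : S -> T) : injective j ->
  exists emb : {rmorphism {fraction {mpoly F[#|S|]}} -> ratfun},
    (forall c, emb (tofrac c%:MP) = rf_const c) /\
    (forall s, emb (tofrac 'X_(enum_rank s)) = rf_var (j s)).
Proof.
move=> j_inj.
pose Phi : {rmorphism {mpoly F[#|S|]} -> poly} :=
  mmap (@mpolyC #|T| F) (fun i => 'X_(enum_rank (j (enum_val i)))).
have Phi_inj : injective (@tofrac poly \o Phi).
  move=> p q /= /eqP; rewrite tofrac_eq -subr_eq0 -raddfB => /eqP e.
  apply/eqP; rewrite -subr_eq0; apply/eqP; move: (p - q) e => {p q} p e.
  have R := subf_ring (image_of_field rf_const).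
  have := indep_inj R (indep_neq0 R rf_var_indep) (inj_comp j_inj (@enum_val_inj _ S)) rf_var_indep.
  move/alg_independent_indep; apply.
  have := congr1 (@tofrac poly) e; rewrite raddf0 => <-.
  rewrite -tofrac_mmap /Phi /=.
  elim/mpolyind: p {e} => [|c m' p _ _ IH]; first by rewrite !raddf0.
  rewrite !raddfD /= IH; congr (_ + _); rewrite !mmapZ !mmapX mul_mpolyC mmapZ; congr (_ * _).
  rewrite /mmap1 rmorph_prod; apply: eq_bigr => i _.
  by rewrite rmorphXn /= mmapX mmap1U enum_rankK.
exists (sval (fraction_lift Phi_inj)); split=> [c|x].
  by rewrite (svalP (fraction_lift Phi_inj)) /= mmapC.
by rewrite (svalP (fraction_lift Phi_inj)) /= mmapX mmap1U enum_rankK.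
Qed.

End RationalFunctions.

(** * The fixed field of the base *)

Lemma big_option_bool (R : Type) (idx : R) (op : Monoid.com_law idx) (f : option bool -> R) :
  \big[op/idx]_i f i = op (f None) (op (f (Some false)) (f (Some true))).
Proof.
rewrite (bigD1 None) // (bigD1 (Some false)) // (bigD1 (Some true)) //= big1 ?Monoid.mulm1 //.
by case=> [[]|].
Qed.

Section BaseField.

Variables (G : finGroupType) (n m : nat) (s t : G).
Hypothesis mg : metacyclic_gens n m s t.
Variables (K : fieldType) (act : G -> {rmorphism K -> K}).
Hypothesis act1 : forall a, act 1%g a = a.
Hypothesis actM : forall g h a, act (g * h)%g a = act g (act h a).
Variables (k : K -> Prop) (kF : is_subfield k).
Hypothesis act_k : forall g a, k a -> act g a = a.
Variables (zeta eta : K) (x : option bool -> K).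
Hypotheses (k_zeta : k zeta) (k_eta : k eta).
Hypotheses (prim_zeta : n.-primitive_root zeta) (prim_eta : (2 * m).-primitive_root eta).
Hypotheses (n_neq0 : n%:R != 0 :> K) (m2_neq0 : (2 * m)%:R != 0 :> K).
Hypothesis x_indep : indep k x.

Let u := x (Some false).
Let v := x (Some true).
Let y := x None.

Hypotheses (su : act s u = zeta * u) (sv : act s v = zeta^-1 * v) (sy : act s y = y).
Hypotheses (tu : act t u = v) (tv : act t v = u) (ty : act t y = eta * y).

Let x0 i : x i != 0. Proof. exact: indep_neq0 (subf_ring kF) x_indep i. Qed.
Let u0 : u != 0 := x0 _.
Let v0 : v != 0 := x0 _.
Let y0 : y != 0 := x0 _.
Let a := n./2.
Let nE : n = a.*2.+1. Proof. by rewrite -[LHS]odd_double_half (mg_n_odd mg). Qed.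

(* [pq ord0 * pq ord_max = u v] and [pq ord0 / pq ord_max = (u / v)^n]; these are
   fixed by [s] and swapped by [t], so that [t] acts linearly on their span. *)
Definition pq (i : 'I_2) : K := if i == ord0 then u ^+ a.+1 / v ^+ a else v ^+ a.+1 / u ^+ a.

(** The difference of the two [pq] and the factor [y ^+ m] both change sign under [t], the latter
    because [eta ^+ m = -1]. *)
Definition base_gen (j : unit + 'I_2) : K :=
  match j with
  | inl _ => y ^+ (2 * m)
  | inr i => if i == ord0 then pq ord0 + pq ord_max else y ^+ m * (pq ord0 - pq ord_max)
  end.

Let ypq (j : unit + 'I_2) : K := match j with inl _ => y | inr i => pq i end.

Let kR := subf_ring kF.

(** The exponents of [u] and [v] in the two [pq] form a matrix with [a + 1] on the diagonal and
    [- a] off it, of determinant [2a + 1 = n]. *)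
Lemma ypq_indep : indep k ypq.
Proof.
pose A (j : unit + 'I_2) (b : option bool) : int :=
  match j, b with
  | inl _, None => 1
  | inl _, Some _ => 0
  | inr i, None => 0
  | inr i, Some b => if (i == ord0) (+) b then a.+1%:Z else - a%:Z
  end.
have kz : forall w, k w -> k w by [].
apply: (@eq_indep _ _ _ (fun j => laurent x (A j))).
  have i1 (b c : K) i j : b ^ (i%:Z) * c ^ (- j%:Z) = b ^+ i / c ^+ j.
    by rewrite -exprnP -exprnN.
  case=> [[]|i]; rewrite /laurent big_option_bool /=; first by rewrite !expr0z expr1z !mulr1.
  rewrite expr0z mul1r /pq; case: (i == ord0) => /=; rewrite ?i1 //.
  by rewrite mulrC i1.
apply: indep_laurent => // w hw.
have split2 (f : unit + 'I_2 -> int) :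
    \sum_j f j = f (inl tt) + (f (inr ord0) + f (inr ord_max)).
  rewrite big_sumType /= !big_ord_recl big_ord0 addr0.
  rewrite (bigD1 tt) //= big1 => [|[] //]; rewrite addr0.
  by congr (_ + (_ + f (inr _))); apply: val_inj.
have := hw None; have := hw (Some false); have := hw (Some true).
rewrite !split2 /= !mulr0 !mulr1 !addr0 !add0r !intS => h1 h2 h3.
have e : w (inr ord0) = - w (inr ord_max).
  apply/eqP; rewrite -addr_eq0; apply/eqP; apply: etrans (congr2 +%R h1 h2).
  by ring.
have e1 : w (inr ord_max) = 0.
  have /eqP : w (inr ord_max) * (1 + 2 * a%:Z) = 0 by rewrite -[RHS]h1 e; ring.
  by rewrite mulf_eq0 => /orP[/eqP //|]; lia.
have e0 : w (inr ord0) = 0 by rewrite e e1 oppr0.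
case=> [[] //|i]; have [->//|] := eqVneq i ord0.
case: i => [[|[|]]] //= i_lt _; rewrite -[RHS]e1; congr (w (inr _)).
exact: val_inj.
Qed.

Let sum2 (f : 'I_2 -> K) : \sum_i f i = f ord0 + f ord_max.
Proof. by rewrite !big_ord_recl big_ord0 addr0; congr (_ + f _); apply: val_inj. Qed.

Let neq2 : (2%:R : K) != 0.
Proof. by apply: contraNneq m2_neq0 => e; rewrite natrM e mul0r. Qed.

Let m_gt0 : (0 < 2 * m)%N := tm2_gt0 mg.

(** Over the field generated by [y], the last two generators are linear in the [pq], with
    determinant [-2 y^m], which is nonzero as 2 is invertible. *)
Lemma base_gen_indep : indep k base_gen.
Proof.
pose S := adjoin k (ypq \o inl).
have SF : is_subfield S by apply: adjoin_field.
have SR := subf_ring SF.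
have Sy : S y by apply: (adjoin_gen kR (ypq \o inl) tt).
have yi : indep k (ypq \o inl).
  apply: (indep_inj kR (indep_neq0 kR ypq_indep) _ ypq_indep).
  by move=> p q [].
apply: (@indep_tower _ _ _ base_gen k S) => //.
- by move=> b kb; apply: adjoin_base.
- by move=> []; apply: (subr_X SR).
- apply: (@eq_indep _ _ _ (fun _ : unit => laurent (ypq \o inl) (fun=> (2 * m)%:Z))).
    by case; rewrite /laurent (bigD1 tt) //= big1 ?mulr1 // => -[].
  apply: indep_laurent => //.
  move=> w /(_ tt); rewrite (bigD1 tt) //= big1 => [|[] //]; rewrite addr0 => /eqP.
  by rewrite mulf_eq0 => /orP[/eqP e []//|]; have := m_gt0; lia.
pose Z : 'M[K]_2 := \matrix_(i, j) if i == ord0 then 1 else y ^+ m * (if j == ord0 then 1 else -1).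
apply: (@eq_indep _ _ _ (fun i => \sum_j Z i j * (ypq \o inr) j)).
  move=> i; rewrite sum2 !mxE /=; case: (i == ord0) => /=; first by rewrite !mul1r.
  by rewrite mulr1 -mulrA mulN1r -mulrDr.
apply: (indep_linear SF).
- move=> i j; rewrite mxE; case: ifP => _; first exact: subr_1.
  apply: (subr_M SR); first exact: (subr_X SR).
  by case: ifP => _; [|apply: (subr_N SR)]; apply: subr_1.
- rewrite unitmxE unitfE (expand_det_row _ ord0) sum2 /cofactor !det_mx11 !mxE /=.
  rewrite !addn0 add0n expr0 expr1 !mul1r mulr1 mulrN1 mulN1r -opprD oppr_eq0.
  by rewrite -mulr2n -mulr_natr mulf_neq0 ?expf_neq0 // y0.
- exact: (indep_untower kF ypq_indep).
Qed.

Let eta_m : eta ^+ m = -1.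
Proof.
have e : (eta ^+ m - 1) * (eta ^+ m + 1) = 0.
  by rewrite -subr_sqr expr1n -exprM mulnC (prim_expr_order prim_eta) subrr.
move/eqP: e; rewrite mulf_eq0 subr_eq0 -(prim_order_dvd prim_eta) addr_eq0.
by case/orP => [/dvdn_leq|/eqP //]; have := m_gt0; lia.
Qed.

Lemma pq_s i : act s (pq i) = pq i.
Proof.
have zn : zeta ^+ a * zeta ^+ a.+1 = 1.
  by rewrite -exprD addnS addnn -nE (prim_expr_order prim_zeta).
rewrite /pq; case: ifP => _; rewrite fmorph_div !rmorphXn su sv !exprMn !exprVn.
  by rewrite invfM invrK mulrACA [_ ^+ a.+1 * _]mulrC zn mul1r.
by rewrite invfM mulrACA -invfM mulrC [zeta ^+ a.+1 * _]mulrC zn invr1 mulr1.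
Qed.

Lemma pq_t i : act t (pq i) = if i == ord0 then pq ord_max else pq ord0.
Proof. by rewrite /pq; case: ifP => _; rewrite fmorph_div !rmorphXn tu tv. Qed.

Lemma base_gen_s j : act s (base_gen j) = base_gen j.
Proof.
case: j => [_|i] /=; first by rewrite rmorphXn sy.
by case: ifP => _; rewrite ?rmorphM ?rmorphXn ?rmorphB ?rmorphD !pq_s ?sy.
Qed.

Lemma base_gen_t j : act t (base_gen j) = base_gen j.
Proof.
case: j => [_|i] /=.
  by rewrite rmorphXn ty exprMn (prim_expr_order prim_eta) mul1r.
case: ifP => _; first by rewrite rmorphD !pq_t /= addrC.
rewrite rmorphM rmorphXn rmorphB !pq_t /= ty exprMn eta_m mulN1r mulNr -mulrN.
by rewrite opprB.
Qed.

Lemma inv_by_gens w : act s w = w -> act t w = w -> inv_by act [set: G] w.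
Proof.
move=> sw tw g _; have [i [j ->]] := mg_gen mg g.
have sX : act (s ^+ j)%g w = w by elim: j => [|j IH]; rewrite ?expg0 ?act1 // expgSr actM sw.
by rewrite actM sX; elim: i => [|i IH]; rewrite ?expg0 ?act1 // expgSr actM tw.
Qed.

Lemma base_gen_inv j : inv_by act [set: G] (base_gen j).
Proof. by apply: inv_by_gens; [apply: base_gen_s | apply: base_gen_t]. Qed.

Lemma adjoin_pq (A : K -> Prop) : is_subfield A -> A u -> A v -> forall i, A (pq i).
Proof.
move=> AF Au Av i; have AR := subf_ring AF.
by rewrite /pq; case: ifP => _; apply: (subf_div AF); apply: (subr_X AR).
Qed.

Lemma base_gen_in j : adjoin k x (base_gen j).
Proof.
have AF := adjoin_field kR x; have AR := subf_ring AF.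
have pqA := adjoin_pq AF (adjoin_gen kR x _) (adjoin_gen kR x _).
case: j => [_|i] /=; first by apply: (subr_X AR); apply: adjoin_gen.
case: ifP => _; first exact: (subr_D AR).
by apply: (subr_M AR); [apply: (subr_X AR); apply: adjoin_gen | apply: (subr_B AR)].
Qed.

(** Two Kummer extensions are descended in turn. Over [k1], generated by [y] and the [pq], the
    generator is [u] and the automorphism [s]; over [k2], generated by the two invariants built from
    the [pq], the generator is [y] and the automorphism [t]. *)
Lemma base_gen_generate w : adjoin k x w -> act s w = w -> act t w = w -> adjoin k base_gen w.
Proof.
move=> xw sw tw.
pose k1 := adjoin k ypq; have k1F : is_subfield k1 by apply: adjoin_field.
have k1R := subf_ring k1F.
have k1y : k1 y by apply: (adjoin_gen kR ypq (inl tt)).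
have k1pq i : k1 (pq i) by apply: (adjoin_gen kR ypq (inr i)).
have k1s b : k1 b -> act s b = b.
  move=> k1b; apply: (adjoin_min (S := fun b => act s b = b) _ _ _ k1b).
  - split; first split; first exact: rmorph1.
    + by move=> c d ec ed; rewrite rmorphB ec ed.
    + by move=> c d ec ed; rewrite rmorphM ec ed.
    + by move=> c ec; rewrite fmorphV ec.
  - by move=> c /act_k.
  - by case=> [[]|i] //=; apply: pq_s.
have uvE : pq ord0 * pq ord_max = u * v.
  rewrite /pq /= mulrACA -invfM ![_ ^+ a.+1]exprS -exprMn mulrACA -!exprMn [v * u]mulrC.
  by rewrite mulfK // expf_neq0 // mulf_neq0.
(* This puts [u ^+ n] in [k1], so the first descent ends in [k1]. *)
have unE : u ^+ n = pq ord0 * (pq ord0 * pq ord_max) ^+ a.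
  rewrite uvE nE {1}/pq /= exprMn mulrACA mulVf ?expf_neq0 // mulr1 -exprD; congr (_ ^+ _).
  by rewrite -addnn addSn.
have k1w : k1 w.
  have k1u : adjoin k1 (fun _ : 'I_1 => u) w.
    have F1 := adjoin_field k1R (fun _ : 'I_1 => u); have R1 := subf_ring F1.
    apply: (adjoin_min F1 _ _ xw) => [b kb|].
      by apply: (adjoin_base k1R); apply: adjoin_base.
    have Au : adjoin k1 (fun _ : 'I_1 => u) u by apply: (adjoin_gen k1R (fun _ : 'I_1 => u) ord0).
    case=> [[]|]; [|exact: Au|exact: adjoin_base].
    (* Over [k1] the variable [v] is expressed by [u], as [u v] is the product of the two [pq]. *)
    have -> : x (Some true) = pq ord0 * pq ord_max / u by rewrite uvE mulrAC divff ?mul1r.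
    apply: (subf_div F1) => //; apply: adjoin_base => //; exact: (subr_M k1R).
  have := kummer_descent act1 actM k1F k1s _ prim_zeta su n_neq0 k1u sw.
  move=> /(_ (adjoin_base kR ypq k_zeta)); apply: adjoin_min => // _.
  by rewrite unE; apply: (subr_M k1R) => //; apply: (subr_X k1R); apply: (subr_M k1R).
pose k2 := adjoin k (base_gen \o inr); have k2F : is_subfield k2 by apply: adjoin_field.
have k2R := subf_ring k2F.
have k2t b : k2 b -> act t b = b.
  move=> k2b; apply: (adjoin_min (S := fun b => act t b = b) _ _ _ k2b).
  - split; first split; first exact: rmorph1.
    + by move=> c d ec ed; rewrite rmorphB ec ed.
    + by move=> c d ec ed; rewrite rmorphM ec ed.
    + by move=> c ec; rewrite fmorphV ec.
  - by move=> c /act_k.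
  - by move=> i; apply: (base_gen_t (inr i)).
have k2y : adjoin k2 (fun _ : 'I_1 => y) w.
  have F1 := adjoin_field k2R (fun _ : 'I_1 => y); have R1 := subf_ring F1.
  have Ay : adjoin k2 (fun _ : 'I_1 => y) y by apply: (adjoin_gen k2R (fun _ : 'I_1 => y) ord0).
  apply: (adjoin_min F1 _ _ k1w) => [b kb|].
    by apply: (adjoin_base k2R); apply: adjoin_base.
  have A0 : adjoin k2 (fun _ : 'I_1 => y) (pq ord0 + pq ord_max).
    by apply: adjoin_base => //; apply: (adjoin_gen kR (base_gen \o inr) ord0).
  have A1 : adjoin k2 (fun _ : 'I_1 => y) (pq ord0 - pq ord_max).
    (* Adjoining [y] to [k2] recovers the difference of the [pq]; with their sum and division by 2
       this gives all of [k1]. *)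
    have -> : pq ord0 - pq ord_max = base_gen (inr ord_max) / y ^+ m.
      by rewrite /= mulrAC divff ?mul1r ?expf_neq0.
    apply: (subf_div F1); last exact: (subr_X R1).
    by apply: adjoin_base => //; apply: (adjoin_gen kR (base_gen \o inr) ord_max).
  have A2 : adjoin k2 (fun _ : 'I_1 => y) 2%:R by apply: (subr_nat R1).
  case=> [[] //|i] /=.
  have [->|] := eqVneq i ord0.
    have -> : pq ord0 = ((pq ord0 + pq ord_max) + (pq ord0 - pq ord_max)) / 2%:R.
      by field.
    by apply: (subf_div F1) => //; apply: (subr_D R1).
  move=> i0; have -> : i = ord_max by apply/val_inj; case: i i0 => [[|[|]]].
  have -> : pq ord_max = ((pq ord0 + pq ord_max) - (pq ord0 - pq ord_max)) / 2%:R.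
    by field.
  by apply: (subf_div F1) => //; apply: (subr_B R1).
have := kummer_descent act1 actM k2F k2t _ prim_eta ty m2_neq0 k2y tw.
move=> /(_ (adjoin_base kR _ k_eta)).
have F0 := adjoin_field kR base_gen.
apply: (adjoin_min F0) => [b|_]; last exact: (adjoin_gen kR base_gen (inl tt)).
apply: (adjoin_min F0) => [c kc|i]; first exact: adjoin_base.
exact: (adjoin_gen kR base_gen (inr i)).
Qed.

End BaseField.

(** * The center of the generic crossed product *)

Section Center.

Variables (F : fieldType) (G : finGroupType) (k : nat).
Variables (Om : fieldType) (emb : {rmorphism gcp_field F G k -> Om}).
Variable act : G -> {rmorphism Om -> Om}.
Hypothesis act1 : forall a, act 1%g a = a.
Hypothesis actM : forall g h a, act (g * h)%g a = act g (act h a).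
Hypothesis act_const : forall g c, act g (emb (gcp_const F G k c)) = emb (gcp_const F G k c).
Hypothesis act_var : forall g h x i,
  act g (emb (gcp_var F h x i)) = emb (gcp_var F (g * h)%g (g * x)%g i).
Variable i0 : 'I_k.

Local Notation M := 'M[gcp_field F G k]_#|G|.
Local Notation gring := (@generic_ring F G k).
Local Notation consts := (image_of (emb \o gcp_const F G k)).

Definition xv (h x : G) (i : 'I_k) : Om := emb (gcp_var F h x i).
Definition tv (g : G) : Om := xv 1%g g i0.
(** The monomial of a closed walk from 1 to [h], along the edge [e] to [g], and back to 1 along a
    reversed edge. *)
Definition ell (e : G * G * 'I_k) : Om := tv e.1.1 * xv e.1.1 e.1.2 e.2 / tv e.1.2.
Definition walk_field : Om -> Prop := adjoin consts ell.

Lemma xv_neq0 h x i : xv h x i != 0.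
Proof. by rewrite fmorph_eq0 gcp_var_neq0. Qed.

Lemma walk_fieldF : is_subfield walk_field.
Proof. exact/adjoin_field/subf_ring/image_of_field. Qed.

Lemma walk_const c : walk_field (emb (gcp_const F G k c)).
Proof. by apply: adjoin_base; [apply/subf_ring/image_of_field | exists c]. Qed.

Lemma cp_gen_entry (g : G) i (a b : G) :
  cp_gen (@gcp_var F G k) g i (enum_rank a) (enum_rank b) =
  gcp_var F a (a * g)%g i * ((a * g)%g == b)%:R.
Proof. by rewrite -[cp_gen _ g i]mulr1 mul_cp_genl mxE (inj_eq enum_rank_inj). Qed.

(** An entry at [(h, x)] collects walks from [h] to [x], and [tv h / tv x] closes them up at 1. In a
    product of matrices the factors at the middle vertex cancel. *)
Lemma ring_entries (r : M) : gring r -> forall h x,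
  walk_field (emb (r (enum_rank h) (enum_rank x)) * tv h / tv x) /\
  forall g, act g (emb (r (enum_rank h) (enum_rank x))) =
    emb (r (enum_rank (g * h)%g) (enum_rank (g * x)%g)).
Proof.
have WF := walk_fieldF; have WR := subf_ring WF.
elim=> {r} [a|_ [g [i ->]]|r r' _ IH _ IH'|r r' _ IH _ IH'] h x.
- rewrite /cp_scalar !mxE (inj_eq enum_rank_inj); have [->|ne] := eqVneq h x.
    split=> [|g]; first by rewrite mulr1n mulfK ?xv_neq0 //; apply: walk_const.
    by rewrite mulr1n mxE eqxx mulr1n act_const.
  split=> [|g]; first by rewrite mulr0n rmorph0 !mul0r; apply: subr_0.
  by rewrite mulr0n !rmorph0 mxE (inj_eq enum_rank_inj) (inj_eq (mulgI g)) (negPf ne) mulr0n rmorph0.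
- rewrite cp_gen_entry; split=> [|g']; last first.
    rewrite cp_gen_entry -mulgA (inj_eq (mulgI g')) !rmorphM act_var !rmorph_nat.
    by rewrite mulgA.
  have [<-|ne] := eqVneq; last by rewrite mulr0 rmorph0 !mul0r; apply: subr_0.
  rewrite mulr1 [emb _ * _]mulrC.
  exact: (adjoin_gen (subf_ring (image_of_field _)) ell (h, (h * g)%g, i)).
- have [w e] := IH h x; have [w' e'] := IH' h x; split=> [|g].
    by rewrite mxE rmorphD !mulrDl; apply: (subr_D WR).
  by rewrite !mxE !rmorphD e e'.
- have entryM (a b : G) : (r * r') (enum_rank a) (enum_rank b) =
      \sum_y r (enum_rank a) (enum_rank y) * r' (enum_rank y) (enum_rank b).
    rewrite -[r * r']/(r *m r') mxE (reindex_onto enum_rank enum_val) /=; last first.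
      by move=> j _; rewrite enum_valK.
    by apply: eq_bigl => y; rewrite enum_rankK eqxx.
  split=> [|g].
    rewrite entryM rmorph_sum !mulr_suml; apply: (subr_sum WR) => y _.
    have [w _] := IH h y; have [w' _] := IH' y x.
    have -> : emb (r (enum_rank h) (enum_rank y) * r' (enum_rank y) (enum_rank x)) * tv h / tv x =
        (emb (r (enum_rank h) (enum_rank y)) * tv h / tv y) *
        (emb (r' (enum_rank y) (enum_rank x)) * tv y / tv x).
      by rewrite rmorphM; field; rewrite !xv_neq0.
    exact: (subr_M WR).
  rewrite !entryM !rmorph_sum [RHS](reindex_inj (mulgI g)); apply: eq_bigr => y _.
  by rewrite !rmorphM (proj2 (IH h y)) (proj2 (IH' y x)).
Qed.

(* The scalars [f] whose orbit, placed on the diagonal, is in the generic ring. *)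
Definition diag_orbit (f : Om) := exists2 r : M, gring r &
  forall h x, emb (r (enum_rank h) (enum_rank x)) = act h f * (h == x)%:R.

Lemma diag_orbit_mul (r r' : M) f f' :
  (forall h x, emb (r (enum_rank h) (enum_rank x)) = act h f * (h == x)%:R) ->
  (forall h x, emb (r' (enum_rank h) (enum_rank x)) = act h f' * (h == x)%:R) ->
  forall h x, emb ((r * r') (enum_rank h) (enum_rank x)) = act h (f * f') * (h == x)%:R.
Proof.
move=> e e' h x; rewrite -[r * r']/(r *m r') mxE (bigD1 (enum_rank h)) //= big1 ?addr0.
  by rewrite rmorphM e e' eqxx mulr1 rmorphM mulrA.
move=> j nj; apply: (fmorph_inj emb); rewrite rmorphM rmorph0 -[j]enum_valK e.
by rewrite -(inj_eq enum_rank_inj) enum_valK eq_sym (negPf nj) mulr0 mul0r.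
Qed.

Lemma diag_orbit_ring : is_subring diag_orbit.
Proof.
split.
- exists 1; first exact: cp_ring1.
  by move=> h x; rewrite mxE (inj_eq enum_rank_inj) rmorph1 mul1r rmorph_nat.
- move=> f f' [r Rr e] [r' Rr' e']; exists (r - r').
    by apply: GenAdd => //; apply: cp_ringN.
  by move=> h x; rewrite !mxE rmorphB e e' -mulrBl rmorphB.
- move=> f f' [r Rr e] [r' Rr' e']; exists (r * r'); first exact: GenMul.
  exact: diag_orbit_mul.
Qed.

Lemma gring_gen g i : gring (cp_gen (@gcp_var F G k) g i).
Proof. by apply: GenIn; exists g, i. Qed.

Lemma diag_orbit_const c : diag_orbit (emb (gcp_const F G k c)).
Proof.
exists (cp_scalar (gcp_const F G k) G c); first exact: GenScalar.
move=> h x; rewrite mxE (inj_eq enum_rank_inj) act_const.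
by case: (h == x); rewrite ?mulr1n ?mulr1 // mulr0n mulr0 rmorph0.
Qed.

Definition round_trip g := xv 1%g g i0 * xv g 1%g i0.

(** Conjugation by a generic matrix translates the diagonal. Returning with the generator of [g^-1]
    instead of an inverse, which stays in the ring, costs the factor [round_trip g]. *)
Lemma diag_orbit_conj g f : diag_orbit f -> diag_orbit (round_trip g * act g f).
Proof.
move=> [r Rr e]; exists (cp_gen (@gcp_var F G k) g i0 * (r * cp_gen (@gcp_var F G k) g^-1%g i0)).
  by apply: GenMul; [apply: gring_gen | apply: GenMul => //; apply: gring_gen].
move=> h x; rewrite mul_cp_genl -[x](mulgK g) mul_cp_genr mulgK.
rewrite !rmorphM e (inj_eq (mulIg g)) !act_var mulg1 -actM.
have [->|_] := eqVneq h x; last by rewrite !(mulr0, mul0r).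
by rewrite !mulr1 -!mulrA; congr (_ * _); rewrite mulrC.
Qed.

Lemma diag_orbit_triangle h x i : diag_orbit (xv 1%g h i0 * xv h x i * xv x 1%g i0).
Proof.
pose gen := cp_gen (@gcp_var F G k).
exists (gen h i0 * (gen (h^-1 * x)%g i * (gen x^-1%g i0 * 1))).
  apply: GenMul; first exact: gring_gen.
  apply: GenMul; first exact: gring_gen.
  by apply: GenMul; [apply: gring_gen | apply: cp_ring1].
move=> a b; rewrite !mul_cp_genl mxE (inj_eq enum_rank_inj) !mulgA !mulgK.
by rewrite /xv !rmorphM !act_var !mulg1 rmorph_nat !mulrA.
Qed.

Lemma diag_orbit_round g : diag_orbit (round_trip g).
Proof.
rewrite -[round_trip g]mulr1 -(rmorph1 (act g)); apply: diag_orbit_conj.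
exact: (subr_1 diag_orbit_ring).
Qed.

Lemma round_trip_neq0 g : round_trip g != 0.
Proof. by rewrite mulf_neq0 ?xv_neq0. Qed.

(** Each [ell] is a closed triangle [1, h, x, 1] divided by the round trip through [x], and both are
    entries of diagonal matrices in the ring. *)
Lemma walk_field_frac f : walk_field f ->
  exists p q, [/\ diag_orbit p, diag_orbit q, q != 0 & f = p / q].
Proof.
have R := diag_orbit_ring.
apply: (adjoin_min (S := fun f => exists p q, [/\ diag_orbit p, diag_orbit q, q != 0 & f = p / q])).
- split; first split.
  + by exists 1, 1; rewrite divr1 oner_neq0; split=> //; apply: subr_1.
  + move=> _ _ [p [q [pp pq q0 ->]]] [p' [q' [pp' pq' q0' ->]]].
    exists (p * q' - p' * q), (q * q'); rewrite mulf_neq0 //; split=> //.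
    * by apply: (subr_B R); apply: (subr_M R).
    * exact: (subr_M R).
    * by field; rewrite q0 q0'.
  + move=> _ _ [p [q [pp pq q0 ->]]] [p' [q' [pp' pq' q0' ->]]].
    by exists (p * p'), (q * q'); rewrite mulf_neq0 // mulf_div; split=> //; apply: (subr_M R).
  + move=> _ [p [q [pp pq q0 ->]]]; have [->|p0] := eqVneq p 0.
      exists 0, 1; rewrite oner_neq0 !mul0r invr0; split=> //; [exact: subr_0 | exact: subr_1].
    by exists q, p; rewrite invf_div; split.
- move=> _ [c ->]; exists (emb (gcp_const F G k c)), 1; rewrite divr1 oner_neq0.
  by split=> //; [apply: diag_orbit_const | apply: subr_1].
- move=> [[h x] i]; exists (xv 1%g h i0 * xv h x i * xv x 1%g i0), (round_trip x).
  split; [exact: diag_orbit_triangle | exact: diag_orbit_round | exact: round_trip_neq0 |].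
  by rewrite /ell /round_trip /tv /=; field; rewrite !xv_neq0.
Qed.

Lemma diag_orbit_scalar f : diag_orbit f -> inv_by act [set: G] f ->
  exists2 a, emb a = f & gring (a%:M : M).
Proof.
move=> [r Rr e] fi; exists (r (enum_rank 1%g) (enum_rank 1%g)).
  by rewrite e eqxx mulr1 act1.
suff <- : r = (r (enum_rank 1%g) (enum_rank 1%g))%:M by [].
apply/matrixP => a b; rewrite -[a]enum_valK -[b]enum_valK mxE (inj_eq enum_rank_inj).
apply: (fmorph_inj emb); rewrite e fi ?inE //.
case: (_ == _); last by rewrite mulr0n mulr0 rmorph0.
by rewrite mulr1n mulr1 e eqxx mulr1 fi ?inE.
Qed.

(** The denominator has to become invariant while staying in [diag_orbit]. Conjugates stay there
    only after multiplication by round trips, so the norm is taken of [beta * q]. *)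
Lemma walk_fixed_central f : walk_field f -> inv_by act [set: G] f ->
  exists2 a, emb a = f & @generic_crossed_product F G k (a%:M : M).
Proof.
move=> /walk_field_frac[p [q [pp pq q0 fE]]] fi.
have R := diag_orbit_ring.
(* In the norm of [beta * q], the factor [beta] at [g = 1] provides one round trip for each of the
   conjugates. *)
pose beta := \prod_g round_trip g.
have beta0 : beta != 0 by apply/prodf_neq0 => g _; apply: round_trip_neq0.
have Rbeta : diag_orbit beta by apply: (subr_prod R) => g _; apply: diag_orbit_round.
pose rest := round_trip 1%g * \prod_(g | g != 1%g) (round_trip g * act g (beta * q)).
have Rrest : diag_orbit rest.
  apply: (subr_M R); first exact: diag_orbit_round.
  by apply: (subr_prod R) => g _; apply: diag_orbit_conj; apply: (subr_M R).
pose D := \prod_g act g (beta * q).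
have DE : D = q * rest.
  have bE : beta = round_trip 1%g * \prod_(g | g != 1%g) round_trip g by rewrite /beta (bigD1 1%g).
  by rewrite /D (bigD1 1%g) //= act1 /rest big_split /= {1}bE; ring.
have D0 : D != 0 by apply/prodf_neq0 => g _; rewrite fmorph_eq0 mulf_neq0.
have Di : inv_by act [set: G] D.
  move=> g _; rewrite rmorph_prod [RHS](reindex_inj (mulgI g)).
  by apply: eq_bigr => h _; rewrite actM.
have [d ed Rd] : exists2 d, emb d = D & gring (d%:M : M).
  by apply: diag_orbit_scalar => //; rewrite DE; apply: (subr_M R).
have [b eb Rb] : exists2 b, emb b = f * D & gring (b%:M : M).
  apply: diag_orbit_scalar; first by rewrite DE fE mulrA divfK //; apply: (subr_M R).
  by move=> g Gg; rewrite rmorphM fi ?Di.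
exists (b / d); first by rewrite fmorph_div eb ed mulfK.
apply/(cp_localizationP _ (@gcp_var_neq0 F G k) (@gcp_var_inj F G k)).
exists b%:M, d; split=> //; first by rewrite -(fmorph_eq0 emb) ed.
by rewrite scale_scalar_mx mulrC.
Qed.

Lemma center_scalar (z : generic_center F G k) : exists a, gc_val z = a%:M.
Proof.
have /generic_centerP/cp_center_scalar := gc_valP z.
exact (fun h => h (@gcp_var_neq0 F G k) (@gcp_var_inj F G k)).
Qed.

Lemma center_walk (a : gcp_field F G k) : @generic_crossed_product F G k (a%:M : M) ->
  fixed_in act walk_field (emb a).
Proof.
have WF := walk_fieldF.
move/(cp_localizationP _ (@gcp_var_neq0 F G k) (@gcp_var_inj F G k)).
move=> [r [d [Rr Rd d0 e]]].
have FF := fixed_in_field act WF.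
have diag (r' : M) : gring r' -> forall b, r' = b%:M -> fixed_in act walk_field (emb b).
  move=> Rr' b eb; have [w i] := ring_entries Rr' 1%g 1%g.
  rewrite eb mxE eqxx mulr1n mulfK ?xv_neq0 // in w i.
  by split=> // g _; rewrite i mxE eqxx mulr1n.
have -> : a = d^-1 * (d * a) by rewrite mulKf.
rewrite rmorphM fmorphV; apply: (subr_M (subf_ring FF)).
  by apply: (subf_V FF); apply: (diag _ Rd).
by apply: (diag _ Rr); rewrite (unfrac_mx d0 e) scale_scalar_mx.
Qed.

(** A central element is a scalar matrix, and [kappa] reads the scalar off at the vertex 1. *)
Theorem center_embedding : exists kappa : {rmorphism generic_center F G k -> Om},
  (forall w, image_of kappa w <-> fixed_in act walk_field w) /\
  (forall c, kappa (@gc_embed F G k c) = emb (gcp_const F G k c)).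
Proof.
pose i1 : 'I_#|G| := enum_rank 1%g.
pose kap (z : generic_center F G k) : Om := emb (gc_val z i1 i1).
have kB : zmod_morphism kap.
  by move=> z z'; rewrite /kap /= !mxE rmorphB.
have kM : monoid_morphism kap.
  split=> [|z z']; first by rewrite /kap /= mxE eqxx rmorph1.
  have [a ea] := center_scalar z; have [b eb] := center_scalar z'.
  rewrite /kap /= ea eb -[_ * _]/(_ *m _) -scalar_mxM !mxE eqxx !mulr1n.
  by rewrite rmorphM.
pose kz := GRing.isZmodMorphism.Build _ _ kap kB.
pose km := GRing.isMonoidMorphism.Build _ _ kap kM.
pose kappa : {rmorphism generic_center F G k -> Om} := HB.pack kap kz km.
exists kappa; split=> [w|c]; last first.
  by rewrite /kappa /= /kap /= mxE eqxx mulr1n.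
split=> [[z ->]|[wf wi]].
  have [a ea] := center_scalar z; rewrite /kappa /= /kap ea mxE eqxx mulr1n.
  apply: center_walk; rewrite -ea; by have /generic_centerP[] := gc_valP z.
have [a ea Da] := walk_fixed_central wf wi.
have Za : (a%:M : M) \in @generic_center_pred F G k.
  exact/(cp_center_scalarP (gcp_const F G k) (@gcp_var F G k)).
by exists (GenericCenter Za); rewrite /kappa /= /kap /= mxE eqxx mulr1n.
Qed.

End Center.

(** * Stable rationality *)

Section Families.

Variables (K : fieldType) (k : K -> Prop) (kF : is_subfield k).

Lemma indep_scale (T : finType) (x c : T -> K) : (forall t, k (c t)) -> (forall t, c t != 0) ->
  indep k x -> indep k (fun t => c t * x t).
Proof.
move=> kc c0 ix s d us kd h; have kR := subf_ring kF.
have monE m : monom (fun t => c t * x t) m = monom c m * monom x m.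
  by rewrite /monom -big_split; apply: eq_bigr => t _; rewrite exprMn.
have mc0 m : monom c m != 0 by apply/prodf_neq0 => t _; rewrite expf_neq0.
have z : {in s, forall m, d m * monom c m = 0}.
  apply: ix => // [m|].
    by apply: (subr_M kR) => //; apply: (subr_prod kR) => t _; apply: (subr_X kR).
  by rewrite -[RHS]h; apply: eq_bigr => m _; rewrite monE mulrA.
by move=> m /z /eqP; rewrite mulf_eq0 (negPf (mc0 m)) orbF => /eqP.
Qed.

Lemma indep_lin (T : finType) (x c : T -> K) : indep k x -> (forall t, k (c t)) ->
  \sum_t c t * x t = 0 -> forall t, c t = 0.
Proof.
move=> ix kc h t; have kR := subf_ring kF.
pose U t' : {ffun T -> nat} := [ffun i => (i == t') : nat].
have Uinj : injective U.
  move=> a b /ffunP /(_ a); rewrite !ffunE eqxx => /esym/eqP.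
  by rewrite eqb1 => /eqP.
pose d m := \sum_(t' | U t' == m) c t'.
have dU t' : d (U t') = c t'.
  rewrite /d (bigD1 t') //= big1 ?addr0 // => b /andP[/eqP/Uinj -> /eqP] //.
have z : {in map U (enum T), forall m, d m = 0}.
  apply: ix.
  - by rewrite map_inj_uniq ?enum_uniq.
  - by move=> m; apply: (subr_sum kR).
  - rewrite big_map -[RHS]h big_enum; apply: eq_bigr => t' _.
    by rewrite dU monomU.
by rewrite -dU z // map_f ?mem_enum.
Qed.

Lemma subf_laurent (T : finType) (x : T -> K) v : (forall t, k (x t)) -> k (laurent x v).
Proof. by move=> kx; apply: (subr_prod (subf_ring kF)) => t _; apply: (subf_Xz kF). Qed.

Lemma adjoin_mono (S : K -> Prop) (T : finType) (x : T -> K) : is_subring S ->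
  (forall a, k a -> S a) -> forall w, adjoin k x w -> adjoin S x w.
Proof.
move=> SR kS; apply: adjoin_min; first exact: adjoin_field.
  by move=> a /kS; apply: adjoin_base.
exact: (adjoin_gen SR).
Qed.

Lemma adjoin_reindex (T T' : finType) (x : T -> K) (f : T' -> T) :
  (forall t, exists t', f t' = t) -> forall w, adjoin k x w -> adjoin k (x \o f) w.
Proof.
move=> f_surj; have kR := subf_ring kF; apply: adjoin_min; first exact: adjoin_field.
  by move=> a; apply: adjoin_base.
by move=> t; have [t' <-] := f_surj t; apply: (adjoin_gen kR (x \o f)).
Qed.

End Families.

(** * Transcendence bases of a field given as a subfield *)

Section PureBasis.

Variables (A K : fieldType) (S : K -> Prop) (SF : is_subfield S).
Local Notation E := (subf_type SF).
Variable kappa : {rmorphism A -> E}.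
Local Notation kappaK := ((val : {rmorphism E -> K}) \o kappa).
Variables (n : nat) (y : 'I_n -> E).

Lemma val_mmap p : val (mmap kappa y p) = mmap kappaK (val \o y) p.
Proof.
rewrite /mmap rmorph_sum; apply: eq_bigr => m _; rewrite rmorphM; congr (_ * _).
by rewrite /mmap1 rmorph_prod; apply: eq_bigr => i _; rewrite rmorphXn.
Qed.

Lemma pure_basis_lift : indep (image_of kappaK) (val \o y) ->
  (forall w, S w -> adjoin (image_of kappaK) (val \o y) w) -> pure_basis kappa y.
Proof.
move=> iy gy; split.
  move=> p hp; move/alg_independent_indep: iy; apply.
  by rewrite -val_mmap hp rmorph0.
move=> z; have [|_ [_ [/poly_in_mmap[p ->] /poly_in_mmap[q ->]]]] := gy (val z).
  exact/(subf_predP SF)/valP.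
rewrite -!val_mmap fmorph_eq0 => q0 e; exists p, q; split=> //.
by apply: val_inj; rewrite e -fmorph_div.
Qed.

End PureBasis.

Section SubfieldMorphisms.

Variables (A K : fieldType) (S : K -> Prop) (SF : is_subfield S).
Local Notation E := (subf_type SF).

Lemma subf_lift (f : {rmorphism A -> K}) : (forall a, S (f a)) ->
  exists g : {rmorphism A -> E}, forall a, val (g a) = f a.
Proof.
move=> Sf; pose g a : E := SubfType (introT (subf_predP SF _) (Sf a)).
have gB : zmod_morphism g by move=> a b; apply: val_inj; rewrite /= rmorphB.
have gM : monoid_morphism g.
  by split=> [|a b]; apply: val_inj; rewrite /= ?rmorph1 ?rmorphM.
pose gz := GRing.isZmodMorphism.Build _ _ g gB.
pose gm := GRing.isMonoidMorphism.Build _ _ g gM.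
pose h : {rmorphism A -> E} := HB.pack g gz gm.
by exists h.
Qed.

Lemma subf_pure_basis (kappa : {rmorphism A -> E}) (k : K -> Prop) (n : nat) (z : 'I_n -> K) :
  (forall i, S (z i)) ->
  (forall w, image_of ((val : {rmorphism E -> K}) \o kappa) w <-> k w) ->
  indep k z -> (forall w, S w -> adjoin k z w) -> exists y : 'I_n -> E, pure_basis kappa y.
Proof.
move=> Sz imk iz gz; exists (fun i => SubfType (introT (subf_predP SF _) (Sz i))).
apply: pure_basis_lift; first by apply: indep_sub iz => a /imk.
move=> w /gz; apply: adjoin_mono; first exact/subf_ring/image_of_field.
by move=> a /imk.
Qed.

End SubfieldMorphisms.

(** * Laurent monomials with exponents in a lattice *)

Section LaurentLattice.

Variables (K : fieldType) (T : finType) (x : T -> K).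
Hypothesis x0 : forall t, x t != 0.
Implicit Types v w : {ffun T -> int}.

Lemma laurent_ffun0 : laurent x (0 : {ffun T -> int}) = 1.
Proof. by rewrite /laurent big1 // => t _; rewrite ffunE. Qed.

Lemma laurent_ffunD v w : laurent x (v + w : {ffun T -> int}) = laurent x v * laurent x w.
Proof. by rewrite -laurentD //; apply: eq_laurent => t; rewrite ffunE. Qed.

Lemma laurent_ffunN v : laurent x (- v : {ffun T -> int}) = (laurent x v)^-1.
Proof. by rewrite -laurentN; apply: eq_laurent => t; rewrite ffunE. Qed.

Lemma laurent_ffunB v w : laurent x (v - w : {ffun T -> int}) = laurent x v / laurent x w.
Proof. by rewrite laurent_ffunD laurent_ffunN. Qed.

Lemma laurent_ffunMz v (a : int) : laurent x (v *~ a : {ffun T -> int}) = laurent x v ^ a.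
Proof. by rewrite -laurentZ; apply: eq_laurent => t; rewrite ffunMzE -mulrzl intz. Qed.

Lemma laurent_lincomb (I : finType) (phi : I -> {ffun T -> int}) (v : I -> int) :
  laurent x (\sum_i phi i *~ v i : {ffun T -> int}) = laurent (fun i => laurent x (phi i)) v.
Proof.
rewrite (big_morph (fun w : {ffun T -> int} => laurent x w) laurent_ffunD laurent_ffun0).
by apply: eq_bigr => i _; apply: laurent_ffunMz.
Qed.

Lemma laurent_span (S : K -> Prop) (I : finType) (P : pred I) (phi : I -> {ffun T -> int})
    (v : I -> int) : is_subfield S -> (forall i, P i -> S (laurent x (phi i))) ->
  S (laurent x (\sum_(i | P i) phi i *~ v i : {ffun T -> int})).
Proof.
move=> SF Sphi; elim/big_ind: _ => [|w w' Sw Sw'|i Pi].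
- by rewrite laurent_ffun0; apply: (subr_1 (subf_ring SF)).
- by rewrite laurent_ffunD; apply: (subr_M (subf_ring SF)).
- by rewrite laurent_ffunMz; apply: subf_Xz => //; apply: Sphi.
Qed.

End LaurentLattice.

(** * Equivariant chains attached to edges *)

Section Walks.

Variables (G : finGroupType) (n m : nat) (s t : G).
Hypothesis mg : metacyclic_gens n m s t.
Local Notation lattice := {ffun pidx s t -> int}.

Lemma translate_bas (g : G) p : translate g (bas p) = bas (pact g p) :> lattice.
Proof. exact: linext_bas. Qed.

Lemma eq_additive_bas (H : zmodType) (f f' : {additive lattice -> H}) :
  (forall p, f (bas p) = f' (bas p)) -> f =1 f'.
Proof.
move=> e v; rewrite [v]lattice_bas !raddf_sum; apply: eq_bigr => p _.
by rewrite (raddfMz f) (raddfMz f') e.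
Qed.

Lemma translate1 v : translate 1%g v = v :> lattice.
Proof.
apply: (eq_additive_bas (f := translate 1%g) (f' := idfun)) => p /=.
by rewrite translate_bas pact1.
Qed.

Lemma translateM g h v : translate (g * h)%g v = translate g (translate h v) :> lattice.
Proof.
apply: (eq_additive_bas (f := translate (g * h)%g) (f' := translate g \o translate h)) => p /=.
by rewrite !translate_bas pactM.
Qed.

(** Each pair has a unique translate starting at 1, where [lam] gives the chain; transporting it
    back makes [walk] equivariant although [lam] is not. *)
Definition walk (h x : G) : lattice := translate h (lam mg (h^-1 * x)%g).

Lemma walk_translate g h x : translate g (walk h x) = walk (g * h)%g (g * x)%g.
Proof. by rewrite /walk -translateM invMg -mulgA mulKg. Qed.

Lemma walk1 g : walk 1%g g = lam mg g.
Proof. by rewrite /walk translate1 invg1 mul1g. Qed.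

Lemma boundary_walk h x : boundary (walk h x) = vertex x - vertex h.
Proof.
pose f : {additive lattice -> {ffun G -> int}} := boundary (s:=s) (t:=t) \o translate h.
have E1 a : f (be1 s t a) = vertex (h * (a * t))%g - vertex (h * a)%g.
  by rewrite /f /= translate_bas /= mulgA; apply: linext_bas.
have E2 a : f (be2 s t a) = vertex (h * (a * (t * s)))%g - vertex (h * a)%g.
  by rewrite /f /= translate_bas /= mulgA; apply: linext_bas.
have /= := crossed_vertex mg (f := f) (u := fun a => vertex (h * a)%g) E1 E2 (h^-1 * x)%g.
by rewrite mulKVg mulg1.
Qed.

End Walks.

(** * The common field and its two descents *)

Section Assembly.

Variables (G : finGroupType) (n m : nat) (s t : G).
Hypothesis mg : metacyclic_gens n m s t.
Variables (ep om : int).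
Hypothesis bezout : n%:Z * ep + (2 * m)%:Z * om = 1.
Variables (F : fieldType) (zeta eta : F) (k : nat) (i0 : 'I_k).
Hypotheses (prim_zeta : n.-primitive_root zeta) (prim_eta : (2 * m).-primitive_root eta).

Local Notation pidx := (pidx s t).
Local Notation qidx := (qidx s t).
Local Notation edge := (G * G * 'I_k)%type.
Local Notation lattice := {ffun pidx -> int}.
Local Notation jrel := (@jrel G n m s t ep om).
Local Notation walk := (walk mg).
Local Notation chi_t := (chi_t mg eta).
Local Notation chi_s := (chi_s mg zeta).
Local Notation odd_t := (odd_t mg).

Variables (K : fieldType) (emb : {rmorphism gcp_field F G k -> K}).
Local Notation cst := (emb \o gcp_const F G k).
Local Notation consts := (image_of cst).
Local Notation X := (fun e : edge => xv emb e.1.1 e.1.2 e.2).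
Variables (y : pidx -> K) (w : option bool -> K).

Definition all_vars (e : edge + (pidx + option bool)) : K :=
  match e with inl e => X e | inr (inl p) => y p | inr (inr b) => w b end.
Hypothesis vars_indep : indep consts all_vars.

(** [None] stands for [y], [Some false] for [u] and [Some true] for [v]; [flip] exchanges the last
    two when the exponent of [t] is odd. *)
Definition twist (g : G) (b : option bool) : F :=
  match b with None => chi_t g | Some false => chi_s g | Some true => (chi_s g)^-1 end.
Definition flip (g : G) (b : option bool) : option bool := omap (addb (odd_t g)) b.

Variable act : G -> {rmorphism K -> K}.
Hypothesis act1 : forall a, act 1%g a = a.
Hypothesis actM : forall g h a, act (g * h)%g a = act g (act h a).
Hypothesis act_const : forall g c, act g (cst c) = cst c.
Hypothesis act_X : forall g h x i, act g (xv emb h x i) = xv emb (g * h)%g (g * x)%g i.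
Hypothesis act_y : forall g p, act g (y p) = y (pact g p).
Hypothesis act_w : forall g b, act g (w b) = cst (twist g b) * w (flip g b).
Hypothesis n_neq0 : n%:R != 0 :> K.
Hypothesis m2_neq0 : (2 * m)%:R != 0 :> K.

Let cF : is_subfield consts. Proof. exact: image_of_field. Qed.
Let cR : is_subring consts := subf_ring cF.

Let X0 h x i : xv emb h x i != 0. Proof. exact: xv_neq0. Qed.
Let y0 p : y p != 0. Proof. exact: (indep_neq0 cR vars_indep (inr (inl p))). Qed.

Let cardG_neq0 : #|G|%:R != 0 :> K.
Proof. by rewrite (mg_card mg) natrM mulf_neq0. Qed.

Local Notation tt := (tv emb i0).
Local Notation L := (walk_field emb i0).
Local Notation ell := (ell emb i0).

Let tt0 g : tt g != 0. Proof. exact: X0. Qed.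

Definition nb (p : pidx) : K := y p / laurent tt (boundary_of p).

Lemma nb_neq0 p : nb p != 0.
Proof. by rewrite mulf_neq0 ?invr_neq0 ?laurent_neq0. Qed.

(** On cycles, [nb] and [y] have the same monomials; this is where the two families of generators
    meet. *)
Lemma laurent_nb (v : lattice) : laurent nb v = laurent y v / laurent tt (boundary v).
Proof.
rewrite /boundary /linext laurent_lincomb // /laurent -prodfV -big_split.
by apply: eq_bigr => p _; rewrite expfzMl expfV.
Qed.

Lemma act_laurent g (v : lattice) : act g (laurent y v) = laurent y (translate g v).
Proof.
rewrite /translate /linext laurent_lincomb // /laurent rmorph_prod; apply: eq_bigr => p _.
rewrite fmorphXz act_y; congr (_ ^ _); rewrite -[LHS](laurentU y).
by apply: eq_laurent => q; rewrite ffunE.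
Qed.

Lemma act_tt g a : act g (tt a) = xv emb g (g * a)%g i0.
Proof. by rewrite /tv act_X mulg1. Qed.

(** The translated walk is based at [g]. Rewritten with walks based at 1, all factors [tv] cancel,
    so [L] is stable under [G]. *)
Lemma act_ell g e :
  act g (ell e) = ell (g, (g * e.1.1)%g, i0) * ell ((g * e.1.1)%g, (g * e.1.2)%g, e.2)
    / ell (g, (g * e.1.2)%g, i0).
Proof.
rewrite /ell !rmorphM fmorphV !act_tt act_X /=; field.
by rewrite !X0.
Qed.

Let L_F : is_subfield L. Proof. exact: walk_fieldF. Qed.
Let L_R : is_subring L := subf_ring L_F.
Let L_ell e : L (ell e). Proof. exact: (adjoin_gen cR ell). Qed.
Let L_cst c : L (cst c). Proof. exact: walk_const. Qed.

Let act_consts g a : consts a -> act g a = a.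
Proof. by case=> c ->; apply: act_const. Qed.

Lemma act_L g a : L a -> L (act g a).
Proof.
have act_field : is_subfield (fun a => L (act g a)).
  split; first split=> [|a' b' La Lb|a' b' La Lb].
  - by rewrite rmorph1; apply: subr_1.
  - by rewrite rmorphB; apply: (subr_B L_R).
  - by rewrite rmorphM; apply: (subr_M L_R).
  - by move=> a' La; rewrite fmorphV; apply: subf_V.
apply: (adjoin_min act_field) => [b [c ->]|e]; first by rewrite act_const; apply: L_cst.
rewrite act_ell; apply: subf_div => //; exact: (subr_M L_R).
Qed.

Definition edge_family (e : pidx + option bool) : K :=
  match e with inl p => nb p | inr b => w b end.

Let X_field : is_subfield (adjoin consts X). Proof. exact: adjoin_field. Qed.
Let X_gen h x i : adjoin consts X (xv emb h x i).
Proof. exact: (adjoin_gen cR X (h, x, i)). Qed.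

Lemma edge_family_indep : indep L edge_family.
Proof.
apply: (@indep_sub _ _ (adjoin consts X)).
  apply: (adjoin_min X_field) => [a|e]; first exact: adjoin_base.
  apply: (subf_div X_field); last exact: X_gen.
  by apply: (subr_M (subf_ring X_field)); apply: X_gen.
pose c (e : pidx + option bool) : K :=
  match e with inl p => (laurent tt (boundary_of p))^-1 | inr b => 1 end.
have := indep_scale X_field (c := c) _ _ (indep_untower cF vars_indep).
move=> h; apply: eq_indep (h _ _) => [[p|b]|[p|b]|[p|b]] /=.
- by rewrite mulrC.
- by rewrite mul1r.
- apply: (subf_V X_field); apply: (subf_laurent X_field) => g; exact: X_gen.
- exact: (subr_1 (subf_ring X_field)).
- by rewrite invr_neq0 ?laurent_neq0.
- exact: oner_neq0.
Qed.

Definition edge_perm g (e : pidx + option bool) : pidx + option bool :=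
  match e with inl p => inl (pact g p) | inr b => inr (flip g b) end.

(** The translate of [tv a] is [tv (g a) * ell (g, g a, i0) / tv g]. The factors [tv g] cancel
    because the boundary of an edge has degree zero, and what remains lies in [L]. *)
Definition edge_factor g (e : pidx + option bool) : K :=
  match e with
  | inl (inl (inl h)) => ell (g, (g * h)%g, i0) / ell (g, (g * (h * t))%g, i0)
  | inl (inl (inr h)) => ell (g, (g * h)%g, i0) / ell (g, (g * (h * (t * s)))%g, i0)
  | inl (inr _) => 1
  | inr b => cst (twist g b)
  end.

Lemma laurent_vertex a : laurent tt (vertex a) = tt a.
Proof. by rewrite -[RHS](laurentU tt); apply: eq_laurent => q; rewrite ffunE. Qed.

Lemma act_edge_family g e :
  act g (edge_family e) = edge_factor g e * edge_family (edge_perm g e).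
Proof.
case: e => [[[h|h]|p]|b] /=.
- rewrite /nb rmorphM fmorphV act_y /= !laurent_ffunB // !laurent_vertex fmorph_div !act_tt.
  by rewrite /ell /= !mulgA; field; rewrite !X0 /=.
- rewrite /nb rmorphM fmorphV act_y /= !laurent_ffunB // !laurent_vertex fmorph_div !act_tt.
  by rewrite /ell /= !mulgA; field; rewrite !X0 /=.
- have e0 : boundary_of (inr p) = 0 by case: p => [?|[?|?]].
  rewrite mul1r /nb e0 rmorphM fmorphV act_y laurent_ffun0 rmorph1; congr (_ / _).
  by case: p {e0} => [?|[?|?]]; rewrite /= laurent_ffun0.
- exact: act_w.
Qed.

Definition tower : K -> Prop := adjoin L edge_family.

Lemma descent_walk : exists z : 'I_#|{: pidx + option bool}| -> K,
  [/\ forall i, fixed_in act tower (z i), indep (fixed_in act L) z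
    & forall a, fixed_in act tower a -> adjoin (fixed_in act L) z a].
Proof.
(* This [ell] is the variable at [(1, 1, i0)], whose translates are distinct variables. *)
have b_inj : injective (fun g => act g (ell (1%g, 1%g, i0))).
  move=> g h; rewrite /ell /= mulfK ?X0 // !act_X !mulg1 => /fmorph_inj.
  by move/gcp_var_inj => [].
have := galois_descent act1 actM L_F act_L (L_ell _) b_inj cardG_neq0 edge_family_indep
  (pi := edge_perm) (d := edge_factor).
case.
- move=> g [[[h|h]|p]|b] /=.
  + exact: (subf_div L_F).
  + exact: (subf_div L_F).
  + exact: subr_1.
  + exact: L_cst.
- move=> [p|b] /=; first by rewrite pact1.
  by case: b => [b|] //=; rewrite /flip /= /odd_t (proj1 (nf_1 mg)).
- exact: act_edge_family.
- move=> z [z_in z_inv z_indep z_gen]; exists z; split=> // [i|a []].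
    by split; [exact: z_in | exact: z_inv].
  exact: z_gen.
Qed.

Definition base_field : K -> Prop := adjoin consts w.

Let k0F : is_subfield base_field. Proof. exact: adjoin_field. Qed.
Let k0R : is_subring base_field := subf_ring k0F.
Let k0_cst c : base_field (cst c). Proof. by apply: (adjoin_base cR); exists c. Qed.
Let k0_w b : base_field (w b). Proof. exact: (adjoin_gen cR w). Qed.

Lemma act_base_field g a : base_field a -> base_field (act g a).
Proof.
have act_field : is_subfield (fun a => base_field (act g a)).
  split; first split=> [|a' b' La Lb|a' b' La Lb].
  - by rewrite rmorph1; apply: subr_1.
  - by rewrite rmorphB; apply: (subr_B k0R).
  - by rewrite rmorphM; apply: (subr_M k0R).
  - by move=> a' La; rewrite fmorphV; apply: subf_V.
apply: (adjoin_min act_field) => [b [c ->]|b]; first by rewrite act_const; apply: k0_cst.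
by rewrite act_w; apply: (subr_M k0R).
Qed.

(** Orders the variables along the tower of the [w], then the [y], then the [x_e]. *)
Definition regroup (e : (option bool + pidx) + edge) : edge + (pidx + option bool) :=
  match e with inl (inl b) => inr (inr b) | inl (inr p) => inr (inl p) | inr e => inl e end.

Let regrouped_indep : indep consts (all_vars \o regroup).
Proof.
apply: indep_inj vars_indep => //; first exact: (indep_neq0 cR vars_indep).
by move=> [[b|p]|e] [[b'|p']|e'] // [->].
Qed.

Let wy_indep : indep consts (all_vars \o regroup \o inl).
Proof.
apply: indep_inj regrouped_indep => //; first exact: (indep_neq0 cR regrouped_indep).
by move=> e e' [].
Qed.

Let w_indep : indep consts w.
Proof.
have h : injective (inl : option bool -> option bool + pidx) by move=> e e' [].
have := indep_inj cR (indep_neq0 cR wy_indep) h wy_indep.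
exact.
Qed.

Definition loop_family (e : qidx + edge) : K :=
  match e with
  | inl q => laurent y (jrel q)
  | inr e => laurent y (- walk e.1.1 e.1.2 : lattice) * X e
  end.

(** The first part is a family of monomials in [y] with independent exponents, by [jrel_indep]; over
    the field of [w] and [y], the second part only rescales the [x_e]. *)
Lemma loop_family_indep : indep base_field loop_family.
Proof.
pose S := adjoin consts (all_vars \o regroup \o inl).
have SF : is_subfield S by apply: adjoin_field.
have Sw b : S (w b) := adjoin_gen cR (all_vars \o regroup \o inl) (inl b).
have Sy p : S (y p) := adjoin_gen cR (all_vars \o regroup \o inl) (inr p).
apply: (@indep_tower _ _ _ loop_family base_field S (subf_ring SF)).
- by apply: (adjoin_min SF) => // a; apply: adjoin_base.
- by move=> q; apply: (subf_laurent SF).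
- apply: (@indep_laurent _ _ _ _ y jrel k0R y0).
    move=> c hc; apply: (jrel_indep mg bezout); apply/ffunP => p.
    rewrite sum_ffunE ffunE -[RHS](hc p); apply: eq_bigr => q _.
    by rewrite ffunMzE -mulrzr intz mulrC.
  exact: (indep_untower cF wy_indep).
- apply: (indep_scale SF (c := fun e : edge => laurent y (- walk e.1.1 e.1.2 : lattice))).
  + by move=> e; apply: (subf_laurent SF).
  + by move=> e; apply: laurent_neq0.
  + exact: (indep_untower cF regrouped_indep).
Qed.

Definition loop_perm g (e : qidx + edge) : qidx + edge :=
  match e with
  | inl q => inl (jact g q)
  | inr e => inr ((g * e.1.1)%g, (g * e.1.2)%g, e.2)
  end.

Lemma act_loop_family g e : act g (loop_family e) = 1 * loop_family (loop_perm g e).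
Proof.
rewrite mul1r; case: e => [q|[[h x] i]] /=; first by rewrite act_laurent (translate_jrel mg).
by rewrite rmorphM act_X act_laurent raddfN /= walk_translate.
Qed.

Let act_w_seed g : act g (w None + w (Some false)) =
  cst (chi_t g) * w None + cst (chi_s g) * w (Some (odd_t g)).
Proof. by rewrite rmorphD !act_w /= addbF. Qed.

(** The stabilizer of [y + u] is trivial: by linear independence of [u], [v], [y], fixing it forces
    an even exponent of [t] and trivial [chi_t] and [chi_s]. *)
Let w_seed_inj : injective (fun g => act g (w None + w (Some false))).
Proof.
move=> g h /= e; apply: (mulgI h^-1%g); rewrite mulVg.
have {}e : act (h^-1 * g)%g (w None + w (Some false)) = w None + w (Some false).
  by rewrite actM e -actM mulVg act1.
move: (h^-1 * g)%g e => {g h} g; rewrite act_w_seed => e.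
(* The coefficients of [g (y + u) - (y + u)]. *)
pose c (b : option bool) : K := match b with
  | None => cst (chi_t g) - 1
  | Some b => cst (chi_s g) *+ (b == odd_t g) - (~~ b)%:R end.
have c0 : forall b, c b = 0.
  apply: (indep_lin cF w_indep) => [b|].
    have c1 : consts 1 by apply: subr_1.
    have cc x : consts (cst x) by exists x.
    case: b => [b|] /=; apply: (subr_B cR); [|exact: (subr_nat cR)|exact: cc|exact: c1].
    by rewrite -mulr_natl; apply: (subr_M cR); [apply: (subr_nat cR) | exact: cc].
  rewrite big_option_bool /=; move/eqP: e; rewrite -subr_eq0 => /eqP <-.
  by case: (odd_t g); rewrite /= ?mulr0n ?mulr1n; ring.
have := c0 (Some false); rewrite /c; case: (odd_t g) => /=.
  by rewrite mulr0n sub0r => /eqP; rewrite oppr_eq0 oner_eq0.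
move=> /eqP; rewrite mulr1n subr_eq0 => /eqP s1.
have := c0 None => /eqP; rewrite subr_eq0 => /eqP t1.
have cst_inj : injective cst by apply: fmorph_inj.
apply: (chi_faithful (mg := mg) prim_zeta prim_eta).
  by apply: cst_inj; rewrite t1 rmorph1.
by apply: cst_inj; apply: (etrans s1); apply/esym/rmorph1.
Qed.

Lemma descent_loop : exists z : 'I_#|{: qidx + edge}| -> K,
  [/\ forall i, fixed_in act (adjoin base_field loop_family) (z i),
      indep (fixed_in act base_field) z
    & forall a, fixed_in act (adjoin base_field loop_family) a ->
        adjoin (fixed_in act base_field) z a].
Proof.
have seed_in : base_field (w None + w (Some false)) by apply: (subr_D k0R).
have := galois_descent act1 actM k0F act_base_field seed_in w_seed_inj cardG_neq0
  loop_family_indep (pi := loop_perm) (d := fun _ _ => 1).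
case.
- by move=> *; apply: subr_1.
- by move=> [q|[[h x] i]] /=; rewrite ?jact1 ?mul1g.
- exact: act_loop_family.
- move=> z [z_in z_inv z_indep z_gen]; exists z; split; [by move=> i; split | by [] |].
  by move=> a [a_in a_inv]; apply: z_gen.
Qed.

Lemma nb_walk e : ell e = loop_family (inr e) * laurent nb (walk e.1.1 e.1.2).
Proof.
rewrite laurent_nb boundary_walk laurent_ffunB // !laurent_vertex /= laurent_ffunN //.
rewrite /ell; field.
by rewrite !X0 laurent_neq0.
Qed.

(** By [lattice_generated], each [nb p] is a monomial in those of the [jrel] and the [lam], which
    are loops or quotients of loops. Conversely, a loop on an edge is [ell e] divided by a monomial
    in [nb]. *)
Lemma tower_loop a : tower a <-> adjoin base_field loop_family a.
Proof.
have lF := adjoin_field k0R loop_family; have lR := subf_ring lF.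
have tF : is_subfield tower := adjoin_field L_R edge_family; have tR := subf_ring tF.
have l_gen e : adjoin base_field loop_family (loop_family e) := adjoin_gen k0R loop_family e.
have t_gen e : tower (edge_family e) := adjoin_gen L_R edge_family e.
have l_w b : adjoin base_field loop_family (w b) := adjoin_base k0R loop_family (k0_w b).
have l_cst c : adjoin base_field loop_family (cst c) := adjoin_base k0R loop_family (k0_cst c).
have t_L b : L b -> tower b := adjoin_base L_R edge_family (a := b).
have jrelE q : laurent nb (jrel q) = laurent y (jrel q).
  by rewrite laurent_nb boundary_jrel // laurent_ffun0 divr1.
have lamE g : laurent nb (lam mg g) = X (1%g, 1%g, i0) / loop_family (inr (1%g, g, i0)).
  rewrite laurent_nb boundary_lam laurent_ffunB // !laurent_vertex /= walk1 laurent_ffunN //.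
  by rewrite /tv; field; rewrite !X0 laurent_neq0.
(* The variable [t_1] left over in [lamE] is itself a loop, since [lam 1 = 0]. *)
have loopE : X (1%g, 1%g, i0) = loop_family (inr (1%g, 1%g, i0)).
  by rewrite /= walk1 lam1 oppr0 laurent_ffun0 mul1r.
have l_nb p : adjoin base_field loop_family (nb p).
  have [c [d e]] := lattice_generated mg bezout p.
  have <- : laurent nb (bas p) = nb p.
    by rewrite -[RHS](laurentU nb); apply: eq_laurent => q; rewrite ffunE.
  rewrite e laurent_ffunD; last exact: nb_neq0.
  apply: (subr_M lR); apply: laurent_span => //; try exact: nb_neq0.
    by move=> q _; rewrite jrelE; apply: (l_gen (inl q)).
  by move=> g _; rewrite lamE loopE; apply: (subf_div lF); apply: l_gen.
split.
- apply: (adjoin_min lF) => [b|[p|b]]; [|exact: l_nb|exact: l_w].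
  apply: (adjoin_min lF) => [_ [c ->]|e]; first exact: l_cst.
  by rewrite nb_walk; apply: (subr_M lR); [apply: l_gen | apply: (subf_laurent lF)].
apply: (adjoin_min tF) => [b|[q|e]].
- apply: (adjoin_min tF) => [_ [c ->]|b']; first exact/t_L/L_cst.
  exact: (t_gen (inr b')).
- by rewrite [loop_family _]/= -jrelE; apply: (subf_laurent tF) => p; apply: (t_gen (inl p)).
- have n0 : laurent nb (walk e.1.1 e.1.2) != 0 by apply/laurent_neq0/nb_neq0.
  rewrite -[loop_family _](mulfK n0) -nb_walk; apply: (subf_div tF).
    exact/t_L/L_ell.
  by apply: (subf_laurent tF) => p; apply: (t_gen (inl p)).
Qed.

Let tower_fixed_field : is_subfield (fixed_in act tower).
Proof. exact: fixed_in_field (adjoin_field L_R edge_family). Qed.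

Lemma tower_rational : exists (N : nat) (z : 'I_N -> K),
  [/\ forall i, fixed_in act tower (z i), indep consts z
    & forall a, fixed_in act tower a -> adjoin consts z a].
Proof.
have [z [z_in z_indep z_gen]] := descent_loop.
have [t_s t_t s_s s_t [odd_s odd_t1]] := chi_gens mg prim_zeta prim_eta.
have rootz : n.-primitive_root (cst zeta) by rewrite fmorph_primitive_root.
have roote : (2 * m).-primitive_root (cst eta) by rewrite fmorph_primitive_root.
have cc c : consts (cst c) by exists c.
have su : act s (w (Some false)) = cst zeta * w (Some false).
  by rewrite act_w /= s_s odd_s.
have sv : act s (w (Some true)) = (cst zeta)^-1 * w (Some true).
  by rewrite act_w [twist _ _]/= s_s [flip _ _]/= odd_s (fmorphV cst).
have sy : act s (w None) = w None by rewrite act_w /= t_s rmorph1 mul1r.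
have tu : act t (w (Some false)) = w (Some true).
  by rewrite act_w /= s_t odd_t1 rmorph1 mul1r.
have tv : act t (w (Some true)) = w (Some false).
  by rewrite act_w /= s_t odd_t1 invr1 rmorph1 mul1r.
have ty : act t (w None) = cst eta * w None by rewrite act_w /= t_t.
pose base := base_gen n m w.
pose S := fixed_in act base_field; have SF : is_subfield S := fixed_in_field act k0F.
have base_in j : S (base j).
  split; first exact: base_gen_in.
  exact: (base_gen_inv mg act1 actM cF rootz roote n_neq0 m2_neq0 w_indep su sv sy tu tv ty).
pose fam (j : (unit + 'I_2) + 'I_#|{: qidx + edge}|) : K :=
  match j with inl j => base j | inr i => z i end.
have fam_indep : indep consts fam.
  apply: (@indep_tower _ _ _ fam consts S (subf_ring SF)).
  - move=> a ca; split; first exact: (adjoin_base cR).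
    by move=> g _; apply: act_consts.
  - exact: base_in.
  - exact: (base_gen_indep mg cF rootz roote n_neq0 m2_neq0 w_indep).
  - exact: z_indep.
have famF := adjoin_field cR fam.
have fam_gen a : fixed_in act tower a -> adjoin consts fam a.
  move=> [/tower_loop a_in a_inv]; have := z_gen a (conj a_in a_inv).
  apply: (adjoin_min famF) => [b [b_in b_inv]|i]; last exact: (adjoin_gen cR fam (inr i)).
  have := base_gen_generate mg act1 actM cF act_consts (cc zeta) (cc eta) rootz roote
    n_neq0 m2_neq0 w_indep su sv sy tu tv ty b_in (b_inv s (in_setT s)) (b_inv t (in_setT t)).
  apply: (adjoin_min famF) => [c cc'|j]; first exact: (adjoin_base cR).
  exact: (adjoin_gen cR fam (inl j)).
exists #|{: (unit + 'I_2) + 'I_#|{: qidx + edge}|}|, (fam \o enum_val); split.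
- move=> i /=; case: (enum_val i) => [j|l] /=.
    have [b_in b_inv] := base_in j; split; last exact: b_inv.
    apply/tower_loop.
    exact: (adjoin_base k0R).
  have [b_in b_inv] := z_in l; split; last exact: b_inv.
  exact/tower_loop.
- exact: (indep_inj cR (indep_neq0 cR fam_indep) (@enum_val_inj _ _) fam_indep).
- move=> a /fam_gen; apply: (adjoin_reindex cF) => j.
  by exists (enum_rank j); rewrite enum_rankK.
Qed.

Theorem walk_center_stably_rational : stably_rational_ext (@gc_embed F G k).
Proof.
have act_var g h x i : act g (emb (gcp_var F h x i)) = emb (gcp_var F (g * h)%g (g * x)%g i).
  exact: act_X.
have [kappa [kappa_im kappa_cst]] := center_embedding act1 actM act_const act_var i0.
have L_tower a : fixed_in act L a -> fixed_in act tower a.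
  by case=> La a_inv; split=> //; apply: (adjoin_base L_R).
have [kappaE kappaE_val] := subf_lift tower_fixed_field (f := kappa)
  (fun a => L_tower _ (proj1 (kappa_im _) (ex_intro _ a erefl))).
have [z [z_in z_indep z_gen]] := descent_walk.
have [N [r [r_in r_indep r_gen]]] := tower_rational.
have [zE zE_basis] : exists zE : 'I_#|{: pidx + option bool}| -> _, pure_basis kappaE zE.
  apply: (subf_pure_basis z_in _ z_indep z_gen) => a.
  by rewrite -kappa_im; split=> -[b ->]; exists b; rewrite /= kappaE_val.
have [rE rE_basis] : exists rE : 'I_N -> _, pure_basis (kappaE \o (@gc_embed F G k)) rE.
  apply: (subf_pure_basis r_in _ r_indep r_gen) => a.
  by split=> -[b ->]; exists b; rewrite /= kappaE_val kappa_cst.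
by exists #|{: pidx + option bool}|, _, kappaE, zE; split=> //; exists N, rE.
Qed.

End Assembly.

Theorem corollary1p2 (G : finGroupType) (n m : nat)
    (n_ge1 : (1 <= n)%N) (m_ge1 : (1 <= m)%N)
    (coprime_n_2m : coprime n (2 * m))
    (presG : ([set: G] \isog
      Grp (s : t : s ^+ n = t ^+ (2 * m)%N = 1, t * s * t^-1 = s^-1))%g)
    (F : fieldType) (charF0 : [pchar F] =i pred0)
    (primF : exists z : F, #|G|.-primitive_root z)
    (k : nat) (k_ge1 : (1 <= k)%N) :
  stably_rational_ext (@gc_embed F G k).
Proof.
have [s [t mg]] := metacyclic_presentation n_ge1 m_ge1 coprime_n_2m presG.
have [ep [om bezout]] : exists ep om : int, n%:Z * ep + (2 * m)%:Z * om = 1.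
  have [u [v e]] := Bezoutz n (2 * m)%N; exists u, v.
  by rewrite mulrC [_ * v]mulrC e /gcdz !absz_nat (eqP coprime_n_2m).
have [z] := primF; rewrite (mg_card mg) => z_prim.
have n_gt0 : (0 < n)%N := n_ge1.
have m2_gt0 : (0 < 2 * m)%N by rewrite muln_gt0.
have prim_zeta : n.-primitive_root (z ^+ (2 * m)%N).
  by have := exp_prim_root z_prim (2 * m)%N; rewrite (gcdn_idPl (dvdn_mull n (dvdnn _))) mulnK.
have prim_eta : (2 * m).-primitive_root (z ^+ n).
  by have := exp_prim_root z_prim n; rewrite (gcdn_idPl (dvdn_mulr _ (dvdnn n))) mulKn.
set zeta := z ^+ _ in prim_zeta; set eta := z ^+ _ in prim_eta.
(* A single rational function field carries the generic entries, the [y_p] and [u], [v], [y]; only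
   the last three are multiplied by roots of unity. *)
pose T := ((G * G * 'I_k) + (pidx s t + option bool))%type.
pose pi g (e : T) : T := match e with
  | inl e => inl ((g * e.1.1)%g, (g * e.1.2)%g, e.2)
  | inr (inl p) => inr (inl (pact g p))
  | inr (inr b) => inr (inr (flip mg g b))
  end.
pose a g (e : T) : F := if e is inr (inr b) then twist mg zeta eta g b else 1.
have [nft1 nfs1] := nf_1 mg.
have pi1 e : pi 1%g e = e.
  case: e => [[[h x] i]|[p|[b|]]] //=; first by rewrite !mul1g.
    by rewrite pact1.
  by rewrite /flip /= /odd_t nft1.
have piM g h e : pi (g * h)%g e = pi g (pi h e).
  case: e => [[[h' x] i]|[p|[b|]]] //=; first by rewrite !mulgA.
    by rewrite pactM.
  by rewrite /flip /= odd_tM addbA.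
have a1 e : a 1%g e = 1.
  case: e => [e|[p|[[]|]]] //=; first by rewrite /chi_s nfs1 expr0 invr1.
    by rewrite /chi_s nfs1.
  by rewrite /chi_t nft1.
have aM g h e : a (g * h)%g e = a h e * a g (pi h e).
  case: e => [e|[p|[[]|]]] /=; rewrite ?mulr1 //.
  - rewrite (chi_sM mg prim_zeta) invfM mulrC addbT; congr (_ * _).
    by case: (odd_t mg h) => //; apply: invrK.
  - by rewrite (chi_sM mg prim_zeta) mulrC addbF.
  - by rewrite (chi_tM mg prim_eta) mulrC.
have [act [act1 actM act_const act_var]] := rf_monomial_action pi1 piM a1 aM.
have inl_inj : injective (inl : G * G * 'I_k -> T) by move=> e e' [].
have [emb [emb_const emb_var]] := rf_embedding F inl_inj.
have {}emb_const c : emb (gcp_const F G k c) = rf_const F T c := emb_const c.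
have {}emb_var h x i : xv emb h x i = rf_var F (inl (h, x, i) : T) := emb_var (h, x, i).
have charT i : (0 < i)%N -> i%:R != 0 :> ratfun F T.
  move=> i0; rewrite -(rmorph_nat (rf_const F T)) fmorph_eq0.
  by have [/(_ charF0) -> _] := pcharf0P F; rewrite -lt0n.
apply: (@walk_center_stably_rational G n m s t mg ep om bezout F zeta eta k
  (Ordinal k_ge1) prim_zeta prim_eta (ratfun F T) emb (fun p => rf_var F (inr (inl p) : T))
  (fun b => rf_var F (inr (inr b) : T)) _ act act1 actM).
- apply: (@indep_sub _ _ (image_of (rf_const F T))).
    by move=> _ [c ->]; exists c; apply: emb_const.
  apply: eq_indep (@rf_var_indep F T); case=> [[[h x] i]|[p|b]].
  + exact: (esym (emb_var h x i)).
  + exact: erefl.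
  + exact: erefl.
- move=> g c; rewrite /= emb_const; exact: act_const.
- by move=> g h x i; rewrite !emb_var act_var rmorph1 mul1r.
- by move=> g p; rewrite act_var rmorph1 mul1r.
- move=> g b; apply: etrans (act_var g (inr (inr b))) _.
  exact: (congr1 (fun c => c * _) (esym (emb_const _))).
- exact: charT.
- exact: charT.
Qed.
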